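(* Let $X_j$, $j\in\mathbb N$, be zero-mean random processes on $[0,1]$ with continuous covariance functions satisfying the Basic assumption, let $Y_d$, $d\in\mathbb N$, be the associated additive random fields, and let $n^{Y_d}(\varepsilon)$ be their average case approximation complexity. Assume: (1) the sequence $\sum_{j=1}^d\bar\lambda_0^{X_j}\big/\sum_{j=1}^d\Lambda^{X_j}$, $d\in\mathbb N$, has a limit as $d\to\infty$, which is strictly less than $1$; let $\varepsilon_0\in(0,1]$ be the number such that $1-\varepsilon_0^2$ equals this limit; (2) $\max_{j=1,\dots,d}\bar\lambda_1^{X_j}=o\bigl(\sum_{j=1}^d\bar\Lambda^{X_j}\bigr)$ as $d\to\infty$; (3) there are a distribution function $U$ and a monotonic real sequence $(\ell_j)_{j\in\mathbb N}$ such that $$\frac{1}{\bar\Lambda^{X_j}}\sum_{k=1}^\infty\bar\lambda_k^{X_j}\,\mathbf 1\bigl(-\ln\bar\lambda_k^{X_j}-\ell_j\leqslant x\bigr)\to U(x),\quad j\to\infty,\quad\text{for all } x\in\mathbf C(U).$$ Let $\mathfrak s=1$ if $(\ell_j)_{j\in\mathbb N}$ is non-decreasing, and $\mathfrak s=-1$ if $(\ell_j)_{j\in\mathbb N}$ is non-increasing. Assume further: (4) there are a distribution function $W$ and a real sequence $(a_d)_{d\in\mathbb N}$ such that $$\frac{\sum_{j=1}^d\bar\Lambda^{X_j}\,\mathbf 1\bigl(\mathfrak s\cdot(\ell_j-a_d)\leqslant x\bigr)}{\sum_{m=1}^d\bar\Lambda^{X_m}}\to W(x),\quad d\to\infty,\quad\text{for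 all } x\in\mathbf C(W).$$ Then for every $\varepsilon\in(0,\varepsilon_0)$ $$n^{Y_d}(\varepsilon)\sim e^{a_d}\sum_{j=1}^d\bar\Lambda^{X_j}\int_0^{1-(\varepsilon/\varepsilon_0)^2}\exp\bigl\{F^{-1}(y)\bigr\}\,dy,\qquad d\to\infty,$$ where $F(x)=\int_{-\infty}^\infty U(x-\mathfrak s\cdot v)\,dW(v)$, $x\in\mathbb R$.
   Context: $\mathbb N=\{1,2,\dots\}$. $\mathbf 1(A)$ equals $1$ if the proposition $A$ is true and $0$ otherwise. A distribution function is a non-decreasing right-continuous function on $\mathbb R$ with limits $0$ at $-\infty$ and $1$ at $+\infty$. $\mathbf C(f)$ is the set of continuity points of $f$. For a distribution function $F$, $F^{-1}(y)=\inf\{x\in\mathbb R: F(x)\geqslant y\}$, $y\in(0,1)$. $a_d\sim b_d$ means $a_d/b_d\to1$ as $d\to\infty$. Setting. $X_j(t)$, $t\in[0,1]$, $j\in\mathbb N$, are zero-mean random processes with continuous covariance functions $\mathcal K^{X_j}(t,s)$. For each $d\in\mathbb N$, $Y_d(t)$, $t\in[0,1]^d$, is a zero-mean random field (a random element of $L_2([0,1]^d)$) with covariance function $\mathcal K^{Y_d}(t,s)=\sum_{j=1}^d\mathcal K^{X_j}(t_j,s_j)$, where $t=(t_1,\dots,t_d)$, $s=(s_1,\dots,s_d)$. Approximation complexity. Let $(\cdot,\cdot)_{2,d}$, $\|\cdot\|_{2,d}$ be the inner product and norm of $L_2([0,1]^d)$. For $n\in\mathbb N$ let $\mathcal A_n^{Y_d}=\{\sum_{m=1}^n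 (Y_d,\psi_m)_{2,d}\,\psi_m:\ \psi_m\in L_2([0,1]^d)\}$ and $e^{Y_d}(n)=\inf\{(\mathbb E\|Y_d-\widetilde Y\|_{2,d}^2)^{1/2}:\ \widetilde Y\in\mathcal A_n^{Y_d}\}$; let $e^{Y_d}(0)=(\mathbb E\|Y_d\|_{2,d}^2)^{1/2}<\infty$. For $\varepsilon\in(0,1)$, $n^{Y_d}(\varepsilon)=\min\{n\in\mathbb N:\ e^{Y_d}(n)\leqslant\varepsilon\, e^{Y_d}(0)\}$. Eigenvalues. $K^{X_j}$ is the covariance operator on $L_2([0,1])$, i.e. the integral operator with kernel $\mathcal K^{X_j}$; $(\lambda_k^{X_j})_{k\in\mathbb N}$ is its non-increasing sequence of eigenvalues (counted with multiplicity) with corresponding orthonormal eigenvectors $\psi_k^{X_j}$; if $K^{X_j}$ has finite rank $p$, one sets $\lambda_k^{X_j}=0$, $\psi_k^{X_j}\equiv0$ for $k>p$. $\Lambda^{X_j}=\sum_{k=1}^\infty\lambda_k^{X_j}$ is the trace. Basic assumption: for every $j\in\mathbb N$ the function identically equal to $1$ on $[0,1]$ is one of the eigenvectors $\psi_k^{X_j}$, $k\in\mathbb N$. Let $\bar\lambda_0^{X_j}$ be the eigenvalue corresponding to this eigenvector $1$, let $(\bar\lambda_k^{X_j})_{k\in\mathbb N}$ be the non-increasing sequence of the remaining eigenvalues, and $\bar\Lambda^{X_j}=\sum_{k\in\mathbb N}\bar\lambda_k^{X_j}=\Lambda^{X_j}-\bar\lambda_0^{X_j}$. Terms with $\bar\lambda_k^{X_j}=0$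 contribute $0$ to the sums in (3), and (3) implicitly includes that $\bar\Lambda^{X_j}>0$ for all sufficiently large $j$. *)

(* Defs.v *)
From HB Require Import structures.
From mathcomp Require Import all_boot all_order all_algebra.
From mathcomp Require Import all_classical all_reals all_analysis.

Set Implicit Arguments.
Unset Strict Implicit.
Unset Printing Implicit Defensive.

Import Order.TTheory GRing.Theory Num.Theory.
Import numFieldNormedType.Exports.

Local Open Scope classical_set_scope.
Local Open Scope ring_scope.

(** Indices are shifted: the object of index j >= 1 in the mathematical text
    is stored at index j - 1 (processes X_j and their spectra, coordinates of
    points of [0,1]^d, eigenvalues lambda_k).  Dimensions d, approximation
    ranks n, and the index k of [bar_eig] below are not shifted. *)

Section lebesgue_cube.
Context {R : realType}.

Definition leb01 : set (measurableTypeR R) -> \bar R :=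
  mrestr (@lebesgue_measure R) (measurable_itv `[0, 1]).

HB.instance Definition _ := Measure.on leb01.

Let leb01_setT : leb01 setT = 1%E.
Proof.
by rewrite /leb01/= /mrestr setTI lebesgue_measure_itv/= lte_fin ltr01 sube0.
Qed.

HB.instance Definition _ := Measure_isProbability.Build _ _ _ leb01 leb01_setT.

Definition tcons n (p : measurableTypeR R * n.-tuple R) : n.+1.-tuple R :=
  [tuple of (p.1 : R) :: p.2].

Let measurable_tcons n : measurable_fun setT (@tcons n).
Proof.
apply: measurable_cons; last exact: measurable_snd.
exact: (@measurable_fst _ _ (measurableTypeR R)).
Qed.

HB.instance Definition _ n := isMeasurableFun.Build _ _ _ _ (@tcons n)
  (@measurable_tcons n).

(** Lebesgue measure restricted to the cube [0,1]^d.  It is a measure on the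
    whole of R^d (d-tuples) that vanishes outside the cube, so values of
    functions outside the cube are irrelevant.  The recursion is over
    probability measures because products require sigma-finiteness. *)
Fixpoint leb_cube d : probability (d.-tuple R) R :=
  match d with
  | 0 => dirac [tuple]
  | d'.+1 => distribution (leb01 \x leb_cube d')%E (@tcons d')
  end.

Definition cube d : set (d.-tuple R) :=
  [set t | forall i : 'I_d, tnth t i \in `[0, 1]].

End lebesgue_cube.

Section random_functions.
Context {R : realType} {dO : measure_display} {Om : measurableType dO}.
Variable P : probability Om R.

Definition zero_mean_on (I : Type) (D : set I) (Z : I -> Om -> R) : Prop :=
  forall t, D t -> Z t \in Lfun P 2%:E /\ ('E_P[Z t] = 0)%E.

Definition covfun (I : Type) (Z : I -> Om -> R) (t s : I) : R :=
  fine (covariance P (Z t) (Z s)).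

End random_functions.

Section L2.
Context {R : realType} {dT : measure_display} {T : measurableType dT}.
Variable mu : {measure set T -> \bar R}.

Definition L2_inner (f g : T -> R) : R := \int[mu]_t (f t * g t).

Definition integral_operator (K : T -> T -> R) (f : T -> R) : T -> R :=
  fun t => \int[mu]_s (K t s * f s).

(** [lam] is the non-increasing sequence of the eigenvalues, counted with
    multiplicity, of the integral operator with kernel [K] (assumed to be
    nonnegative definite), with orthonormal eigenvectors [psi]; if there are
    only finitely many nonzero eigenvalues both sequences are padded with
    zeros.  Equality in L_2 is equality almost everywhere.  The last clause
    says that every nonzero eigenvalue is listed as many times as the dimension
    of its eigenspace. *)
Definition is_eigensystem (K : T -> T -> R)
    (lam : nat -> R) (psi : nat -> T -> R) : Prop :=
  [/\ nonincreasing_seq lam /\ (forall k, 0 <= lam k),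
      forall k, psi k \in Lfun mu 2%:E,
      forall k, {ae mu, forall t,
        integral_operator K (psi k) t = lam k * psi k t},
      (forall k l, lam k != 0 -> lam l != 0 ->
        L2_inner (psi k) (psi l) = (k == l)%:R) /\
      (forall k, lam k = 0 -> {ae mu, forall t, psi k t = 0}) &
      forall (m : R) (f : T -> R), m != 0 -> f \in Lfun mu 2%:E ->
        {ae mu, forall t, integral_operator K f t = m * f t} ->
        exists n (c : nat -> R),
          {ae mu, forall t, f t = \sum_(k < n | lam k == m) c k * psi k t}].

End L2.

Section approximation_complexity.
Context {R : realType}.
Context {dO dT : measure_display} {Om : measurableType dO}
  {T : measurableType dT}.
Variables (P : probability Om R) (mu : {measure set T -> \bar R}).
Variable Z : T -> Om -> R.
Local Open Scope ereal_scope.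

(** E || Z - sum_(m < n) (Z, psi_m) psi_m ||^2 *)
Definition mean_square_error n (psi : 'I_n -> T -> R) : \bar R :=
  \int[P]_w \int[mu]_t
    ((Z t w - \sum_(m < n) L2_inner mu (Z ^~ w) (psi m) * psi m t) ^+ 2)%R%:E.

(** For n = 0 the infimum is over a single value, (E || Z ||^2)^(1/2). *)
Definition approx_error n : \bar R :=
  ereal_inf [set mean_square_error psi `^ 2^-1 |
    psi in [set psi : 'I_n -> T -> R | forall m, psi m \in Lfun mu 2%:E]].

(** Smallest n >= 1 with relative error at most eps; the default value 0 is
    only taken if no such n exists. *)
Definition complexity (eps : R) : nat :=
  let admissible n := (0 < n)%N /\ approx_error n <= eps%:E * approx_error 0 in
  xget 0%N [set n | admissible n /\ forall m, admissible m -> (n <= m)%N].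

End approximation_complexity.

Section spectra.
Context {R : realType}.
Variables (lam : nat -> nat -> R) (k0 : nat -> nat).

Definition trace (j : nat) : R := limn (series (lam j)).

(** [bar_eig j 0] is the eigenvalue of X_j at the distinguished position [k0 j],
    and [bar_eig j 1], [bar_eig j 2], ... is the sequence of the remaining ones. *)
Definition bar_eig (j k : nat) : R :=
  if k is k'.+1 then lam j (bump (k0 j) k') else lam j (k0 j).

Definition bar_trace (j : nat) : R := \big[+%R/0]_(1 <= k <oo) bar_eig j k.

End spectra.

Section distribution_functions.
Context {R : realType}.

Definition quantile (F : R -> R) (y : R) : R := inf [set x | y <= F x].

(** x |-> int U(x - s v) dW(v); [cumulativeBounded 0 1] is the type of
    distribution functions. *)
Definition signed_convolution (U W : cumulativeBounded (0 : R) (1 : R)) (s : R)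
    : R -> R :=
  fun x => \int[lebesgue_stieltjes_measure W]_v U (x - s * v).

End distribution_functions.

(* Main.v *)
Require Import Defs.
From mathcomp Require Import all_boot all_order all_algebra.
From mathcomp Require Import all_classical all_reals all_analysis.
From mathcomp Require Import measurable_realfun.
From mathcomp Require Import ring lra zify.

Set Implicit Arguments.
Unset Strict Implicit.
Unset Printing Implicit Defensive.

Import Order.TTheory GRing.Theory Num.Theory.
Import numFieldNormedType.Exports.

Local Open Scope classical_set_scope.
Local Open Scope ring_scope.

(** The covariance operator of the additive field is the sum over the coordinates
    of the covariance operators of the processes, each acting on its own
    coordinate.  Since the constant function 1 is an eigenfunction of every
    summand, the other eigenfunctions have mean zero, and the whole operator is
    diagonalised: 1 is an eigenfunction whose eigenvalue is the sum of the
    distinguished eigenvalues, and a non-constant eigenfunction of the process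
    [X_i], evaluated at the coordinate [t_i], keeps its eigenvalue.  The best
    approximation of rank [n] projects onto the eigenfunctions of the largest
    eigenvalues, so the complexity is, up to a bounded error, the number of largest
    non-constant eigenvalues whose sum reaches [y_d * S_d], where [S_d] is the sum
    of all of them.  By the first assumption the share [y_d] tends to
    [y0 = 1 - (eps / eps0) ^+ 2].

    The lemmas [field_admissible_upper] and [field_admissible_lower] express this
    without sorting the spectrum: any finite list of eigenvalues with a large
    enough sum bounds the complexity from above, and for every level [theta] the
    total excess of the eigenvalues over [theta] yields a bound from below (the
    dual form of Ky Fan's inequality, [total_quad_upper]).  The square
    integrability and the measurability that a projection of paths requires come
    from a modification of the field.  That the eigenvalues add up to the
    integral of the variance, so that nothing of the variance escapes the listed
    spectrum, is Mercer's theorem ([mercer], [eigenvalue_sum_cvg]).  It rests on the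
    existence of an eigenfunction of a nonzero symmetric kernel
    ([kernel_eigenfunction]), obtained as a limit of normalised powers, and on the
    completeness of the list of eigenvalues.

    The asymptotic part is convex duality.  Put the mass [mu / S_d] at the point
    [- ln mu - a_d] for every non-constant eigenvalue [mu] of the first [d]
    processes.  The third and fourth assumptions say that this distribution
    converges to the convolution [F] ([mixture_sandwich]).  For a level [tau] let
    [h_d tau] be the mean of [max 0 (tau - exp x)] with respect to it.  Then the
    number [n] of largest eigenvalues needed satisfies
    [n * exp (- a_d) / S_d = sup_tau (tau * y_d - h_d tau)] up to a
    vanishing error ([spectrum_excess_lower], [spectrum_excess_upper]); the second
    assumption makes single eigenvalues negligible.  Mean excesses depend on the
    distribution function through monotone Riemann sums, so they converge
    ([mean_excess_close]), and the conjugate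
    [sup_tau (tau * y0 - h tau)] of the limit is the integral of [exp] of
    the quantile of [F] over the interval from 0 to [y0]
    ([excess_conjugate_le], [excess_conjugate_eq]).  *)

(** * Integration of real functions over a probability space *)

Section integral_toolkit.
Context {R : realType} {d : measure_display} {T : measurableType d}.
Variable mu : probability T R.
Implicit Types f g h : T -> R.

Definition L1 f := mu.-integrable [set: T] (EFin \o f).
Definition L2 f := measurable_fun [set: T] f /\ L1 (fun x => f x ^+ 2).
Definition bounded_measurable f :=
  measurable_fun [set: T] f /\ exists M : R, forall x, `|f x| <= M.

Lemma L1_measurable f : L1 f -> measurable_fun [set: T] f.
Proof. by move=> /measurable_int/measurable_EFinP. Qed.

Lemma le_L1 f g : measurable_fun [set: T] f -> L1 g ->
  (forall x, `|f x| <= g x) -> L1 f.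
Proof.
move=> mf ig fg; apply: le_integrable ig => //; first exact/measurable_EFinP.
by move=> x _; rewrite /= lee_fin (le_trans (fg x))// ler_norm.
Qed.

Lemma L1D f g : L1 f -> L1 g -> L1 (fun x => f x + g x).
Proof. by move=> fi gi; exact: (integrableD _ fi gi). Qed.

Lemma L1B f g : L1 f -> L1 g -> L1 (fun x => f x - g x).
Proof. by move=> fi gi; exact: (integrableB _ fi gi). Qed.

Lemma L1Zl c f : L1 f -> L1 (fun x => c * f x).
Proof. by move=> fi; exact: (integrableZl _ c fi). Qed.

Lemma L1Zr c f : L1 f -> L1 (fun x => f x * c).
Proof. by move=> fi; exact: (integrableZr _ c fi). Qed.

Lemma L1_sum I (s : seq I) (P : pred I) (F : I -> T -> R) :
  (forall i, P i -> L1 (F i)) -> L1 (fun x => \sum_(i <- s | P i) F i x).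
Proof.
move=> Fi; elim: s => [|i s IH].
  by under eq_fun do rewrite big_nil; exact: integrable0.
under eq_fun do rewrite big_cons.
have := Fi i; case: (P i) => // /(_ isT) Fi1; exact: L1D.
Qed.

Lemma bounded_L1 f : bounded_measurable f -> L1 f.
Proof.
move=> [mf [M fM]]; apply: (@le_L1 _ (cst M)) => //.
exact: finite_measure_integrable_cst.
Qed.

Lemma cst_bounded c : bounded_measurable (fun=> c).
Proof. by split => //; exists `|c|. Qed.

Lemma boundedD f g : bounded_measurable f -> bounded_measurable g ->
  bounded_measurable (fun x => f x + g x).
Proof.
move=> [mf [M fM]] [mg [N gN]]; split; first exact: measurable_funD.
by exists (M + N) => x; rewrite (le_trans (ler_normD _ _))// lerD.
Qed.

Lemma boundedM f g : bounded_measurable f -> bounded_measurable g ->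
  bounded_measurable (fun x => f x * g x).
Proof.
move=> [mf [M fM]] [mg [N gN]]; split; first exact: measurable_funM.
by exists (M * N) => x; rewrite normrM ler_pM.
Qed.

Lemma bounded_mul_L1 f g : bounded_measurable f -> L1 g ->
  L1 (fun x => f x * g x).
Proof.
move=> [mf [M fM]] g1; apply: (@le_L1 _ (fun x => M * `|g x|)).
- by apply: measurable_funM => //; exact: L1_measurable.
- by apply: L1Zl; exact: integrable_norm.
- by move=> x; rewrite normrM ler_wpM2r.
Qed.

Lemma boundedZ c f : bounded_measurable f -> bounded_measurable (fun x => c * f x).
Proof. by apply: boundedM; exact: cst_bounded. Qed.

Lemma boundedB f g : bounded_measurable f -> bounded_measurable g ->
  bounded_measurable (fun x => f x - g x).
Proof.
move=> fb gb; under eq_fun do rewrite -mulN1r.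
by apply: boundedD => //; exact: boundedZ.
Qed.

Lemma bounded_sum I (s : seq I) (F : I -> T -> R) :
  (forall i, bounded_measurable (F i)) ->
  bounded_measurable (fun x => \sum_(i <- s) F i x).
Proof.
move=> Fb; elim: s => [|i s IH].
  by under eq_fun do rewrite big_nil; exact: cst_bounded.
by under eq_fun do rewrite big_cons; exact: boundedD.
Qed.

Lemma bounded_limit (F : nat -> T -> R) f (M : R) :
  (forall n, measurable_fun [set: T] (F n)) -> (forall n x, `|F n x| <= M) ->
  (forall x, F ^~ x @ \oo --> f x) -> bounded_measurable f.
Proof.
move=> mF FM Ff; split.
  by apply: (measurable_fun_cvg mF) => x _; exact: Ff.
exists M => x.
have H : (fun n => `|F n x|) @ \oo --> `|f x| by apply: cvg_norm; exact: Ff.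
exact: (cvgr_to_le H (nearW _ (fun n => FM n x))).
Qed.

Lemma bounded_L2 f : bounded_measurable f -> L2 f.
Proof.
by move=> fb; split; [exact: fb.1|apply: bounded_L1; exact: boundedM].
Qed.

Lemma L2_mul_L1 f g : L2 f -> L2 g -> L1 (fun x => f x * g x).
Proof.
move=> [mf f2] [mg g2].
apply: (@le_L1 _ (fun x => f x ^+ 2 + g x ^+ 2)).
- exact: measurable_funM.
- exact: L1D.
- by move=> x; rewrite ler_norml; apply/andP; split; nra.
Qed.

Lemma L2_L1 f : L2 f -> L1 f.
Proof.
move=> f2; rewrite (_ : f = fun x => f x * 1); last first.
  by apply/funext => x; rewrite mulr1.
by apply: L2_mul_L1 => //; exact/bounded_L2/cst_bounded.
Qed.

Lemma L2D f g : L2 f -> L2 g -> L2 (fun x => f x + g x).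
Proof.
move=> f2 g2; split; first by apply: measurable_funD; [case: f2|case: g2].
under eq_fun do rewrite sqrrD.
apply: L1D; last by case: g2.
apply: L1D; first by case: f2.
under eq_fun do rewrite -mulr_natl.
by apply: L1Zl; exact: L2_mul_L1.
Qed.

Lemma bounded_mul_L2 f g : bounded_measurable f -> L2 g ->
  L2 (fun x => f x * g x).
Proof.
move=> fb [mg g2]; split; first by apply: measurable_funM => //; case: fb.
under eq_fun do rewrite exprMn.
by apply: bounded_mul_L1 => //; exact: boundedM.
Qed.

Lemma L2Z c f : L2 f -> L2 (fun x => c * f x).
Proof. by apply: bounded_mul_L2; exact: cst_bounded. Qed.

Lemma L2B f g : L2 f -> L2 g -> L2 (fun x => f x - g x).
Proof.
move=> fi gi; under eq_fun do rewrite -mulN1r.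
by apply: L2D => //; exact: L2Z.
Qed.

Lemma L2_sum I (s : seq I) (F : I -> T -> R) :
  (forall i, L2 (F i)) -> L2 (fun x => \sum_(i <- s) F i x).
Proof.
move=> Fi; elim: s => [|i s IH].
  by under eq_fun do rewrite big_nil; exact/bounded_L2/cst_bounded.
by under eq_fun do rewrite big_cons; exact: L2D.
Qed.

Lemma L2_Lfun f : L2 f <-> f \in Lfun mu 2%:E.
Proof.
split=> [[mf /integrableP[_ f2]]|fL].
  rewrite inE; apply/andP; split; rewrite inE//= /finite_norm unlock /Lnorm.
  rewrite poweR_lty//; apply: le_lt_trans f2.
  under eq_integral => x _ do rewrite poweR_EFin powR_mulrn// -normrX.
  exact: lexx.
split; last exact: Lfun2_integrable_sqr.
by move: fL; rewrite inE => /andP[]; rewrite inE.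
Qed.

Lemma ae_eq_Rintegral f g : measurable_fun [set: T] f ->
  measurable_fun [set: T] g -> {ae mu, forall x, f x = g x} ->
  \int[mu]_x f x = \int[mu]_x g x.
Proof.
move=> mf mg fg; congr fine; apply: ae_eq_integral => //.
- exact/measurable_EFinP.
- exact/measurable_EFinP.
- by apply: filterS fg => x /= -> _.
Qed.

Lemma RintD f g : L1 f -> L1 g ->
  \int[mu]_x (f x + g x) = \int[mu]_x f x + \int[mu]_x g x.
Proof. by move=> *; exact: RintegralD. Qed.

Lemma RintB f g : L1 f -> L1 g ->
  \int[mu]_x (f x - g x) = \int[mu]_x f x - \int[mu]_x g x.
Proof. by move=> *; exact: RintegralB. Qed.

Lemma RintZl c f : L1 f -> \int[mu]_x (c * f x) = c * \int[mu]_x f x.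
Proof. by move=> *; exact: RintegralZl. Qed.

Lemma RintZr c f : L1 f -> \int[mu]_x (f x * c) = (\int[mu]_x f x) * c.
Proof. by move=> *; exact: RintegralZr. Qed.

Lemma Rint_sum I (s : seq I) (F : I -> T -> R) : (forall i, L1 (F i)) ->
  \int[mu]_x (\sum_(i <- s) F i x) = \sum_(i <- s) \int[mu]_x F i x.
Proof.
move=> Fi; elim: s => [|i s IH].
  under eq_Rintegral do rewrite big_nil.
  by rewrite big_nil Rintegral_cst// mul0r.
under eq_Rintegral do rewrite big_cons.
by rewrite big_cons RintD ?IH//; exact: L1_sum.
Qed.

Lemma Rint_cst c : \int[mu]_x c = c.
Proof.
have m1 : (mu : {measure set T -> \bar R}) [set: T] = 1%E.
  exact: (probability_setT mu).
by rewrite Rintegral_cst// m1 mulr1.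
Qed.

Lemma Rint_le f g : L1 f -> L1 g -> (forall x, f x <= g x) ->
  \int[mu]_x f x <= \int[mu]_x g x.
Proof. by move=> fi gi fg; apply: le_Rintegral. Qed.

Lemma RintE f : L1 f -> (\int[mu]_x f x)%:E = (\int[mu]_x (f x)%:E)%E.
Proof. by move=> fi; rewrite /Rintegral fineK//; exact: integrable_fin_num. Qed.

Lemma norm_Rintegral_le f M : L1 f -> (forall x, `|f x| <= M) ->
  `|\int[mu]_x f x| <= M.
Proof.
move=> fi fM; apply: le_trans; first exact: le_normr_Rintegral.
rewrite -[leRHS]Rint_cst; apply: Rint_le => //; first exact: integrable_norm.
exact/bounded_L1/cst_bounded.
Qed.

Lemma Rintegral_eq0_ae f : L1 f -> (forall x, 0 <= f x) ->
  \int[mu]_x f x = 0 -> {ae mu, forall x, f x = 0}.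
Proof.
move=> f1 f0 If.
have : (\int[mu]_x `|(f x)%:E| = 0)%E.
  under eq_integral do rewrite gee0_abs ?lee_fin//.
  by rewrite -RintE// If.
move=> /ae_eq_integral_abs; move=> /(_ measurableT).
move=> H; have := H (proj2 (measurable_EFinP _ _) (L1_measurable f1)).
apply: filterS => x /= /(_ I).
by move=> [].
Qed.

Lemma bounded_convergence (F : nat -> T -> R) f (M : R) :
  (forall n, measurable_fun [set: T] (F n)) -> (forall n x, `|F n x| <= M) ->
  (forall x, F ^~ x @ \oo --> f x) ->
  (fun n => \int[mu]_x F n x) @ \oo --> \int[mu]_x f x.
Proof.
move=> mF FM Ff; have bf := bounded_limit mF FM Ff.
have : (fun n => \int[mu]_x (F n x)%:E)%E @ \oo --> (\int[mu]_x (f x)%:E)%E.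
  apply: (@dominated_cvg _ _ _ mu _ measurableT
      (fun n x => (F n x)%:E) _ (fun=> M%:E)) => //.
  - by move=> n; exact/measurable_EFinP.
  - by move=> x _; apply/cvg_EFin; [exact: nearW|exact: Ff].
  - exact: finite_measure_integrable_cst.
  - by move=> n x _; rewrite /= lee_fin.
rewrite -RintE; last exact: bounded_L1.
by move=> /fine_cvg.
Qed.

Lemma cauchy_schwarz f g : L2 f -> L2 g ->
  (\int[mu]_x (f x * g x)) ^+ 2 <=
  (\int[mu]_x (f x ^+ 2)) * (\int[mu]_x (g x ^+ 2)).
Proof.
move=> f2 g2; set b := \int[mu]_x (f x * g x).
set a := \int[mu]_x _; set c := \int[mu]_x _.
have fg1 := L2_mul_L1 f2 g2.
have c0 : 0 <= c by apply: Rintegral_ge0 => x _; exact: sqr_ge0.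
(* the quadratic polynomial s -> || s f + t g ||^2 is nonnegative *)
have H s t : 0 <= s ^+ 2 * a + 2 * s * t * b + t ^+ 2 * c.
  have -> : s ^+ 2 * a + 2 * s * t * b + t ^+ 2 * c =
      \int[mu]_x ((s * f x + t * g x) ^+ 2).
    rewrite -!RintZl//; [|by case: g2|by case: f2].
    rewrite -RintD; [|apply: L1Zl; by case: f2|exact: L1Zl].
    rewrite -RintD; [|apply: L1D; [apply: L1Zl; by case: f2|exact: L1Zl]|
                   apply: L1Zl; by case: g2].
    by apply: eq_Rintegral => x _; ring.
  by apply: Rintegral_ge0 => x _; exact: sqr_ge0.
have [c00|cn0] := eqVneq c 0.
  have [->|bn0] := eqVneq b 0; first by rewrite c00 mulr0 expr0n.
  exfalso; have := H 1 (- (a + 1) / (2 * b)); rewrite c00.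
  have -> : 1 ^+ 2 * a + 2 * 1 * (- (a + 1) / (2 * b)) * b +
     (- (a + 1) / (2 * b)) ^+ 2 * 0 = -1 by field.
  lra.
have cp : 0 < c by rewrite lt_neqAle eq_sym cn0.
have := H c (- b).
have -> : c ^+ 2 * a + 2 * c * (- b) * b + (- b) ^+ 2 * c =
  c * (a * c - b ^+ 2) by ring.
by rewrite pmulr_rge0// subr_ge0.
Qed.

End integral_toolkit.

(** * Iterated integrals *)

Section real_fubini.
Context {R : realType} {d1 d2 : measure_display}.
Context {T1 : measurableType d1} {T2 : measurableType d2}.
Variables (mu : probability T1 R) (nu : probability T2 R).
Implicit Type F : T1 * T2 -> R.

Lemma measurable_section1 F x : measurable_fun [set: T1 * T2] F ->
  measurable_fun [set: T2] (fun y => F (x, y)).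
Proof. by move=> mF; apply: measurableT_comp mF (pair1_measurable x). Qed.

Lemma measurable_section2 F y : measurable_fun [set: T1 * T2] F ->
  measurable_fun [set: T1] (fun x => F (x, y)).
Proof. by move=> mF; apply: measurableT_comp mF (pair2_measurable y). Qed.

Lemma ae_L1_section1 F : L1 (mu \x nu)%E F ->
  {ae mu, forall x, L1 nu (fun y => F (x, y))}.
Proof. exact: ae_integrable1. Qed.

Lemma ae_L1_section2 F : L1 (mu \x nu)%E F ->
  {ae nu, forall y, L1 mu (fun x => F (x, y))}.
Proof. exact: ae_integrable2. Qed.

Lemma measurable_Rintegral1 F : L1 (mu \x nu)%E F ->
  measurable_fun [set: T1] (fun x => \int[nu]_y F (x, y)).
Proof.
move=> F1; apply: (measurableT_comp (fine_measurable measurableT)).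
exact: (measurable_fubini_F F1).
Qed.

Lemma measurable_Rintegral2 F : L1 (mu \x nu)%E F ->
  measurable_fun [set: T2] (fun y => \int[mu]_x F (x, y)).
Proof.
move=> F1; apply: (measurableT_comp (fine_measurable measurableT)).
exact: (measurable_fubini_G F1).
Qed.

Let ae1 F : L1 (mu \x nu)%E F ->
  {ae mu, forall x, [set: T1] x ->
    (fun x => \int[nu]_y (F (x, y))%:E)%E x = (\int[nu]_y F (x, y))%:E}.
Proof.
move=> /ae_L1_section1; apply: filterS => x Fx _.
by rewrite -RintE.
Qed.

Let ae2 F : L1 (mu \x nu)%E F ->
  {ae nu, forall y, [set: T2] y ->
    (fun y => \int[mu]_x (F (x, y))%:E)%E y = (\int[mu]_x F (x, y))%:E}.
Proof.
move=> /ae_L1_section2; apply: filterS => x Fx _.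
by rewrite -RintE.
Qed.

Lemma L1_Rintegral1 F : L1 (mu \x nu)%E F ->
  L1 mu (fun x => \int[nu]_y F (x, y)).
Proof.
move=> F1; apply/integrableP; split.
  exact/measurable_EFinP/measurable_Rintegral1.
have /integrableP[mF Ffin] := integrable_fubini_F F1.
apply: le_lt_trans Ffin; rewrite le_eqVlt; apply/orP; left; apply/eqP.
apply: ae_eq_integral => //.
- apply: measurableT_comp => //.
  exact/measurable_EFinP/measurable_Rintegral1.
- exact: measurableT_comp.
- by have := ae1 F1; apply: filterS => x H xT; congr abse; exact/esym/H.
Qed.

(** Only almost every section of an integrable function is integrable, so the
    passage from extended to real inner integrals is made almost everywhere. *)
Lemma real_Fubini1 F : L1 (mu \x nu)%E F ->
  \int[mu]_x \int[nu]_y F (x, y) = \int[(mu \x nu)%E]_p F p.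
Proof.
move=> F1; congr fine; rewrite -(integral12_prod_meas1 F1).
apply: ae_eq_integral => //.
- exact/measurable_EFinP/measurable_Rintegral1.
- exact: measurable_fubini_F F1.
- by have := ae1 F1; apply: filterS => x H xT; exact/esym/H.
Qed.

Lemma real_Fubini2 F : L1 (mu \x nu)%E F ->
  \int[nu]_y \int[mu]_x F (x, y) = \int[(mu \x nu)%E]_p F p.
Proof.
move=> F1; congr fine; rewrite -(integral21_prod_meas1 F1).
apply: ae_eq_integral => //.
- exact/measurable_EFinP/measurable_Rintegral2.
- exact: measurable_fubini_G F1.
- by have := ae2 F1; apply: filterS => x H xT; exact/esym/H.
Qed.

Lemma real_Fubini F : L1 (mu \x nu)%E F ->
  \int[mu]_x \int[nu]_y F (x, y) = \int[nu]_y \int[mu]_x F (x, y).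
Proof. by move=> F1; rewrite real_Fubini1// real_Fubini2. Qed.

Lemma L1_prod F : measurable_fun [set: T1 * T2] F ->
  (forall x, L1 nu (fun y => F (x, y))) ->
  L1 mu (fun x => \int[nu]_y `|F (x, y)|) -> L1 (mu \x nu)%E F.
Proof.
move=> mF Fx /integrableP[_ FF]; apply/integrable12ltyP.
  exact/measurable_EFinP.
apply: le_lt_trans FF; rewrite le_eqVlt; apply/orP; left; apply/eqP.
apply: eq_integral => x _.
rewrite gee0_abs; last by rewrite lee_fin; apply: Rintegral_ge0 => *.
by rewrite /= RintE//; exact: (integrable_norm (Fx x)).
Qed.

Lemma L1_mul_prod f g : L1 mu f -> L1 nu g ->
  L1 (mu \x nu)%E (fun p => f p.1 * g p.2).
Proof.
move=> f1 g1; apply: L1_prod => [|x|].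
- apply: measurable_funM.
  + exact: measurableT_comp (L1_measurable f1) measurable_fst.
  + exact: measurableT_comp (L1_measurable g1) measurable_snd.
- exact: (L1Zl (f x) g1).
- have ng1 : L1 nu (fun y => `|g y|) by exact: (integrable_norm g1).
  rewrite (_ : (fun _ => _) = fun x => `|f x| * \int[nu]_y `|g y|).
    by apply: L1Zr; exact: (integrable_norm f1).
  by apply/funext => x; rewrite -RintZl//; apply: eq_Rintegral => y _; rewrite normrM.
Qed.

Lemma bounded_comp {d d'} {S : measurableType d} {S' : measurableType d'}
    (f : S -> R) (g : S' -> S) :
  bounded_measurable f -> measurable_fun [set: S'] g ->
  bounded_measurable (fun x => f (g x)).
Proof.
move=> [mf [M fM]] mg; split; first exact: measurableT_comp.
by exists M => x; exact: fM.
Qed.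

Lemma bounded_section1 F x : bounded_measurable F ->
  bounded_measurable (fun y => F (x, y)).
Proof. by move=> /bounded_comp; apply; exact: pair1_measurable. Qed.

Lemma bounded_section2 F y : bounded_measurable F ->
  bounded_measurable (fun x => F (x, y)).
Proof. by move=> /bounded_comp; apply; exact: pair2_measurable. Qed.

Lemma bounded_Rintegral1 F : bounded_measurable F ->
  bounded_measurable (fun x => \int[nu]_y F (x, y)).
Proof.
move=> Fb; split; first exact/measurable_Rintegral1/bounded_L1.
have [M FM] := Fb.2; exists M => x; apply: norm_Rintegral_le => //.
exact/bounded_L1/bounded_section1.
Qed.

End real_fubini.

Section real_fubini_swap.
Context {R : realType} {d1 d2 : measure_display}.
Context {T1 : measurableType d1} {T2 : measurableType d2}.
Variables (mu : probability T1 R) (nu : probability T2 R).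
Implicit Type F : T1 * T2 -> R.

Lemma L1_swap F : L1 (mu \x nu)%E F -> L1 (nu \x mu)%E (fun p => F (p.2, p.1)).
Proof.
move=> F1; have mF := L1_measurable F1.
apply/integrable12ltyP.
  apply/measurable_EFinP; apply: (measurableT_comp mF).
  exact: measurable_swap.
by apply/(integrable21ltyP mu nu (f := EFin \o F)) => //; exact/measurable_EFinP.
Qed.

Lemma L1_Rintegral2 F : L1 (mu \x nu)%E F ->
  L1 nu (fun y => \int[mu]_x F (x, y)).
Proof. by move=> /L1_swap/L1_Rintegral1. Qed.

Lemma bounded_Rintegral2 F : bounded_measurable F ->
  bounded_measurable (fun y => \int[mu]_x F (x, y)).
Proof.
move=> Fb; apply: (@bounded_Rintegral1 _ _ _ _ _ nu mu (fun p => F (p.2, p.1))).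
by apply: bounded_comp Fb _; exact: measurable_swap.
Qed.

End real_fubini_swap.

(** * Log-convex submultiplicative sequences *)

Section submultiplicative_log_convex.
Context {R : realType}.
Variable b : nat -> R.
Hypothesis b_gt0 : forall n, 0 < b n.
Hypothesis b_logconvex : forall n, b n.+1 ^+ 2 <= b n * b n.+2.
Hypothesis b_submul : forall n m, b (n + m).+1 <= b n * b m.

Let r n := b n.+1 / b n.

Let r_gt0 n : 0 < r n. Proof. by rewrite divr_gt0. Qed.

Let r_nd : nondecreasing_seq r.
Proof.
apply/nondecreasing_seqP => n; rewrite /r ler_pdivrMr// mulrAC ler_pdivlMr//.
by rewrite -expr2 mulrC b_logconvex.
Qed.

Let r_cvg : cvgn r.
Proof.
apply: nondecreasing_is_cvgn => //; exists (b 0) => _ [n _ <-].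
by rewrite /r ler_pdivrMr// mulrC -[in leLHS](addn0 n) b_submul.
Qed.

(** Log-convexity makes the ratios of consecutive terms increase to a limit
    [rho], so the normalised sequence decreases.  Submultiplicativity bounds it
    from below: passing from a large [m] to [m + n.+1] multiplies it by almost 1,
    but also by at most [b n / rho ^+ n.+1]. *)
Lemma growth_rate : exists2 rho, 0 < rho &
  [/\ forall n, 1 <= b n / rho ^+ n.+1, nonincreasing_seq (fun n => b n / rho ^+ n.+1) &
      cvgn (fun n => b n / rho ^+ n.+1)].
Proof.
pose rho := limn r.
have r_le n : r n <= rho by exact: nondecreasing_cvgn_le.
have rho0 : 0 < rho := lt_le_trans (r_gt0 0) (r_le 0).
have rhon n : 0 < rho ^+ n by rewrite exprn_gt0.
exists rho => //; set x := fun n => _.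
have x_gt0 n : 0 < x n by rewrite divr_gt0.
have xS n : x n.+1 = x n * (r n / rho).
  rewrite /x /r exprS; field.
  by rewrite expf_neq0 ?gt_eqF// gt_eqF.
have x_ni : nonincreasing_seq x.
  apply/nonincreasing_seqP => n; rewrite xS ger_pMr//.
  by rewrite ler_pdivrMr// mul1r.
split => //; last first.
  apply: nonincreasing_is_cvgn => //; exists 0 => _ [n _ <-].
  exact: ltW.
move=> n.
(* x (m + k) / x m is a product of k ratios, each at least r m / rho *)
have x_low m k : x m * (r m / rho) ^+ k <= x (m + k)%N.
  elim: k => [|k IH]; first by rewrite addn0 expr0 mulr1.
  rewrite addnS xS exprSr mulrA ler_pM//.
  - by rewrite mulr_ge0 ?exprn_ge0 ?divr_ge0// ltW.
  - by rewrite divr_ge0// ltW.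
  - by rewrite ler_pM2r ?invr_gt0// r_nd// leq_addr.
have x_submul m : x (m + n.+1)%N <= x m * x n.
  rewrite addnS /x mulrACA -invfM -exprD [(m.+1 + _)%N]addSn addnS.
  by rewrite ler_pM2r ?invr_gt0.
have H m : (r m / rho) ^+ n.+1 <= x n.
  by rewrite -(ler_pM2l (x_gt0 m)) (le_trans (x_low _ _)).
have lim1 : (fun m => (r m / rho) ^+ n.+1) @ \oo --> (1 : R).
  rewrite -[X in _ --> X](expr1n _ n.+1).
  apply: (@continuous_cvg _ _ _ _ _ (fun m => r m / rho)
            (fun y : R => y ^+ n.+1)); first exact: exprn_continuous.
  rewrite -[X in _ --> X](divff (lt0r_neq0 rho0)).
  exact: cvgMr_tmp.
exact: (cvgr_to_le lim1 (nearW _ H)).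
Qed.

End submultiplicative_log_convex.

(** * Bounded kernels and their powers *)

Section kernels.
Context {R : realType} {d : measure_display} {T : measurableType d}.
Variable mu : probability T R.
Implicit Types K L : T -> T -> R.

Definition bounded_kernel K := bounded_measurable (fun p : T * T => K p.1 p.2).

Definition kernel_comp K L t s := \int[mu]_u (K t u * L u s).

(** The index is shifted: this is the kernel of the [n.+1]-st power of the
    operator, since the identity operator has no kernel. *)
Fixpoint kernel_pow K n :=
  if n is n'.+1 then kernel_comp K (kernel_pow K n') else K.

Definition hilbert_schmidt K L :=
  \int[(mu \x mu)%E]_p (K p.1 p.2 * L p.1 p.2).

Lemma bounded_kernelE K t : bounded_kernel K -> bounded_measurable (K t).
Proof. exact: bounded_section1. Qed.

Lemma bounded_kernelEr K s : bounded_kernel K -> bounded_measurable (K^~ s).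
Proof. exact: bounded_section2. Qed.

Lemma bounded_kernel_section K L t s : bounded_kernel K -> bounded_kernel L ->
  bounded_measurable (fun u => K t u * L u s).
Proof.
by move=> Kb Lb; apply: boundedM; [exact: bounded_kernelE|exact: bounded_kernelEr].
Qed.

Lemma bounded_kernel_comp K L : bounded_kernel K -> bounded_kernel L ->
  bounded_kernel (kernel_comp K L).
Proof.
move=> Kb Lb; rewrite /bounded_kernel /kernel_comp.
apply: (@bounded_Rintegral1 _ _ _ _ _ (mu \x mu)%E mu
  (fun p => K p.1.1 p.2 * L p.2 p.1.2)).
apply: boundedM.
- apply: (bounded_comp (g := fun p : (T * T) * T => (p.1.1, p.2)) Kb).
  apply: measurable_fun_pair => //.
  exact: (measurableT_comp measurable_fst measurable_fst).
- apply: (bounded_comp (g := fun p : (T * T) * T => (p.2, p.1.2)) Lb).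
  apply: measurable_fun_pair => //.
  exact: (measurableT_comp measurable_snd measurable_fst).
Qed.

Lemma bounded_kernel_pow K n : bounded_kernel K -> bounded_kernel (kernel_pow K n).
Proof. by move=> Kb; elim: n => //= n IH; exact: bounded_kernel_comp. Qed.

Lemma kernel_apply_Fubini K (f g : T -> R) : bounded_kernel K ->
  L1 mu f -> L1 mu g ->
  \int[mu]_t (f t * \int[mu]_s (K t s * g s)) =
  \int[mu]_s ((\int[mu]_t (f t * K t s)) * g s).
Proof.
move=> Kb f1 g1.
have fKg : L1 (mu \x mu)%E (fun p => K p.1 p.2 * (f p.1 * g p.2)).
  by apply: bounded_mul_L1 => //; exact: L1_mul_prod.
have Kg t : L1 mu (fun s => K t s * g s).
  by apply: bounded_mul_L1 => //; exact: bounded_kernelE.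
have fK s : L1 mu (fun t => f t * K t s).
  under eq_fun do rewrite mulrC.
  by apply: bounded_mul_L1 => //; exact: bounded_kernelEr.
transitivity (\int[mu]_t \int[mu]_s (K t s * (f t * g s))).
  apply: eq_Rintegral => t _; rewrite -RintZl//.
  by apply: eq_Rintegral => s _; ring.
rewrite (real_Fubini fKg); apply: eq_Rintegral => s _; rewrite -RintZr//.
by apply: eq_Rintegral => t _; ring.
Qed.

Lemma kernel_compA K L M : bounded_kernel K -> bounded_kernel L ->
  bounded_kernel M ->
  kernel_comp K (kernel_comp L M) = kernel_comp (kernel_comp K L) M.
Proof.
move=> Kb Lb Mb; apply/funext => t; apply/funext => s.
apply: kernel_apply_Fubini => //.
- exact/bounded_L1/bounded_kernelE.
- exact/bounded_L1/bounded_kernelEr.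
Qed.

Lemma kernel_powD K n m : bounded_kernel K ->
  kernel_pow K (n + m).+1 = kernel_comp (kernel_pow K n) (kernel_pow K m).
Proof.
move=> Kb; elim: n => [//|n IH]; rewrite addSn.
change (kernel_comp K (kernel_pow K (n + m).+1) =
  kernel_comp (kernel_comp K (kernel_pow K n)) (kernel_pow K m)).
by rewrite IH kernel_compA//; exact: bounded_kernel_pow.
Qed.

Lemma bounded_kernelM K L : bounded_kernel K -> bounded_kernel L ->
  bounded_kernel (fun t s => K t s * L t s).
Proof. exact: boundedM. Qed.

Lemma hilbert_schmidtE K L : bounded_kernel K -> bounded_kernel L ->
  hilbert_schmidt K L = \int[mu]_t \int[mu]_s (K t s * L t s).
Proof.
move=> Kb Lb; rewrite (real_Fubini1 (F := fun p => K p.1 p.2 * L p.1 p.2))//.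
by apply: bounded_L1; exact: boundedM.
Qed.

Lemma hilbert_schmidt_ge0 K : 0 <= hilbert_schmidt K K.
Proof. by apply: Rintegral_ge0 => p _; rewrite -expr2 sqr_ge0. Qed.

Lemma hilbert_schmidt_CS K L : bounded_kernel K -> bounded_kernel L ->
  hilbert_schmidt K L ^+ 2 <= hilbert_schmidt K K * hilbert_schmidt L L.
Proof.
move=> Kb Lb; apply: (@cauchy_schwarz _ _ _ (mu \x mu)%E) => //;
  exact: bounded_L2.
Qed.

Lemma hilbert_schmidt_adj K L M : bounded_kernel K -> bounded_kernel L ->
  bounded_kernel M -> (forall t s, K t s = K s t) ->
  hilbert_schmidt (kernel_comp K L) M = hilbert_schmidt L (kernel_comp K M).
Proof.
move=> Kb Lb Mb Ksym.
have KLb := bounded_kernel_comp Kb Lb; have KMb := bounded_kernel_comp Kb Mb.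
rewrite /hilbert_schmidt -real_Fubini2; last first.
  by apply: bounded_L1; exact: bounded_kernelM.
rewrite -real_Fubini2; last first.
  by apply: bounded_L1; exact: bounded_kernelM.
apply: eq_Rintegral => s _ /=.
have LKM := kernel_apply_Fubini Kb (bounded_L1 mu (bounded_kernelEr s Mb))
  (bounded_L1 mu (bounded_kernelEr s Lb)).
transitivity (\int[mu]_t (M t s * kernel_comp K L t s)).
  by apply: eq_Rintegral => t _; rewrite mulrC.
rewrite /kernel_comp LKM; apply: eq_Rintegral => t _; rewrite mulrC; congr (_ * _).
by apply: eq_Rintegral => u _; rewrite mulrC Ksym.
Qed.

End kernels.

(** In the application [C^-1 * (u n - u k) ^+ 2] is at most the squared distance
    of two vectors whose inner products depend only on the sum of the indices,
    hence form a convergent, and therefore Cauchy, array. *)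
Lemma cvgn_of_gram {R : realType} (u x : nat -> R) (C : R) :
  (forall n k, (u n - u k) ^+ 2 <=
     C * (x (n + n)%N - 2 * x (n + k)%N + x (k + k)%N)) ->
  cvgn x -> cvgn u.
Proof.
move=> ux /cvg_ex[/= l xl]; apply/cauchy_cvgP/cauchy_exP => e e0.
pose c : R := 1 + `|C|.
have C1 : 0 < c by rewrite ltr_pwDl.
pose del : R := e ^+ 2 / (8 * c).
have del0 : 0 < del by rewrite divr_gt0// ?exprn_gt0// mulr_gt0.
have /cvgrPdist_lt /(_ _ del0) [N _ xN] := xl.
exists (u N), N => // n /= Nn.
have near m p : (N <= m)%N -> `|l - x (m + p)%N| < del.
  by move=> Nm; apply: xN; rewrite /= (leq_trans Nm)// leq_addr.
have := near N N (leqnn N); have := near n n Nn; have := near N n (leqnn N).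
rewrite !ltr_norml => /andP[a1 a2] /andP[b1 b2] /andP[c1 c2].
rewrite /ball/= -ltr_sqr ?nnegrE// ?normr_ge0 ?ltW// real_normK ?num_real//.
apply: (le_lt_trans (ux N n)).
set y := x (N + N)%N - _ + _.
have yy : `|y| <= 4 * del by rewrite /y ler_norml; lra.
apply: (@le_lt_trans _ _ (c * (4 * del))).
  apply: le_trans (ler_norm _) _; rewrite normrM ler_pM//.
  by rewrite lerDr.
have -> : c * (4 * del) = e ^+ 2 / 2 by rewrite /del; field; rewrite gt_eqF.
by rewrite ltr_pdivrMr// ltr_pMr ?exprn_gt0// ltr1n.
Qed.

Section kernel_eigenfunction.
Context {R : realType} {d : measure_display} {T : measurableType d}.
Variables (mu : probability T R) (K : T -> T -> R).
Hypothesis Kb : bounded_kernel K.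
Hypothesis Ksym : forall t s, K t s = K s t.

Local Notation P := (kernel_pow mu K).
Local Notation hs := (hilbert_schmidt mu).

Let Pb n : bounded_kernel (P n). Proof. exact: bounded_kernel_pow. Qed.

Let hs_L1 L M : bounded_kernel L -> bounded_kernel M ->
  L1 (mu \x mu)%E (fun p => L p.1 p.2 * M p.1 p.2).
Proof. by move=> Lb Mb; apply: bounded_L1; exact: boundedM. Qed.

Let b k := hs (P k) (P k).

Let hs_shift n m : hs (P n.+1) (P m) = hs (P n) (P m.+1).
Proof. exact: hilbert_schmidt_adj. Qed.

Let hsD n m : hs (P n) (P m) = hs (P 0) (P (n + m)).
Proof. by elim: n m => [//|n IH] m; rewrite hs_shift IH addnS. Qed.

Let b_logconvex k : b k.+1 ^+ 2 <= b k * b k.+2.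
Proof.
have -> : b k.+1 = hs (P k) (P k.+2) by rewrite /b hsD [RHS]hsD addSn !addnS.
exact: hilbert_schmidt_CS.
Qed.

(** The Cauchy-Schwarz inequality in the inner variable. *)
Lemma hilbert_schmidt_comp_le L M : bounded_kernel L -> bounded_kernel M ->
  hs (kernel_comp mu L M) (kernel_comp mu L M) <= hs L L * hs M M.
Proof.
move=> Lb Mb; have LMb := bounded_kernel_comp mu Lb Mb.
pose f t := \int[mu]_u (L t u ^+ 2); pose g s := \int[mu]_u (M u s ^+ 2).
have fb : bounded_measurable f.
  apply: (bounded_Rintegral1 mu mu (F := fun p => L p.1 p.2 ^+ 2)).
  exact: (boundedM Lb Lb).
have gb : bounded_measurable g.
  apply: (bounded_Rintegral2 mu mu (F := fun p => M p.1 p.2 ^+ 2)).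
  exact: (boundedM Mb Mb).
have fg1 : L1 (mu \x mu)%E (fun p => f p.1 * g p.2).
  by apply: L1_mul_prod; exact: bounded_L1.
have -> : hs L L * hs M M = \int[(mu \x mu)%E]_p (f p.1 * g p.2).
  rewrite -(real_Fubini1 fg1)/= hilbert_schmidtE//.
  have -> : hs M M = \int[mu]_s g s.
    rewrite /hs -real_Fubini2 ?bounded_L1//; exact: boundedM.
  rewrite -RintZr; last exact: bounded_L1.
  by apply: eq_Rintegral => t _; rewrite RintZl//; exact: bounded_L1.
apply: Rint_le => //.
  by apply: bounded_L1; exact: boundedM.
move=> [t s] /=; rewrite -expr2; apply: cauchy_schwarz.
- exact/bounded_L2/bounded_kernelE.
- exact/bounded_L2/bounded_kernelEr.
Qed.

Let b_submul n m : b (n + m).+1 <= b n * b m.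
Proof. by rewrite /b kernel_powD//; exact: hilbert_schmidt_comp_le. Qed.

Let b_ge0 n : 0 <= b n. Proof. exact: hilbert_schmidt_ge0. Qed.

Hypothesis b1_neq0 : hs (P 1) (P 1) != 0.

Let b_gt0 n : 0 < b n.
Proof.
have b1 : 0 < b 1 by rewrite lt_neqAle eq_sym b1_neq0 b_ge0.
have b0 : 0 < b 0.
  rewrite lt_neqAle b_ge0 andbT; apply/eqP => b00.
  by have := b_submul 0 0; rewrite -b00 mul0r leNgt b1.
suff : 0 < b n /\ 0 < b n.+1 by case.
elim: n => [|n [bn bn1]]; [by split|split; first exact: bn1].
rewrite lt_neqAle b_ge0 andbT; apply/eqP => b00.
by have := b_logconvex n; rewrite -b00 mulr0 leNgt exprn_gt0.
Qed.

(** The power method.  The inner products of the powers of a symmetric kernel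
    depend only on the total exponent, so their norms are log-convex and
    submultiplicative and [growth_rate] provides the normalisation.  The
    normalised even powers [Q n] are a Cauchy sequence in the Hilbert-Schmidt
    norm; composing with [K] on both sides upgrades this to convergence at
    every point.  The limit [H] has norm at least 1, and its columns are
    eigenfunctions of the square of [K]. *)
Lemma kernel_sqr_eigenfunction : exists2 rho : R, 0 < rho &
  exists f : T -> R, [/\ bounded_measurable f, \int[mu]_t (f t ^+ 2) != 0 &
    forall t, \int[mu]_u (P 1 t u * f u) = rho * f t].
Proof.
have [rho rho0 [x_ge1 x_ni x_cvg]] := growth_rate b_gt0 b_logconvex b_submul.
set x := fun n => _ in x_ge1 x_ni x_cvg.
exists rho => //.
pose Q n t s := P (n + n).+1 t s * (rho ^+ n.+1)^-1.
have Qb n : bounded_kernel (Q n) by exact: (boundedM (Pb (n + n).+1) (cst_bounded _)).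
have hsQ n k : hs (Q n) (Q k) = x (n + k).+1.
  transitivity (hs (P (n + n).+1) (P (k + k).+1) * (rho ^+ (n + k).+2)^-1).
    rewrite -RintZr; last exact: hs_L1.
    apply: eq_Rintegral => p _; rewrite /Q.
    have -> : ((n + k).+2 = n.+1 + k.+1)%N by rewrite addSn addnS.
    by rewrite exprD invfM; ring.
  have e : ((n + n).+1 + (k + k).+1 = (n + k).+1 + (n + k).+1)%N by lia.
  by rewrite /x /b (hsD (n + n).+1) e -hsD.
pose D n k t s := Q n t s - Q k t s.
have Db n k : bounded_kernel (D n k) by exact: (boundedB (Qb n) (Qb k)).
have hsDD n k : hs (D n k) (D n k) = x (n + n).+1 - 2 * x (n + k).+1 + x (k + k).+1.
  have QQ i j : L1 (mu \x mu)%E (fun p => Q i p.1 p.2 * Q j p.1 p.2).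
    exact: hs_L1.
  rewrite -!hsQ -RintZl// -RintB//; last exact: L1Zl.
  rewrite -RintD//; last by apply: L1B => //; exact: L1Zl.
  by apply: eq_Rintegral => p _; rewrite /D; ring.
have QS n t s : Q n.+1 t s = rho^-1 * kernel_comp mu K (kernel_comp mu (Q n) K) t s.
  have -> : kernel_comp mu (Q n) K =
      fun t s => (rho ^+ n.+1)^-1 * kernel_comp mu (P (n + n).+1) K t s.
    apply/funext => v; apply/funext => w; rewrite -RintZl.
      by apply: eq_Rintegral => u _; rewrite /Q; ring.
    exact/bounded_L1/bounded_kernel_section.
  rewrite -(kernel_powD _ (n + n).+1 0)// addn0.
  rewrite /Q addSn addnS exprS invfM.
  have -> : P (n + n).+3 = kernel_comp mu K (P (n + n).+2) by [].
  rewrite [LHS]mulrC -mulrA; congr (_ * _).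
  transitivity (\int[mu]_u ((rho ^+ n.+1)^-1 * (K t u * P (n + n).+2 u s))).
    by apply/esym; apply: RintZl; exact/bounded_L1/bounded_kernel_section.
  by apply: eq_Rintegral => u _; ring.
have [M KM] := Kb.2.
pose C := (M ^+ 2 / rho) ^+ 2.
(* K L K is bounded in the uniform norm by the Hilbert-Schmidt norm of L *)
have sup_le L t s : bounded_kernel L ->
    (rho^-1 * kernel_comp mu K (kernel_comp mu L K) t s) ^+ 2 <= C * hs L L.
  move=> Lb.
  have K2 v w : K v w ^+ 2 <= M ^+ 2.
    by rewrite -[leLHS]real_normK ?num_real// lerXn2r ?nnegrE// ?(KM (v, w))//
       (le_trans _ (KM (v, w))).
  have IK2 f : (forall u, f u ^+ 2 <= M ^+ 2) -> bounded_measurable f ->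
      \int[mu]_u (f u ^+ 2) <= M ^+ 2.
    move=> fM fb; rewrite -[leRHS](Rint_cst mu); apply: Rint_le => //.
      by apply: bounded_L1; exact: (boundedM fb fb).
    exact/bounded_L1/cst_bounded.
  have LKb := bounded_kernel_comp mu Lb Kb.
  rewrite exprMn /C exprMn exprVn mulrAC mulrC; apply: ler_wpM2r.
    by rewrite invr_ge0 exprn_ge0// ltW.
  apply: le_trans (cauchy_schwarz (bounded_L2 mu (bounded_kernelE t Kb))
     (bounded_L2 mu (bounded_kernelEr s LKb))) _.
  rewrite -exprM (_ : (2 * 2 = 2 + 2)%N)// exprD -mulrA.
  apply: ler_pM.
  - by apply: Rintegral_ge0 => u _; exact: sqr_ge0.
  - by apply: Rintegral_ge0 => u _; exact: sqr_ge0.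
  - by apply: IK2 => //; exact: bounded_kernelE.
  have L2b : bounded_measurable (fun p : T * T => L p.1 p.2 * L p.1 p.2).
    exact: boundedM.
  rewrite hilbert_schmidtE// -RintZl; last first.
    apply: bounded_L1; exact: (bounded_Rintegral1 mu mu L2b).
  apply: Rint_le => [||u].
  - have b1 := bounded_kernelEr s LKb.
    by apply: bounded_L1; exact: (boundedM b1 b1).
  - by apply: L1Zl; apply: bounded_L1; exact: (bounded_Rintegral1 mu mu L2b).
  apply: le_trans (cauchy_schwarz (bounded_L2 mu (bounded_kernelE u Lb))
     (bounded_L2 mu (bounded_kernelEr s Kb))) _.
  rewrite mulrC; apply: ler_wpM2r.
    by apply: Rintegral_ge0 => v _; exact: sqr_ge0.
  by apply: IK2 => //; exact: bounded_kernelEr.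
have C0 : 0 <= C by exact: sqr_ge0.
have Q_cvg t s : cvgn (fun n => Q n.+1 t s).
  apply: (@cvgn_of_gram _ _ (fun n => x n.+1) C) => [n k|]; last first.
    move/cvg_ex : x_cvg => [z xz]; apply/cvg_ex; exists z.
    by move: xz; rewrite -cvg_shiftS.
  rewrite -hsDD; apply: le_trans (sup_le _ t s (Db n k)).
  rewrite !QS -mulrBr /kernel_comp -RintB.
  - rewrite le_eqVlt; apply/orP; left; apply/eqP.
    congr ((_ * _) ^+ 2); apply: eq_Rintegral => u _.
    rewrite -mulrBr -RintB.
    + by congr (_ * _); apply: eq_Rintegral => v _; rewrite /D mulrBl.
    + exact/bounded_L1/bounded_kernel_section.
    + exact/bounded_L1/bounded_kernel_section.
  - apply/bounded_L1/(bounded_kernel_section (L := kernel_comp mu (Q n) K)) => //.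
    exact: bounded_kernel_comp.
  - apply/bounded_L1/(bounded_kernel_section (L := kernel_comp mu (Q k) K)) => //.
    exact: bounded_kernel_comp.
pose H t s := limn (fun n => Q n.+1 t s).
have QH t s : (fun n => Q n.+1 t s) @ \oo --> H t s by exact: Q_cvg.
pose B := 1 + C * x 0%N.
have QB n t s : `|Q n.+1 t s| <= B.
  have := sup_le _ t s (Qb n); rewrite -QS hsQ => QC.
  have : Q n.+1 t s ^+ 2 <= C * x 0%N.
    by apply: (le_trans QC); apply: ler_wpM2l => //; exact: x_ni.
  by rewrite /B ler_norml; set q := Q _ _ _; set c := C * _ => qc; nra.
have Hb : bounded_kernel H.
  apply: (@bounded_limit _ _ _ (fun n p => Q n.+1 p.1 p.2) _ B) => [n|n p|p].
  - exact: (Qb n.+1).1.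
  - exact: (QB n p.1 p.2).
  - exact: (QH p.1 p.2).
have hsH : 1 <= hs H H.
  have : (fun n => hs (Q n.+1) (Q n.+1)) @ \oo --> hs H H.
    apply: (@bounded_convergence _ _ _ _ _ _ (B * B)) => [n|n p|p].
    - exact: (boundedM (Qb n.+1) (Qb n.+1)).1.
    - by rewrite normrM ler_pM// QB.
    - by apply: cvgM; exact: (QH p.1 p.2).
  by move=> /cvgr_to_ge; apply; apply: nearW => n; rewrite hsQ; exact: x_ge1.
have H_eigen t s : \int[mu]_u (P 1 t u * H u s) = rho * H t s.
  have l1 : (fun n => \int[mu]_u (P 1 t u * Q n.+1 u s)) @ \oo -->
      \int[mu]_u (P 1 t u * H u s).
    have [N PN] := (Pb 1).2.
    apply: (@bounded_convergence _ _ _ _ _ _ (N * B)) => [n|n u|u].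
    - exact: (bounded_kernel_section t s (Pb 1) (Qb n.+1)).1.
    - by rewrite normrM ler_pM// ?QB ?(PN (t, u)).
    - by apply: cvgMl_tmp; exact: QH.
  have l2 : (fun n => \int[mu]_u (P 1 t u * Q n.+1 u s)) @ \oo --> rho * H t s.
    have -> : (fun n => \int[mu]_u (P 1 t u * Q n.+1 u s)) =
        fun n => rho * Q n.+2 t s.
      apply/funext => n; rewrite /Q.
      transitivity (kernel_comp mu (P 1) (P (n.+1 + n.+1).+1) t s
        * (rho ^+ n.+2)^-1).
        transitivity (\int[mu]_u (P 1 t u * P (n.+1 + n.+1).+1 u s * (rho ^+ n.+2)^-1)).
          by apply: eq_Rintegral => u _; rewrite mulrA.
        by apply: RintZr; exact/bounded_L1/bounded_kernel_section.
      rewrite -kernel_powD//.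
      have -> : ((1 + (n.+1 + n.+1).+1).+1 = (n.+2 + n.+2).+1)%N by lia.
      rewrite [rho ^+ n.+3]exprS [(rho * rho ^+ n.+2)^-1]invfM mulrCA.
      by rewrite (mulrA rho) divff ?mul1r// gt_eqF.
    by apply: cvgMl_tmp; have := QH t s; rewrite -(cvg_shiftS (fun n => Q n.+1 t s)).
  exact: (cvg_unique _ l1 l2).
have [s Hs] : exists s, \int[mu]_t (H t s ^+ 2) != 0.
  apply: contrapT => /forallNP H0; have := hsH.
  rewrite /hs -real_Fubini2; last by apply: bounded_L1; exact: boundedM.
  rewrite (_ : (fun y => _) = cst 0) ?Rint_cst ?ler10//.
  apply/funext => s; have /negP := H0 s; rewrite negbK => /eqP <-.
  by apply: eq_Rintegral => t _; rewrite expr2.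
exists (H^~ s); split => //; exact: bounded_kernelEr.
Qed.

(** If h is an eigenfunction of K^2 with eigenvalue m^2 then K h + m h is an
    eigenfunction of K with eigenvalue m, unless it vanishes, and then h is
    one with eigenvalue - m. *)
Lemma kernel_eigenfunction : exists (m : R) (f : T -> R),
  [/\ m != 0, bounded_measurable f, \int[mu]_t (f t ^+ 2) != 0 &
    {ae mu, forall t, \int[mu]_u (K t u * f u) = m * f t}].
Proof.
have [rho rho0 [h [hb h0 hE]]] := kernel_sqr_eigenfunction.
pose m := Num.sqrt rho.
have m0 : 0 < m by rewrite sqrtr_gt0.
have mm : m * m = rho by rewrite -expr2 sqr_sqrtr// ltW.
pose Kh t := \int[mu]_u (K t u * h u).
have Khb : bounded_measurable Kh.
  apply: (bounded_Rintegral1 mu mu (F := fun p => K p.1 p.2 * h p.2)).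
  apply: boundedM => //.
  exact: (bounded_comp hb measurable_snd).
have KKh t : \int[mu]_u (K t u * Kh u) = rho * h t.
  rewrite -hE; apply: kernel_apply_Fubini => //.
    exact/bounded_L1/bounded_kernelE.
  exact: bounded_L1.
have K1 f t : bounded_measurable f -> L1 mu (fun u => K t u * f u).
  by move=> fb; apply: bounded_L1; apply: boundedM => //; exact: bounded_kernelE.
pose g t := Kh t + m * h t.
have gb : bounded_measurable g by apply: boundedD => //; exact: boundedZ.
have [g0|g0] := eqVneq (\int[mu]_t (g t ^+ 2)) 0; last first.
  exists m, g; split => //; first by rewrite gt_eqF.
  apply: aeW => t; rewrite /g.
  transitivity (\int[mu]_u (K t u * Kh u + m * (K t u * h u))).
    by apply: eq_Rintegral => u _; ring.
  rewrite RintD; [|exact: K1|by apply: L1Zl; exact: K1].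
  by rewrite RintZl ?K1// KKh -mm /Kh; ring.
exists (- m), h; split => //; first by rewrite oppr_eq0 gt_eqF.
have := Rintegral_eq0_ae (bounded_L1 mu (boundedM gb gb)) (fun x => sqr_ge0 (g x)) g0.
apply: filterS => t /eqP; rewrite mulf_eq0 orbb /g addr_eq0 => /eqP.
by rewrite /Kh => ->; rewrite mulNr.
Qed.

End kernel_eigenfunction.

(** * Marginals of the cube and positive kernels *)

Section cube_measure.
Context {R : realType}.
Local Notation mu := (@leb01 R).

Lemma integral_leb_cubeS d (G : d.+1.-tuple R -> R) : bounded_measurable G ->
  \int[leb_cube d.+1]_t G t =
  \int[mu]_x \int[leb_cube d]_t G [tuple of x :: t].
Proof.
move=> Gb.
have mc : measurable_fun setT (@tcons R d) by exact: measurable_funPT.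
have Gcb : bounded_measurable (fun p => G (@tcons R d p)) by exact: bounded_comp mc.
rewrite (real_Fubini1 (F := fun p => G (@tcons R d p))); last exact: bounded_L1.
congr fine; rewrite integral_distribution//.
- exact: measurableT_comp Gb.1.
- exact: (bounded_L1 _ Gcb).
Qed.

Lemma bounded_tnth d (i : 'I_d) (f : R -> R) : bounded_measurable f ->
  bounded_measurable (fun t : d.-tuple R => f (tnth t i)).
Proof. by move=> /bounded_comp; apply; exact: measurable_tnth. Qed.

Lemma bounded_tnth2 d (i j : 'I_d) (F : R -> R -> R) : bounded_kernel F ->
  bounded_measurable (fun t : d.-tuple R => F (tnth t i) (tnth t j)).
Proof.
move=> Fb.
apply: (bounded_comp (g := fun t : d.-tuple R => (tnth t i, tnth t j)) Fb).
by apply: measurable_fun_pair; exact: measurable_tnth.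
Qed.

Lemma integral_cube_tnth d (i : 'I_d) (f : R -> R) : bounded_measurable f ->
  \int[leb_cube d]_t f (tnth t i) = \int[mu]_x f x.
Proof.
elim: d i => [[]//|d IH] i fb.
rewrite integral_leb_cubeS; last exact: bounded_tnth.
case: (unliftP ord0 i) => [j|] ->.
  rewrite -[RHS](Rint_cst mu); apply: eq_Rintegral => x _.
  by rewrite -(IH j)//; apply: eq_Rintegral => t _; rewrite tnthS.
by apply: eq_Rintegral => x _; rewrite -[RHS](Rint_cst (leb_cube d)).
Qed.

Lemma integral_cube_tnth2 d (i j : 'I_d) (F : R -> R -> R) : i != j ->
  bounded_kernel F ->
  \int[leb_cube d]_t F (tnth t i) (tnth t j) = \int[mu]_x \int[mu]_y F x y.
Proof.
elim: d i j F => [[]//|d IH] i j F ij Fb.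
rewrite integral_leb_cubeS; last exact: bounded_tnth2.
case: (unliftP ord0 i) ij => [i'|] ->; case: (unliftP ord0 j) => [j'|] ->.
- rewrite (inj_eq lift_inj) => ij.
  rewrite -[RHS](Rint_cst mu); apply: eq_Rintegral => x _.
  by rewrite -(IH i' j')//; apply: eq_Rintegral => t _; rewrite !tnthS.
- move=> _; have /= -> := real_Fubini (bounded_L1 (mu \x mu)%E Fb).
  apply: eq_Rintegral => x _.
  rewrite -(integral_cube_tnth i'); last exact: bounded_kernelEr.
  by apply: eq_Rintegral => t _; rewrite tnthS.
- move=> _; apply: eq_Rintegral => x _ /=.
  rewrite -(integral_cube_tnth j'); last exact: bounded_kernelE.
  by apply: eq_Rintegral => t _; rewrite tnthS.
- by rewrite eqxx.
Qed.

(** Lists of weighted points may repeat points, which makes random points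
    admissible without a condition that they be distinct. *)
Definition psd_kernel (K : R -> R -> R) := forall s : seq (R * R),
  0 <= \sum_(p <- s) \sum_(q <- s) p.1 * q.1 * K p.2 q.2.

(** The quadratic form at the points [t0], with weight 1, and [n] independent
    uniform points [s], with weights [f s / n], has a nonnegative expectation.
    The diagonal contributes O(1/n), and the limit needs no regularity
    of [K]. *)
Lemma psd_kernel_integral (K : R -> R -> R) (f : R -> R) (t0 : R) :
  bounded_kernel K -> (forall t s, K t s = K s t) -> psd_kernel K ->
  bounded_measurable f ->
  0 <= K t0 t0 + 2 * \int[mu]_s (f s * K t0 s) +
       \int[mu]_s \int[mu]_u (f s * f u * K s u).
Proof.
move=> Kb Ksym Kpsd fb.
set A := \int[mu]_s (f s * K t0 s).
set E := \int[mu]_s _; pose D := \int[mu]_s (f s * f s * K s s).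
have Ktb := bounded_kernelE t0 Kb.
have fKb : bounded_measurable (fun s => f s * K t0 s) by exact: boundedM.
have ffKb : bounded_kernel (fun s u => f s * f u * K s u).
  apply: boundedM Kb; apply: boundedM.
  - exact: bounded_comp fb measurable_fst.
  - exact: bounded_comp fb measurable_snd.
have ffKdb : bounded_measurable (fun s => f s * f s * K s s).
  apply: (bounded_comp (g := fun s => (s, s)) ffKb).
  exact: measurable_fun_pair.
(* the expectation of the quadratic form; D is the contribution of the diagonal *)
have H n : (0 < n)%N ->
    0 <= K t0 t0 + 2 * A + n%:R^-1 * D + (1 - n%:R^-1) * E.
  move=> n0; have nn0 : (n%:R : R) != 0 by rewrite pnatr_eq0 -lt0n.
  pose c : R := n%:R^-1.
  pose Q (t : n.-tuple R) := K t0 t0 + 2 * c * (\sum_(i < n) f (tnth t i) * K t0 (tnth t i))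
    + c ^+ 2 * \sum_(i < n) \sum_(j < n) f (tnth t i) * f (tnth t j) * K (tnth t i) (tnth t j).
  have Q0 t : 0 <= Q t.
    have := Kpsd ((1, t0) :: [seq (c * f (tnth t i), tnth t i) | i <- index_enum 'I_n]).
    rewrite big_cons /= big_cons /= !big_map /=.
    rewrite (_ : \sum_(j < n) 1 * (c * f (tnth t j)) * K t0 (tnth t j) =
      c * \sum_(i < n) f (tnth t i) * K t0 (tnth t i)); last first.
      by rewrite mulr_sumr; apply: eq_bigr => i _; rewrite mul1r mulrA.
    under eq_bigr do rewrite big_cons big_map /=.
    rewrite big_split /= (_ : \sum_(i < n) c * f (tnth t i) * 1 * K (tnth t i) t0 =
      c * \sum_(i < n) f (tnth t i) * K t0 (tnth t i)); last first.
      by rewrite mulr_sumr; apply: eq_bigr => i _; rewrite mulr1 Ksym mulrA.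
    rewrite (_ : \sum_(i < n) \sum_(j < n) c * f (tnth t i) * (c * f (tnth t j)) *
      K (tnth t i) (tnth t j) = c ^+ 2 * \sum_(i < n) \sum_(j < n)
        f (tnth t i) * f (tnth t j) * K (tnth t i) (tnth t j)); last first.
      rewrite mulr_sumr; apply: eq_bigr => i _.
      by rewrite mulr_sumr; apply: eq_bigr => j _; ring.
    by rewrite /Q; set S1 := \sum_(_ < _) _; set S2 := \sum_(_ < _) _ => H; nra.
  have b1 i : bounded_measurable (fun t : n.-tuple R => f (tnth t i) * K t0 (tnth t i)).
    exact: (bounded_tnth i fKb).
  have b2 i j : bounded_measurable (fun t : n.-tuple R =>
      f (tnth t i) * f (tnth t j) * K (tnth t i) (tnth t j)).
    exact: (bounded_tnth2 i j ffKb).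
  have bs1 : bounded_measurable (fun t : n.-tuple R =>
      \sum_(i < n) f (tnth t i) * K t0 (tnth t i)) by exact: bounded_sum.
  have bs2 : bounded_measurable (fun t : n.-tuple R => \sum_(i < n) \sum_(j < n)
      f (tnth t i) * f (tnth t j) * K (tnth t i) (tnth t j)).
    by apply: bounded_sum => i; exact: bounded_sum.
  have : 0 <= \int[leb_cube n]_t Q t by exact: Rintegral_ge0.
  rewrite /Q RintD; last 2 first.
    - by apply: bounded_L1; apply: boundedD; [exact: cst_bounded|exact: boundedZ].
    - by apply: bounded_L1; exact: boundedZ.
  rewrite RintD; last 2 first.
    - by apply: bounded_L1; exact: cst_bounded.
    - by apply: bounded_L1; exact: boundedZ.
  rewrite RintZl ?RintZl; [|exact: bounded_L1|exact: bounded_L1].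
  rewrite Rint_cst !Rint_sum; last 2 first.
    - by move=> i; apply: bounded_L1; exact: bounded_sum.
    - by move=> i; exact: bounded_L1.
  have -> : \sum_(i < n) \int[leb_cube n]_t (f (tnth t i) * K t0 (tnth t i)) = n%:R * A.
    under eq_bigr => i _ do rewrite (integral_cube_tnth i fKb).
    by rewrite sumr_const card_ord mulr_natl.
  have -> : \sum_(i < n) \int[leb_cube n]_t (\sum_(j < n)
      f (tnth t i) * f (tnth t j) * K (tnth t i) (tnth t j)) =
      n%:R * (D + (n%:R - 1) * E).
    rewrite (eq_bigr (fun=> D + (n%:R - 1) * E)); last first.
      move=> i _; rewrite Rint_sum; last by move=> j; exact: bounded_L1.
      rewrite (bigD1 i)//=; congr (_ + _).
      exact: (integral_cube_tnth i ffKdb).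
    rewrite (eq_bigr (fun=> E)) => [|j ji]; last first.
      by rewrite (integral_cube_tnth2 _ ffKb) // eq_sym.
    by rewrite sumr_const cardC1 card_ord -[LHS]mulr_natl -subn1 natrB.
    by rewrite sumr_const card_ord mulr_natl.
  rewrite /c => QE; apply: (le_trans QE); rewrite le_eqVlt; apply/orP; left.
  by apply/eqP; field.
rewrite leNgt; apply/negP => AE.
pose e := - (K t0 t0 + 2 * A + E).
have e0 : 0 < e by rewrite oppr_gt0.
pose n := (Num.truncn (`|D - E| / e)).+1.
have := H n isT.
have -> : K t0 t0 + 2 * A + n%:R^-1 * D + (1 - n%:R^-1) * E =
  n%:R^-1 * (D - E) - e by rewrite /e; ring.
rewrite subr_ge0 leNgt; apply/negP; rewrite negbK.
rewrite mulrC ltr_pdivrMr ?ltr0n// mulrC -ltr_pdivrMr//.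
apply: (@le_lt_trans _ _ (`|D - E| / e)).
  by rewrite ler_pM2r ?invr_gt0// ler_norm.
by rewrite /n truncnS_gt.
Qed.

End cube_measure.

(** * Continuity on the unit interval *)

Section sequential_continuity.
Context {R : realType}.
Local Notation mu := (@leb01 R).

Lemma leb01_aeS (P Q : R -> Prop) : (forall x, P x -> Q x) ->
  {ae mu, forall x, P x} -> {ae mu, forall x, Q x}.
Proof. by move=> PQ [N [mN N0 PN]]; exists N; split=> // x /= /(contra_not (PQ x)) /PN. Qed.

Lemma leb01_aeS2 (P1 P2 Q : R -> Prop) : (forall x, P1 x -> P2 x -> Q x) ->
  {ae mu, forall x, P1 x} -> {ae mu, forall x, P2 x} -> {ae mu, forall x, Q x}.
Proof.
move=> PQ a1 a2; have [N [mN N0 PN]] := negligibleU a1 a2.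
exists N; split=> // x /= nQ; apply: PN => /=.
have [p1|np1] := pselect (P1 x); last by left.
by right => p2; apply: nQ; exact: PQ.
Qed.

(** Continuity on the unit interval alone, for functions on the whole line whose
    values elsewhere are arbitrary. *)
Definition seq_continuous01 (f : R -> R) := forall (u : nat -> R) (x : R),
  (forall n, u n \in `[0, 1]) -> x \in `[0, 1] -> u @ \oo --> x ->
  (fun n => f (u n)) @ \oo --> f x.

Lemma leb01_setC01 : mu (~` `[0, 1]%classic) = 0%E.
Proof. by rewrite /leb01 /= /mrestr setICl measure0. Qed.

Lemma ae_leb01_in : {ae mu, forall x, x \in `[0, 1]}.
Proof.
exists (~` `[0, 1]%classic); split.
- exact: measurableC.
- exact: leb01_setC01.
- by move=> x /=.
Qed.

(** Every neighbourhood of a point of the interval has positive measure, hence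
    meets the zero set. *)
Lemma seq_continuous01_ae0 (f : R -> R) : {ae mu, forall x, f x = 0} ->
  seq_continuous01 f -> forall x, x \in `[0, 1] -> f x = 0.
Proof.
move=> [N [mN N0 fN]] fc x x01; have := x01; rewrite in_itv/= => /andP[x0 x1].
have near n : exists y : R, [/\ y \in `[0, 1], `|x - y| <= n.+1%:R^-1 & f y = 0].
  pose del : R := n.+1%:R^-1; have del0 : 0 < del by rewrite invr_gt0.
  apply: contrapT => /forallNP H.
  pose a := Num.max 0 (x - del); pose b := Num.min 1 (x + del).
  have ab : a < b.
    rewrite /a /b gt_max !lt_min ltr01/=; apply/andP; split.
      by rewrite (lt_le_trans del0)// lerDr.
    rewrite ltrBlDr (le_lt_trans x1) ?ltrDl//=.
    by rewrite ltrBlDr -addrA ltrDl addr_gt0.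
  have abN : `[a, b]%classic `<=` N.
    move=> y; rewrite /= in_itv/= => /andP[]; rewrite ge_max le_min.
    move=> /andP[y0 xy] /andP[y1 yx].
    apply: fN => /= fy0; apply: (H y); split=> //.
      by rewrite in_itv/= y0.
    by rewrite -/del ler_norml; apply/andP; split; lra.
  have : (mu `[a, b]%classic <= mu N)%E.
    by apply: le_measure => //; rewrite inE.
  rewrite N0 /leb01 /= /mrestr setIidl; last first.
    move=> y; rewrite /= !in_itv/= ge_max le_min.
    by move=> /andP[/andP[-> _] /andP[-> _]].
  by rewrite lebesgue_measure_itv/= lte_fin ab -EFinB lee_fin leNgt subr_gt0 ab.
have [u uP] := choice near.
have ux : u @ \oo --> x.
  apply/cvgrPdist_le => e e0; near=> n.
  have [_ + _] := uP n; move=> /le_trans; apply; apply: ltW.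
  near: n; exact: (near_infty_natSinv_lt (PosNum e0)).
have := fc u x (fun n => let: And3 h _ _ := uP n in h) x01 ux.
have -> : (fun n => f (u n)) = cst 0.
  by apply/funext => n; have [_ _ ->] := uP n.
by move=> fx; apply: (cvg_unique (@norm_hausdorff _ R) fx); exact: cvg_cst.
Unshelve. all: by end_near. Qed.

End sequential_continuity.

(** * Mercer's theorem *)

Section mercer.
Context {R : realType}.
Local Notation mu := (@leb01 R).
Variables (K : R -> R -> R) (lam : nat -> R) (psi : nat -> R -> R).
Hypotheses (Kb : bounded_kernel K) (Ksym : forall t s, K t s = K s t).
Hypotheses (Kpsd : psd_kernel K) (Kcont : forall t, seq_continuous01 (K t)).
Hypothesis K_out : forall t s : R, s \notin `[0, 1] -> K t s = 0.
Hypotheses (lam_ge0 : forall k, 0 <= lam k) (psi2 : forall k, L2 mu (psi k)).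
Hypothesis psi_eig : forall k,
  {ae mu, forall t, \int[mu]_s (K t s * psi k s) = lam k * psi k t}.
Hypothesis psi_orth : forall k l, lam k != 0 -> lam l != 0 ->
  \int[mu]_t (psi k t * psi l t) = (k == l)%:R.
Hypothesis complete : forall (m : R) (f : R -> R), m != 0 -> bounded_measurable f ->
  {ae mu, forall t, \int[mu]_s (K t s * f s) = m * f t} ->
  exists n (c : nat -> R),
    {ae mu, forall t, f t = \sum_(k < n | lam k == m) c k * psi k t}.

(** The continuous representative of [psi k], defined at every point by the
    eigenvalue equation; division by a zero eigenvalue makes it vanish. *)
Definition eigenfun k t := (lam k)^-1 * \int[mu]_s (K t s * psi k s).
Local Notation phi := eigenfun.

Lemma eigenfun_lam0 k t : lam k = 0 -> phi k t = 0.
Proof. by move=> lk; rewrite /eigenfun lk invr0 mul0r. Qed.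

Lemma bounded_eigenfun k : bounded_measurable (phi k).
Proof.
apply: boundedZ.
have psi1 : L1 mu (psi k) by exact: L2_L1.
have [M KM] := Kb.2.
have F1 : L1 (mu \x mu)%E (fun p => K p.1 p.2 * psi k p.2).
  apply: bounded_mul_L1 => //.
  have := L1_mul_prod (bounded_L1 mu (cst_bounded (1 : R))) psi1.
  by apply: eq_integrable => // p _ /=; rewrite mul1r.
split; first exact: (measurable_Rintegral1 F1).
exists (M * \int[mu]_s `|psi k s|) => t.
have Kp : L1 mu (fun s => K t s * psi k s).
  by apply: bounded_mul_L1 => //; exact: bounded_kernelE.
apply: le_trans; first exact: le_normr_Rintegral.
rewrite -RintZl; last exact: (integrable_norm psi1).
apply: Rint_le => [||s].
- exact: (integrable_norm Kp).
- by apply: L1Zl; exact: (integrable_norm psi1).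
- by rewrite normrM ler_wpM2r// (KM (t, s)).
Qed.

Lemma eigenfun_ae k : lam k != 0 -> {ae mu, forall t, phi k t = psi k t}.
Proof.
move=> lk; have := psi_eig k; apply: leb01_aeS => t.
by rewrite /eigenfun => ->; rewrite mulKf.
Qed.

Lemma eigenfunE k t : \int[mu]_s (K t s * phi k s) = lam k * phi k t.
Proof.
have [lk|lk] := eqVneq (lam k) 0.
  rewrite lk mul0r -[RHS](Rint_cst mu); apply: eq_Rintegral => s _.
  by rewrite eigenfun_lam0// mulr0.
rewrite /eigenfun mulVKf//; apply: ae_eq_Rintegral.
- apply: measurable_funM; first exact: (bounded_kernelE t Kb).1.
  exact: (bounded_eigenfun k).1.
- apply: measurable_funM; first exact: (bounded_kernelE t Kb).1.
  exact: (psi2 k).1.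
- by apply: leb01_aeS (eigenfun_ae lk) => s; rewrite /eigenfun => ->.
Qed.

Lemma eigenfun_orth k l :
  lam k * \int[mu]_t (phi k t * phi l t) = lam k * (k == l)%:R.
Proof.
have [->|lk] := eqVneq (lam k) 0; first by rewrite !mul0r.
congr (_ * _); have [ll|ll] := eqVneq (lam l) 0.
  rewrite (_ : (k == l) = false); last by apply: contra_neqF lk => /eqP ->.
  rewrite -[RHS](Rint_cst mu); apply: eq_Rintegral => t _.
  by rewrite (eigenfun_lam0 t ll) mulr0.
rewrite -psi_orth//; apply: ae_eq_Rintegral.
- exact: (boundedM (bounded_eigenfun k) (bounded_eigenfun l)).1.
- by apply: measurable_funM; apply psi2.
- have := eigenfun_ae ll; have := eigenfun_ae lk.
  by apply: leb01_aeS2 => t -> ->.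
Qed.

Lemma seq_continuous_kernel_apply (L : R -> R -> R) (f : R -> R) :
  bounded_kernel L -> (forall s, seq_continuous01 (L^~ s)) ->
  bounded_measurable f -> seq_continuous01 (fun t => \int[mu]_s (L t s * f s)).
Proof.
move=> Lb Lc fb u x u01 x01 ux.
have [M LM] := Lb.2; have [N fN] := fb.2.
apply: (@bounded_convergence _ _ _ _ _ _ (M * N)) => [n|n s|s].
- exact: (boundedM (bounded_kernelE (u n) Lb) fb).1.
- by rewrite normrM ler_pM// (LM (u n, s)).
- by apply: cvgMr_tmp; exact: Lc.
Qed.

Lemma seq_continuous_eigenfun k : seq_continuous01 (phi k).
Proof.
have [lk|lk] := eqVneq (lam k) 0.
  move=> u x _ _ _; rewrite (_ : (fun n => _) = cst 0); last first.
    by apply/funext => n; rewrite eigenfun_lam0.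
  by rewrite eigenfun_lam0//; exact: cvg_cst.
have -> : phi k = fun t => (lam k)^-1 * \int[mu]_s (K t s * phi k s).
  by apply/funext => t; rewrite eigenfunE mulKf.
move=> u x u01 x01 ux; apply: cvgMl_tmp.
apply: (seq_continuous_kernel_apply Kb) => //; last exact: bounded_eigenfun.
move=> s; have := @Kcont s; congr seq_continuous01; apply/funext => t.
exact: Ksym.
Qed.

Lemma eigenfun_out k t : t \notin `[0, 1] -> phi k t = 0.
Proof.
move=> t01; rewrite /eigenfun (_ : \int[mu]_s _ = 0) ?mulr0//.
rewrite -[RHS](Rint_cst mu); apply: eq_Rintegral => s _.
by rewrite Ksym K_out// mul0r.
Qed.

(** Bessel's inequality in the Hilbert space with reproducing kernel [K]: test
    the positivity of [K] on the point mass at [t] minus the projection of its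
    image, namely on the density [- \sum_(k < n) phi k t * phi k]. *)
Lemma eigenfun_bessel n t : \sum_(k < n) lam k * phi k t ^+ 2 <= K t t.
Proof.
pose f s := \sum_(k < n) (- phi k t) * phi k s.
have phib k : L1 mu (fun s => phi k t * phi k s).
  by apply: L1Zl; exact/bounded_L1/bounded_eigenfun.
have fb : bounded_measurable f.
  by apply: bounded_sum => k; apply: boundedZ; exact: bounded_eigenfun.
have Kf s : \int[mu]_u (K s u * f u) = - \sum_(k < n) lam k * phi k t * phi k s.
  rewrite (_ : \int[mu]_u _ = \int[mu]_u \sum_(k < n) (- phi k t) * (K s u * phi k u)).
    rewrite Rint_sum => [|k]; last first.
      apply: L1Zl; apply: bounded_L1.
      apply: boundedM; [exact: bounded_kernelE|exact: bounded_eigenfun].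
    rewrite -sumrN; apply: eq_bigr => k _; rewrite RintZl ?eigenfunE.
      by rewrite mulNr mulrA [phi k t * _]mulrC.
    apply: bounded_L1; apply: boundedM; [exact: bounded_kernelE|].
    exact: bounded_eigenfun.
  apply: eq_Rintegral => u _; rewrite mulr_sumr; apply: eq_bigr => k _.
  by rewrite mulrCA.
have := psd_kernel_integral t Kb Ksym Kpsd fb.
have -> : \int[mu]_s (f s * K t s) = - \sum_(k < n) lam k * phi k t ^+ 2.
  under eq_Rintegral do rewrite mulrC.
  by rewrite Kf; congr (- _); apply: eq_bigr => k _; rewrite -mulrA -expr2.
have -> : \int[mu]_s \int[mu]_u (f s * f u * K s u) =
    \sum_(k < n) lam k * phi k t ^+ 2.
  transitivity (\int[mu]_s \sum_(k < n) (- (lam k * phi k t)) * (f s * phi k s)).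
    apply: eq_Rintegral => s _.
    rewrite (_ : \int[mu]_u _ = f s * \int[mu]_u (K s u * f u)).
      rewrite Kf -sumrN mulr_sumr; apply: eq_bigr => k _.
      by rewrite mulrN mulrCA mulNr.
    rewrite -RintZl; first by apply: eq_Rintegral => u _; ring.
    by apply: bounded_L1; apply: boundedM => //; exact: bounded_kernelE.
  have fphi k : L1 mu (fun s => f s * phi k s).
    by apply: bounded_L1; apply: boundedM => //; exact: bounded_eigenfun.
  rewrite Rint_sum => [|k]; last exact: L1Zl.
  apply: eq_bigr => k _; rewrite RintZl// mulNr -mulrA mulrCA.
  transitivity (- (phi k t * (lam k * \int[mu]_s (phi k s * f s)))).
    by congr (- (_ * (_ * _))); apply: eq_Rintegral => s _; rewrite mulrC.
  rewrite (_ : \int[mu]_s (phi k s * f s) =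
      \sum_(l < n) - phi l t * \int[mu]_s (phi k s * phi l s)).
    rewrite mulr_sumr (bigD1 k)//= big1 => [|l lk].
      by rewrite mulrCA eigenfun_orth eqxx mulr1 addr0; ring.
    by rewrite mulrCA eigenfun_orth eq_sym (inj_eq val_inj) (negbTE lk) !mulr0.
  transitivity (\int[mu]_s \sum_(l < n) (- phi l t) * (phi k s * phi l s)).
    apply: eq_Rintegral => s _; rewrite /f mulr_sumr; apply: eq_bigr => l _.
    by rewrite mulrCA.
  rewrite Rint_sum => [|l]; last first.
    apply: L1Zl; apply: bounded_L1.
    by apply: boundedM; exact: bounded_eigenfun.
  apply: eq_bigr => l _; rewrite RintZl//; apply: bounded_L1.
  by apply: boundedM; exact: bounded_eigenfun.
lra.
Qed.

Definition mercer_term t s k := lam k * phi k t * phi k s.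
Local Notation S n t s := (series (mercer_term t s) n).

Lemma mercer_termC t s k : mercer_term t s k = mercer_term s t k.
Proof. by rewrite /mercer_term mulrAC. Qed.

Lemma mercer_diag_ge0 t k : 0 <= mercer_term t t k.
Proof. by rewrite /mercer_term -mulrA mulr_ge0// -expr2 sqr_ge0. Qed.

Lemma mercer_diag_le n t : S n t t <= K t t.
Proof.
apply: le_trans (eigenfun_bessel n t); rewrite /series/= big_mkord.
by apply: ler_sum => k _; rewrite /mercer_term -mulrA -expr2.
Qed.

Lemma mercer_diag_cvg t : cvgn (series (mercer_term t t)).
Proof.
apply: nondecreasing_is_cvgn.
  by apply: nondecreasing_series => n _ _; exact: mercer_diag_ge0.
by exists (K t t) => _ [n _ <-]; exact: mercer_diag_le.
Qed.

(** The inequality between arithmetic and geometric means; the weight [del] is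
    at the disposal of the uniform estimate of the tails. *)
Lemma mercer_term_le (del : R) t s k : 0 < del ->
  `|mercer_term t s k| <= del^-1 * mercer_term t t k + del * mercer_term s s k.
Proof.
move=> d0; rewrite /mercer_term; set a := phi k t; set b := phi k s.
rewrite (_ : _ + _ = lam k * (del^-1 * (a * a) + del * (b * b))); last by ring.
rewrite -mulrA normrM ger0_norm//; apply: ler_wpM2l => //.
have := sqr_ge0 (a - del * b); have := sqr_ge0 (a + del * b) => h1 h2.
have ad : 0 <= del^-1 by rewrite invr_ge0 ltW.
have e1 : del^-1 * (a - del * b) ^+ 2 = del^-1 * (a * a) + del * (b * b) - 2 * (a * b).
  by field; rewrite gt_eqF.
have e2 : del^-1 * (a + del * b) ^+ 2 = del^-1 * (a * a) + del * (b * b) + 2 * (a * b).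
  by field; rewrite gt_eqF.
have := mulr_ge0 ad h1; have := mulr_ge0 ad h2; rewrite e1 e2 => g1 g2.
have p1 : 0 <= del^-1 * (a * a) by rewrite mulr_ge0// -expr2 sqr_ge0.
have p2 : 0 <= del * (b * b) by rewrite mulr_ge0 ?(ltW d0)// -expr2 sqr_ge0.
by rewrite ler_norml; apply/andP; split; lra.
Qed.

Lemma mercer_tail_le (del : R) t s a b : 0 < del -> (a <= b)%N ->
  `|S b t s - S a t s| <=
    del^-1 * (S b t t - S a t t) + del * (S b s s - S a s s).
Proof.
move=> d0 ab; rewrite !sub_series_geq//.
apply: le_trans (ler_norm_sum _ _ _) _.
rewrite !mulr_sumr -big_split; apply: ler_sum => k _; exact: mercer_term_le.
Qed.

Definition mercer_sum t s := limn (series (mercer_term t s)).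
Local Notation G := mercer_sum.

Lemma mercer_cvg t s : (fun n => S n t s) @ \oo --> G t s.
Proof.
suff : cvgn (series (mercer_term t s)) by [].
apply: normed_cvg; rewrite /normed_series_of.
apply: (@series_le_cvg _ _ (mercer_term t t \+ mercer_term s s)) => [k|k|k|].
- exact: normr_ge0.
- by rewrite /= addr_ge0// mercer_diag_ge0.
- by have := @mercer_term_le 1 t s k ltr01; rewrite invr1 !mul1r.
- by apply: is_cvg_seriesD; exact: mercer_diag_cvg.
Qed.

Lemma mercer_sum_bounded n t s M : (forall t s, `|K t s| <= M) ->
  `|S n t s| <= 2 * M.
Proof.
move=> KM; have S0 x y : S 0%N x y = 0 by rewrite /series/= big_geq.
have := @mercer_tail_le 1 t s 0 n ltr01 (leq0n n).
rewrite !S0 !subr0 invr1 !mul1r => /le_trans; apply.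
have K_le x : S n x x <= M.
  by apply: (le_trans (mercer_diag_le n x)); exact: le_trans (ler_norm _) (KM x x).
rewrite (_ : 2 * M = M + M); last by ring.
by apply: lerD; exact: K_le.
Qed.

Lemma bounded_mercer_partial n : bounded_kernel (fun t s => S n t s).
Proof.
rewrite /bounded_kernel /series/=.
apply: bounded_sum => k; apply: boundedM.
  apply: boundedZ.
  exact: (bounded_comp (bounded_eigenfun k) measurable_fst).
exact: (bounded_comp (bounded_eigenfun k) measurable_snd).
Qed.

Lemma bounded_mercer_sum : bounded_kernel G.
Proof.
have [M KM] := Kb.2.
apply: (@bounded_limit _ _ _ (fun n p => S n p.1 p.2) _ (2 * M)) => [n|n p|p].
- exact: (bounded_mercer_partial n).1.
- by apply: mercer_sum_bounded => t s; exact: (KM (t, s)).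
- exact: mercer_cvg.
Qed.

Lemma seq_continuous_uniform_limit (f : R -> R) :
  (forall e, 0 < e -> exists2 g, seq_continuous01 g &
     forall s, `|f s - g s| <= e) -> seq_continuous01 f.
Proof.
move=> fg u x u01 x01 ux; apply/cvgrPdist_le => e e0.
have e3 : 0 < e / 3 by rewrite divr_gt0.
have [g gc fge] := fg _ e3.
have /cvgrPdist_le /(_ _ e3) := gc u x u01 x01 ux.
apply: filterS => n gn.
rewrite (_ : f x - f (u n) = (f x - g x) + (g x - g (u n)) - (f (u n) - g (u n))).
  apply: le_trans (ler_normB _ _) _.
  rewrite (_ : e = e / 3 + e / 3 + e / 3); last by field.
  apply: lerD; last exact: fge.
  by apply: le_trans (ler_normD _ _) _; apply: lerD.
by ring.
Qed.

(** For fixed [t] the convergence is uniform in the other variable: the diagonal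
    tail at [t] is small and the one at [s] is bounded by the supremum of the
    diagonal of [K], by [eigenfun_bessel]. *)
Lemma seq_continuous_mercer_sum t : seq_continuous01 (G t).
Proof.
have [M KM] := Kb.2.
have K_le s : K s s <= M by exact: le_trans (ler_norm _) (KM (s, s)).
apply: seq_continuous_uniform_limit => e e0.
pose N := `|M| + 1; have N0 : 0 < N by rewrite ltr_wpDl.
(* the choice for which both halves of the tail estimate are e / 2 *)
pose del := e / (2 * N).
have del0 : 0 < del by rewrite divr_gt0// mulr_gt0.
have ed0 : 0 < e * del / 2 by rewrite divr_gt0// mulr_gt0.
have /cvgrPdist_le /(_ _ ed0) [n _ tn] := @mercer_diag_cvg t.
exists (fun s => S n t s).
  move=> u x u01 x01 ux; rewrite /series/=.
  elim: (n) => [|k IH].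
    under eq_fun do rewrite big_nil; rewrite big_nil; exact: cvg_cst.
  under eq_fun do rewrite big_nat_recr//; rewrite big_nat_recr//.
  apply: cvgD => //; apply: cvgMl_tmp; exact: seq_continuous_eigenfun.
move=> s.
have : (fun b => `|S b t s - S n t s|) @ \oo --> `|G t s - S n t s|.
  apply: cvg_norm; apply: cvgB; last exact: cvg_cst.
  exact: mercer_cvg.
move=> /cvgr_to_le; apply; exists n => // b /= nb.
apply: le_trans (mercer_tail_le t s del0 nb) _.
rewrite (_ : e = del^-1 * (e * del / 2) + del * N); last first.
  by rewrite /del; field; rewrite !gt_eqF.
apply: lerD.
- apply: ler_wpM2l; first by rewrite invr_ge0 ltW.
  apply: (@le_trans _ _ (G t t - S n t t)).
    apply: lerB => //; apply: nondecreasing_cvgn_le.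
      by apply: nondecreasing_series => k _ _; exact: mercer_diag_ge0.
    exact: mercer_diag_cvg.
  by apply: le_trans (ler_norm _) _; exact: (tn n (leqnn n)).
- apply: ler_wpM2l; first exact: ltW.
  apply: (@le_trans _ _ (S b s s)).
    by rewrite gerBl// sumr_ge0// => k _; exact: mercer_diag_ge0.
  apply: (le_trans (mercer_diag_le b s)).
  by rewrite (le_trans (K_le s))// /N (le_trans (ler_norm _))// lerDl.
Qed.

Lemma mercer_sum_sym t s : G t s = G s t.
Proof.
rewrite /G; congr (limn _); apply/funext => n; rewrite /series/=.
by apply: eq_bigr => k _; exact: mercer_termC.
Qed.

Lemma mercer_sum_apply f t : bounded_measurable f ->
  (fun n => \sum_(k < n) lam k * phi k t * \int[mu]_s (phi k s * f s)) @ \oo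
    --> \int[mu]_s (G t s * f s).
Proof.
move=> fb; have [M KM] := Kb.2; have [N fN] := fb.2.
have -> : (fun n => \sum_(k < n) lam k * phi k t * \int[mu]_s (phi k s * f s)) =
    fun n => \int[mu]_s (S n t s * f s).
  apply/funext => n.
  have phif k : L1 mu (fun s => phi k s * f s).
    by apply: bounded_L1; apply: boundedM => //; exact: bounded_eigenfun.
  transitivity (\int[mu]_s \sum_(k < n) lam k * phi k t * (phi k s * f s)).
    rewrite Rint_sum => [|k]; last exact: L1Zl.
    by apply: eq_bigr => k _; rewrite RintZl.
  apply: eq_Rintegral => s _; rewrite /series/= big_mkord mulr_suml.
  by apply: eq_bigr => k _; rewrite /mercer_term mulrA.
apply: (@bounded_convergence _ _ _ _ _ _ (2 * M * N)) => [n|n s|s].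
- exact: (boundedM (bounded_kernelE t (bounded_mercer_partial n)) fb).1.
- rewrite normrM ler_pM//; apply: mercer_sum_bounded => x y; exact: (KM (x, y)).
- by apply: cvgMr_tmp; exact: mercer_cvg.
Qed.

Definition mercer_residual t s := K t s - G t s.
Local Notation Q := mercer_residual.

Lemma bounded_mercer_residual : bounded_kernel Q.
Proof. exact: (boundedB Kb bounded_mercer_sum). Qed.

Lemma mercer_residual_sym t s : Q t s = Q s t.
Proof. by rewrite /Q Ksym mercer_sum_sym. Qed.

Lemma seq_continuous_mercer_residual t : seq_continuous01 (Q t).
Proof.
move=> u x u01 x01 ux; apply: cvgB; first exact: Kcont.
exact: seq_continuous_mercer_sum.
Qed.

Lemma mercer_residual_eigenfun k t : \int[mu]_s (Q t s * phi k s) = 0.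
Proof.
have pb := bounded_eigenfun k.
have -> : \int[mu]_s (Q t s * phi k s) =
    \int[mu]_s (K t s * phi k s) - \int[mu]_s (G t s * phi k s).
  rewrite -RintB; first by apply: eq_Rintegral => s _; rewrite mulrBl.
  - by apply: bounded_L1; apply: boundedM => //; exact: bounded_kernelE.
  - apply: bounded_L1; apply: boundedM => //; apply: bounded_kernelE.
    exact: bounded_mercer_sum.
rewrite eigenfunE; apply/eqP; rewrite subr_eq0; apply/eqP.
have l1 := @mercer_sum_apply _ t pb.
have l2 : (fun n => \sum_(l < n) lam l * phi l t * \int[mu]_s (phi l s * phi k s)) @ \oo
    --> lam k * phi k t.
  apply: cvg_near_cst; exists k.+1 => // n /= kn.
  rewrite (bigD1 (Ordinal kn))//= big1 => [|l lk].
    by rewrite mulrAC eigenfun_orth eqxx mulr1 addr0.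
  rewrite mulrAC eigenfun_orth (_ : (val l == k) = false) ?mulr0 ?mul0r//.
  by apply: contraNF lk => /eqP lk; apply/eqP/val_inj.
exact: (cvg_unique _ l2 l1).
Qed.

(** Otherwise the residual has an eigenfunction with a nonzero eigenvalue.  It is
    orthogonal to all [phi k], hence is an eigenfunction of [K] itself, and by
    completeness of the spectrum a combination of the [phi k]: it vanishes. *)
Lemma mercer_residual_sqr0 :
  hilbert_schmidt mu (kernel_pow mu Q 1) (kernel_pow mu Q 1) = 0.
Proof.
have Qb := bounded_mercer_residual; have Qsym := mercer_residual_sym.
apply/eqP; apply: contraT => QQ0.
have [m [f [m0 fb f0 fE]]] := kernel_eigenfunction (mu := mu) Qb Qsym QQ0.
have phif k : \int[mu]_s (phi k s * f s) = 0.
  apply/eqP; rewrite -(mulrI_eq0 _ (mulfI m0)); apply/eqP.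
  have pb := bounded_eigenfun k.
  have Qf : bounded_measurable (fun t => \int[mu]_u (Q t u * f u)).
    apply: (bounded_Rintegral1 mu mu (F := fun p => Q p.1 p.2 * f p.2)).
    by apply: boundedM => //; exact: (bounded_comp fb measurable_snd).
  transitivity (\int[mu]_t (phi k t * \int[mu]_u (Q t u * f u))).
    rewrite -RintZl; last by apply: bounded_L1; exact: boundedM.
    apply: ae_eq_Rintegral.
    - apply: measurable_funM => //; exact: (boundedM pb fb).1.
    - exact: (boundedM pb Qf).1.
    - by apply: leb01_aeS fE => t ->; rewrite mulrCA.
  have pb1 : L1 mu (phi k) by apply: bounded_L1.
  have fb1 : L1 mu f by apply: bounded_L1.
  rewrite (@kernel_apply_Fubini _ _ _ mu Q (phi k) f Qb pb1 fb1).
  rewrite -[RHS](Rint_cst mu); apply: eq_Rintegral => s _.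
  rewrite (_ : \int[mu]_t _ = 0) ?mul0r// -(mercer_residual_eigenfun k s).
  by apply: eq_Rintegral => t _; rewrite mulrC Qsym.
have Gf t : \int[mu]_s (G t s * f s) = 0.
  have l1 := @mercer_sum_apply _ t fb.
  have l2 : (fun n => \sum_(l < n) lam l * phi l t * \int[mu]_s (phi l s * f s)) @ \oo
      --> (0 : R).
    apply: cvg_near_cst; apply: nearW => n.
    by apply: big1 => l _; rewrite phif mulr0.
  exact: (cvg_unique _ l1 l2).
have Kf : {ae mu, forall t, \int[mu]_s (K t s * f s) = m * f t}.
  apply: leb01_aeS fE => t <-.
  have -> : \int[mu]_u (Q t u * f u) =
      \int[mu]_u (K t u * f u) - \int[mu]_u (G t u * f u).
    rewrite -RintB; first by apply: eq_Rintegral => s _; rewrite mulrBl.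
    - by apply: bounded_L1; apply: boundedM => //; exact: bounded_kernelE.
    - apply: bounded_L1; apply: boundedM => //; apply: bounded_kernelE.
      exact: bounded_mercer_sum.
  by rewrite Gf subr0.
have [n [c fc]] := complete m0 fb Kf.
exfalso; move: f0 => /eqP; apply.
pose g t := \sum_(k < n | lam k == m) c k * phi k t.
have gb : bounded_measurable g.
  rewrite /g; under eq_fun do rewrite big_mkcond.
  apply: bounded_sum => k; case: (lam k == m); last exact: cst_bounded.
  by apply: boundedZ; exact: bounded_eigenfun.
have fg : {ae mu, forall t, f t = g t}.
  have H k : {ae mu, forall t, lam k == m -> phi k t = psi k t}.
    have [lk|lk] := eqVneq (lam k) m; last by apply: aeW => t.
    have := eigenfun_ae (k := k); rewrite lk => /(_ m0).
    by apply: leb01_aeS => t.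
  have : {ae mu, forall t, forall k : 'I_n, lam k == m -> phi k t = psi k t}.
    have : {ae mu, forall t, forall k : 'I_n, [set: 'I_n] k -> lam k == m -> phi k t = psi k t}.
      apply: filter_forall => k; apply: leb01_aeS (H k) => t h _; exact: h.
    by apply: leb01_aeS => t h k; exact: h.
  apply: leb01_aeS2 fc => t -> h.
  by rewrite /g; apply: eq_bigr => k lk; rewrite h.
transitivity (\int[mu]_t (g t * f t)).
  apply: ae_eq_Rintegral.
  - exact: (boundedM fb fb).1.
  - exact: (boundedM gb fb).1.
  - by apply: leb01_aeS fg => t ->; rewrite expr2.
transitivity (\int[mu]_t \sum_(k < n) (if lam k == m then c k else 0) * (phi k t * f t)).
  apply: eq_Rintegral => t _; rewrite /g big_mkcond mulr_suml.
  apply: eq_bigr => k _; case: (lam k == m); first exact/esym/mulrA.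
  by rewrite !mul0r.
have pf k : L1 mu (fun s => phi k s * f s).
  by apply: bounded_L1; apply: boundedM => //; exact: bounded_eigenfun.
rewrite Rint_sum => [|k]; last exact: L1Zl.
by apply: big1 => k _; rewrite RintZl// phif mulr0.
Qed.

(** That the square of the residual vanishes almost everywhere says nothing on the
    diagonal, a null set; continuity in each variable does. *)
Lemma mercer : {ae mu, forall s, forall u, K s u = G s u}.
Proof.
have Qb := bounded_mercer_residual.
have QQb := bounded_kernel_pow mu 1 Qb.
pose g s := \int[mu]_t (kernel_pow mu Q 1 t s ^+ 2).
have QQ2b : bounded_measurable (fun p : R * R => kernel_pow mu Q 1 p.1 p.2 ^+ 2).
  exact: (boundedM QQb QQb).
have g0 : \int[mu]_s g s = 0.
  rewrite -mercer_residual_sqr0.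
  exact: (real_Fubini2 (bounded_L1 (mu \x mu)%E QQ2b)).
have gb : bounded_measurable g by exact: (bounded_Rintegral2 mu mu QQ2b).
have gge0 s : 0 <= g s by apply: Rintegral_ge0 => t _; exact: sqr_ge0.
have := Rintegral_eq0_ae (bounded_L1 mu gb) gge0 g0.
apply: leb01_aeS2 ae_leb01_in => s s01 gs u.
have QQs : kernel_pow mu Q 1 s s = 0.
  apply: (@seq_continuous01_ae0 _ (fun t => kernel_pow mu Q 1 t s)) => //.
  - have := Rintegral_eq0_ae (bounded_L1 mu (bounded_section2 s QQ2b))
      (fun t => sqr_ge0 _) gs.
    by apply: leb01_aeS => t /eqP; rewrite sqrf_eq0 => /eqP.
  - apply: (seq_continuous_kernel_apply Qb).
      move=> x v y v01 y01 vy; rewrite mercer_residual_sym.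
      under eq_fun do rewrite mercer_residual_sym.
      exact: seq_continuous_mercer_residual.
    exact: bounded_kernelEr.
have Qs2 : \int[mu]_v (Q s v ^+ 2) = 0.
  by rewrite -QQs; apply: eq_Rintegral => v _; rewrite [Q v s]mercer_residual_sym.
have [u01|u01] := boolP (u \in `[0, 1]); last first.
  rewrite K_out// /G (_ : series _ = cst 0) ?lim_cst//.
  apply/funext => n; rewrite /series/= big1// => k _.
  by rewrite /mercer_term (eigenfun_out k u01) mulr0.
apply/eqP; rewrite -subr_eq0 -/(Q s u); apply/eqP.
apply: (@seq_continuous01_ae0 _ (Q s)) => //; last first.
  exact: seq_continuous_mercer_residual.
have Qsb := bounded_kernelE s Qb.
have := Rintegral_eq0_ae (bounded_L1 mu (boundedM Qsb Qsb)) (fun t => sqr_ge0 _) Qs2.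
by apply: leb01_aeS => t /eqP; rewrite sqrf_eq0 => /eqP.
Qed.

(** Integrate Mercer's expansion along the diagonal. *)
Lemma eigenvalue_sum_cvg : series lam @ \oo --> \int[mu]_s K s s.
Proof.
have diagb (L : R -> R -> R) : bounded_kernel L ->
    bounded_measurable (fun s : R => L s s).
  move=> Lb; apply: (bounded_comp (g := fun s : R => (s, s)) Lb).
  exact: measurable_fun_pair.
have -> : \int[mu]_s K s s = \int[mu]_s G s s.
  apply: ae_eq_Rintegral.
  - exact: (diagb _ Kb).1.
  - exact: (diagb _ bounded_mercer_sum).1.
  - by apply: leb01_aeS mercer => s ->.
have -> : series lam = fun n => \int[mu]_s S n s s.
  apply/funext => n; rewrite /series/=.
  rewrite Rint_sum => [|k]; last first.
    apply: bounded_L1; apply: boundedM; last exact: bounded_eigenfun.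
    by apply: boundedZ; exact: bounded_eigenfun.
  apply: eq_bigr => k _; rewrite /mercer_term.
  transitivity (lam k * \int[mu]_s (phi k s * phi k s)).
    by rewrite eigenfun_orth eqxx mulr1.
  rewrite -RintZl; first by apply: eq_Rintegral => s _; rewrite mulrA.
  by apply: bounded_L1; apply: boundedM; exact: bounded_eigenfun.
have [M KM] := Kb.2.
apply: (@bounded_convergence _ _ _ _ _ _ (2 * M)) => [n|n s|s].
- exact: (diagb _ (bounded_mercer_partial n)).1.
- by apply: mercer_sum_bounded => t u; exact: (KM (t, u)).
- exact: mercer_cvg.
Qed.

End mercer.

(** * Orthonormal families *)

Section inner_product.
Context {R : realType} {d : measure_display} {T : measurableType d}.
Variable mu : probability T R.
Implicit Types f g h : T -> R.
Local Notation inner := (L2_inner mu).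

Lemma innerC f g : inner f g = inner g f.
Proof. by apply: eq_Rintegral => t _; rewrite mulrC. Qed.

Lemma innerBl f g h : L2 mu f -> L2 mu g -> L2 mu h ->
  inner (fun t => f t - g t) h = inner f h - inner g h.
Proof.
move=> f2 g2 h2; rewrite /L2_inner -RintB; try exact: L2_mul_L1.
by apply: eq_Rintegral => t _; rewrite mulrBl.
Qed.

Lemma innerZl c f h : L2 mu f -> L2 mu h ->
  inner (fun t => c * f t) h = c * inner f h.
Proof.
move=> f2 h2; rewrite /L2_inner -RintZl; last exact: L2_mul_L1.
by apply: eq_Rintegral => t _; rewrite mulrA.
Qed.

Lemma inner_suml n (b : nat -> R) (e : nat -> T -> R) h :
  (forall k, L2 mu (e k)) -> L2 mu h ->
  inner (fun t => \sum_(k < n) b k * e k t) h = \sum_(k < n) b k * inner (e k) h.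
Proof.
move=> e2 h2; rewrite /L2_inner.
transitivity (\int[mu]_t \sum_(k < n) b k * (e k t * h t)).
  apply: eq_Rintegral => t _; rewrite mulr_suml.
  by apply: eq_bigr => k _; rewrite mulrA.
rewrite Rint_sum => [|k]; last by apply: L1Zl; exact: L2_mul_L1.
by apply: eq_bigr => k _; rewrite RintZl//; exact: L2_mul_L1.
Qed.

Lemma inner_ge0 f : 0 <= inner f f.
Proof. by apply: Rintegral_ge0 => t _; rewrite -expr2 sqr_ge0. Qed.

Lemma inner_null f g : L2 mu f -> L2 mu g -> inner g g = 0 -> inner f g = 0.
Proof.
move=> f2 g2 g0; have := cauchy_schwarz f2 g2.
have -> : \int[mu]_x (g x ^+ 2) = inner g g.
  by apply: eq_Rintegral => t _; rewrite expr2.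
by rewrite g0 mulr0 => h; apply/eqP; rewrite -sqrf_eq0 eq_le h sqr_ge0.
Qed.

(** Orthonormal up to vanishing members, which dependent vectors produce in the
    Gram-Schmidt process and padding produces in families of eigenfunctions. *)
Definition orthonormal_or0 (e : nat -> T -> R) :=
  [/\ forall k, L2 mu (e k), forall k l, k != l -> inner (e k) (e l) = 0 &
      forall k, inner (e k) (e k) = 0 \/ inner (e k) (e k) = 1].

Lemma L2_comb n (b : nat -> R) e : orthonormal_or0 e ->
  L2 mu (fun t => \sum_(k < n) b k * e k t).
Proof. by move=> [e2 _ _]; apply: L2_sum => k; apply: L2Z. Qed.

Lemma sqr_inner_norm f e k : orthonormal_or0 e -> L2 mu f ->
  inner f (e k) * inner (e k) (e k) = inner f (e k).
Proof.
move=> [e2 _ en] f2; case: (en k) => [ek|->]; last by rewrite mulr1.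
by rewrite (inner_null f2 (e2 k) ek) mul0r.
Qed.

Lemma inner_sub_comb f n (b : nat -> R) e : orthonormal_or0 e -> L2 mu f ->
  inner (fun t => f t - \sum_(k < n) b k * e k t)
        (fun t => f t - \sum_(k < n) b k * e k t) =
  inner f f - 2 * \sum_(k < n) b k * inner f (e k) +
    \sum_(k < n) b k ^+ 2 * inner (e k) (e k).
Proof.
move=> eo f2; have g2 := L2_comb n b eo; have [e2 eorth en] := eo.
have fg2 := L2B f2 g2.
set g := fun t => \sum_(k < n) b k * e k t.
pose h t := f t - g t.
have hE u : L2 mu u -> inner h u = inner f u - inner g u by move=> u2; exact: innerBl.
rewrite -/h hE// (innerC f h) (innerC g h) !hE//.
have gh u : L2 mu u -> inner g u = \sum_(k < n) b k * inner (e k) u.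
  by move=> u2; exact: inner_suml.
rewrite [inner f g]innerC !gh//.
rewrite (_ : \sum_(k < n) b k * inner (e k) g = \sum_(k < n) b k ^+ 2 * inner (e k) (e k)).
  rewrite (eq_bigr (fun k : 'I_n => b k * inner f (e k))); last first.
    by move=> k _; rewrite innerC.
  by ring.
apply: eq_bigr => k _; rewrite expr2 -mulrA; congr (_ * _).
rewrite innerC gh// (bigD1 k)//= big1 ?addr0// => l lk.
by rewrite eorth ?mulr0// (inj_eq val_inj).
Qed.

Lemma inner_sub_proj f n e : orthonormal_or0 e -> L2 mu f ->
  inner (fun t => f t - \sum_(k < n) inner f (e k) * e k t)
        (fun t => f t - \sum_(k < n) inner f (e k) * e k t) =
  inner f f - \sum_(k < n) inner f (e k) ^+ 2.
Proof.
move=> eo f2; rewrite (inner_sub_comb n (fun k => inner f (e k)) eo f2).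
rewrite [X in _ + X](_ : _ = \sum_(k < n) inner f (e k) ^+ 2).
  by under eq_bigr do rewrite -expr2; ring.
by apply: eq_bigr => k _; rewrite expr2 -mulrA sqr_inner_norm.
Qed.

Lemma bessel f n e : orthonormal_or0 e -> L2 mu f ->
  \sum_(k < n) inner f (e k) ^+ 2 <= inner f f.
Proof.
by move=> eo f2; rewrite -subr_ge0 -inner_sub_proj//; exact: inner_ge0.
Qed.

Lemma proj_optimal f n (b : nat -> R) e : orthonormal_or0 e -> L2 mu f ->
  inner f f - \sum_(k < n) inner f (e k) ^+ 2 <=
  inner (fun t => f t - \sum_(k < n) b k * e k t)
        (fun t => f t - \sum_(k < n) b k * e k t).
Proof.
move=> eo f2; rewrite (inner_sub_comb n b eo f2) -addrA lerD2l -sumrN mulr_sumr -sumrN.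
rewrite -big_split; apply: ler_sum => k _ /=.
have [e2 _ en] := eo; case: (en k) => ek; last first.
  rewrite ek -subr_ge0; set c := inner f (e k).
  by rewrite (_ : _ - _ = (b k - c) ^+ 2) ?sqr_ge0//; ring.
by rewrite (inner_null f2 (e2 k) ek) ek expr0n/= !mulr0 addr0.
Qed.

(** Degenerate residuals have norm zero, and since [0^-1 = 0] their normalisation
    is null as well; almost everywhere this loses nothing. *)
Lemma gram_schmidt (psi : nat -> T -> R) n : (forall k, L2 mu (psi k)) ->
  exists e, [/\ orthonormal_or0 e, forall k t, (n <= k)%N -> e k t = 0 &
    forall m, (m < n)%N -> exists a : nat -> R,
      {ae mu, forall t, psi m t = \sum_(l < n) a l * e l t}].
Proof.
move=> psi2; elim: n => [|n [e [eo e0 ea]]].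
  exists (fun _ _ => 0); split=> //; split.
  - by move=> k; exact/bounded_L2/cst_bounded.
  - move=> k l _; rewrite -[RHS](Rint_cst mu).
    by apply: eq_Rintegral => t _; rewrite mulr0.
  - move=> k; left; rewrite -[RHS](Rint_cst mu).
    by apply: eq_Rintegral => t _; rewrite mulr0.
have [e2 eorth en] := eo.
pose p t := \sum_(l < n) inner (psi n) (e l) * e l t.
pose r t := psi n t - p t.
have p2 : L2 mu p by exact: (L2_comb n (fun l => inner (psi n) (e l)) eo).
have r2 : L2 mu r by exact: L2B.
pose N := inner r r; pose c := (Num.sqrt N)^-1.
have re l : (l < n)%N -> inner r (e l) = 0.
  move=> ln; rewrite innerBl//.
  rewrite (inner_suml n (fun l => inner (psi n) (e l)) e2 (e2 l)).
  rewrite (bigD1 (Ordinal ln))//= big1 => [|i il].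
    by rewrite addr0 sqr_inner_norm// subrr.
  by rewrite eorth ?mulr0//; apply: contra il => /eqP il; apply/eqP/val_inj.
have e_n0 l f : (n <= l)%N -> inner f (e l) = 0.
  move=> nl; rewrite -[RHS](Rint_cst mu); apply: eq_Rintegral => t _.
  by rewrite e0// mulr0.
have re' l : inner r (e l) = 0.
  by have [/e_n0//|/re] := leqP n l.
pose e' k := if k == n then (fun t => c * r t) else e k.
have e'n : e' n = fun t => c * r t by rewrite /e' eqxx.
have e'E k : k != n -> e' k = e k by rewrite /e' => /negbTE ->.
have e'2 k : L2 mu (e' k).
  by rewrite /e'; case: eqP => // _; exact: L2Z.
have e'rn l : l != n -> inner (e' n) (e' l) = 0.
  by move=> ln; rewrite e'n e'E// innerZl// re' mulr0.
exists e'; split.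
- split=> //.
  + move=> k l; have [->|kn] := eqVneq k n.
      by rewrite eq_sym; exact: e'rn.
    have [->|ln] := eqVneq l n; first by rewrite innerC e'rn.
    by rewrite !e'E//; exact: eorth.
  + move=> k; have [->|kn] := eqVneq k n; last by rewrite e'E.
    rewrite e'n innerZl//; last exact: L2Z.
    rewrite innerC innerZl// -/N mulrA.
    have [N0|N0] := eqVneq N 0; first by left; rewrite N0 mulr0.
    have NN : 0 < N by rewrite lt_neqAle eq_sym N0 inner_ge0.
    right; rewrite /c -invfM -expr2 sqr_sqrtr ?inner_ge0// mulVf//.
- move=> k t nk; rewrite e'E ?e0//; first exact: ltnW.
  by rewrite gtn_eqF.
- move=> m; rewrite ltnS leq_eqVlt => /predU1P[->|mn]; last first.
    have [a ae] := ea m mn; exists (fun l => if l == n then 0 else a l).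
    apply: filterS ae => t ->; rewrite big_ord_recr/= eqxx mul0r addr0.
    by apply: eq_bigr => l _; rewrite e'E (ltn_eqF (ltn_ord l)).
  exists (fun l => if l == n then Num.sqrt N else inner (psi n) (e l)).
  have rN : {ae mu, forall t, r t = Num.sqrt N * (c * r t)}.
    have [N0|N0] := eqVneq N 0.
      have h : \int[mu]_t (r t ^+ 2) = 0.
        by rewrite -N0; apply: eq_Rintegral => t _; rewrite expr2.
      apply: filterS (Rintegral_eq0_ae r2.2 (fun t => sqr_ge0 _) h) => t /eqP.
      by rewrite sqrf_eq0 => /eqP ->; rewrite !mulr0.
    apply: aeW => t; rewrite /c mulrA divff ?mul1r//.
    by rewrite sqrtr_eq0 -ltNge lt_neqAle eq_sym N0 inner_ge0.
  apply: filterS rN => t rt; rewrite big_ord_recr/= eqxx e'n -rt.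
  rewrite (eq_bigr (fun l : 'I_n => inner (psi n) (e l) * e l t)).
    by rewrite /r /p addrC subrK.
  by move=> l _; rewrite e'E (ltn_eqF (ltn_ord l)).
Qed.

End inner_product.

(** * Mean square errors of a random field *)

Section random_field.
Context {R : realType} {dO dT : measure_display}.
Context {Om : measurableType dO} {T : measurableType dT}.
Variables (P : probability Om R) (mu : probability T R).
Variables (Y : T -> Om -> R) (M : R).
Hypothesis mY : measurable_fun [set: T * Om] (fun p => Y p.1 p.2).
Hypothesis Y_paths : forall w, L2 mu (Y^~ w).
Hypothesis Y_moments : forall t, L2 P (Y t).
Hypothesis Y_bound : forall t, \int[P]_w (Y t w ^+ 2) <= M.

Local Notation inner := (L2_inner mu).
Local Notation pr := (mu \x P)%E.

Definition second_moment t u := \int[P]_w (Y t w * Y u w).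

Lemma bounded_variance : bounded_measurable (fun t => \int[P]_w (Y t w ^+ 2)) /\
  L1 pr (fun p => Y p.1 p.2 ^+ 2).
Proof.
have mY2 : measurable_fun [set: T * Om] (fun p => Y p.1 p.2 ^+ 2).
  exact: measurable_funX.
have mv : measurable_fun [set: T] (fun t => \int[P]_w (Y t w ^+ 2)).
  apply: (measurableT_comp (fine_measurable measurableT)).
  apply: (measurable_fun_fubini_tonelli_F (fun p => (Y p.1 p.2 ^+ 2)%:E)).
    exact/measurable_EFinP.
  by move=> p; rewrite lee_fin sqr_ge0.
have bv : bounded_measurable (fun t => \int[P]_w (Y t w ^+ 2)).
  split=> //; exists M => t; rewrite ger0_norm//.
  by apply: Rintegral_ge0 => w _; exact: sqr_ge0.
split=> //; apply: L1_prod => // [t|]; first exact: (Y_moments t).2.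
rewrite (_ : (fun _ => _) = (fun t => \int[P]_w (Y t w ^+ 2))).
  exact: bounded_L1.
apply/funext => t; apply: eq_Rintegral => w _.
by rewrite ger0_norm ?sqr_ge0.
Qed.

Lemma field_L2 : L2 pr (fun p => Y p.1 p.2).
Proof. by split=> //; exact: bounded_variance.2. Qed.

Lemma L1_path_norm : L1 P (fun w => inner (Y^~ w) (Y^~ w)).
Proof.
rewrite (_ : (fun w => _) = fun w => \int[mu]_t (Y t w ^+ 2)).
  exact: (L1_Rintegral2 bounded_variance.2).
by apply/funext => w; apply: eq_Rintegral => t _; rewrite expr2.
Qed.

Lemma expected_path_norm :
  \int[P]_w inner (Y^~ w) (Y^~ w) = \int[mu]_t second_moment t t.
Proof.
transitivity (\int[P]_w \int[mu]_t (Y t w ^+ 2)).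
  by apply: eq_Rintegral => w _; apply: eq_Rintegral => t _; rewrite expr2.
rewrite -(real_Fubini bounded_variance.2).
by apply: eq_Rintegral => t _; apply: eq_Rintegral => w _; rewrite expr2.
Qed.

Lemma L1_fst (f : T -> R) : L1 mu f -> L1 pr (fun p => f p.1).
Proof.
move=> f1; have := L1_mul_prod f1 (bounded_L1 P (cst_bounded 1)).
by apply: eq_integrable => // p _ /=; rewrite mulr1.
Qed.

Lemma L2_fst (f : T -> R) : L2 mu f -> L2 pr (fun p => f p.1).
Proof.
move=> [mf f2]; split; last exact: (L1_fst f2).
exact: (measurableT_comp mf measurable_fst).
Qed.

Lemma L2_mul_prod (f : T -> R) (g : Om -> R) : L2 mu f -> L2 P g ->
  L2 pr (fun p => g p.2 * f p.1).
Proof.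
move=> [mf f2] [mg g2]; split.
  apply: measurable_funM; first exact: (measurableT_comp mg measurable_snd).
  exact: (measurableT_comp mf measurable_fst).
have := L1_mul_prod f2 g2.
by apply: eq_integrable => // p _ /=; rewrite exprMn mulrC.
Qed.

Lemma coordinate_L2 e : L2 mu e -> L2 P (fun w => inner (Y^~ w) e).
Proof.
move=> e2; have Ye := L2_mul_L1 field_L2 (L2_fst e2).
split; first exact: (measurable_Rintegral2 Ye).
pose N := \int[mu]_t (e t ^+ 2).
apply: (@le_L1 _ _ _ _ _ (fun w => N * inner (Y^~ w) (Y^~ w))).
- by apply: measurable_funX; exact: (measurable_Rintegral2 Ye).
- exact/L1Zl/L1_path_norm.
- move=> w; rewrite ger0_norm ?sqr_ge0// mulrC.
  apply: le_trans (cauchy_schwarz (Y_paths w) e2) _.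
  exact: lexx.
Qed.

(** The variance of the coordinate along [e] is the quadratic form of the
    covariance operator at [e]: expand the square and exchange the expectation
    with one integration at a time. *)
Lemma coordinate_variance e : L2 mu e ->
  \int[P]_w (inner (Y^~ w) e ^+ 2) =
  \int[mu]_u (e u * \int[mu]_t (e t * second_moment t u)).
Proof.
move=> e2; have e1 := L2_L1 e2.
have ne1 : L1 mu (fun t => `|e t|) by exact: (integrable_norm e1).
pose Z w := inner (Y^~ w) e.
have Z2 : L2 P Z by exact: coordinate_L2.
have me (p1 : T * Om -> R) : measurable_fun [set: T * Om] p1 ->
  measurable_fun [set: T * Om] (fun p => p1 p * e p.1).
  move=> mp; apply: measurable_funM => //.
  exact: (measurableT_comp (L1_measurable e1) measurable_fst).
have mYu u : measurable_fun [set: T * Om] (fun p => Y u p.2).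
  exact: (measurableT_comp (Y_moments u).1 measurable_snd).
have [bv Y2] := bounded_variance.
have eY2 : L1 pr (fun p => `|e p.1| * Y p.1 p.2 ^+ 2).
  apply: L1_prod => [|t|].
  - apply: measurable_funM; last exact: measurable_funX.
    exact: (L1_measurable (L1_fst ne1)).
  - exact: (@L1Zl _ _ _ P `|e t| _ (Y_moments t).2).
  - rewrite (_ : (fun _ => _) = fun t => (\int[P]_w (Y t w ^+ 2)) * `|e t|).
      exact: bounded_mul_L1.
    apply/funext => t; rewrite mulrC -RintZl; last exact: (Y_moments t).2.
    apply: eq_Rintegral => w _.
    by rewrite normrM normr_id [`|_ ^+ 2|]ger0_norm// sqr_ge0.
have EYZ u : \int[P]_w (Y u w * Z w) = \int[mu]_t (e t * second_moment t u).
  have F1 : L1 pr (fun p => Y u p.2 * Y p.1 p.2 * e p.1).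
    apply: (@le_L1 _ _ _ _ _
      (fun p => `|e p.1| * Y p.1 p.2 ^+ 2 + `|e p.1| * Y u p.2 ^+ 2)).
    - by apply: me; exact: measurable_funM.
    - by apply: L1D => //; exact: (L1_mul_prod ne1 (Y_moments u).2).
    - move=> p; rewrite -mulrDr normrM mulrC; apply: ler_wpM2l => //.
      by rewrite ler_norml; apply/andP; split; nra.
  transitivity (\int[P]_w \int[mu]_t (Y u w * Y t w * e t)).
    apply: eq_Rintegral => w _; rewrite /Z /L2_inner -RintZl.
      by apply: eq_Rintegral => t _; rewrite mulrA.
    exact: L2_mul_L1.
  rewrite -(real_Fubini F1); apply: eq_Rintegral => t _.
  rewrite /second_moment -RintZl; first by apply: eq_Rintegral => w _; ring.
  exact: L2_mul_L1.
have F2 : L1 pr (fun p => Y p.1 p.2 * Z p.2 * e p.1).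
  apply: (@le_L1 _ _ _ _ _
    (fun p => `|e p.1| * Y p.1 p.2 ^+ 2 + `|e p.1| * Z p.2 ^+ 2)).
  - apply: me; apply: measurable_funM => //.
    exact: (measurableT_comp Z2.1 measurable_snd).
  - by apply: L1D => //; exact: (L1_mul_prod ne1 Z2.2).
  - move=> p; rewrite -mulrDr normrM mulrC; apply: ler_wpM2l => //.
    by rewrite ler_norml; apply/andP; split; nra.
transitivity (\int[P]_w \int[mu]_u (Y u w * Z w * e u)).
  apply: eq_Rintegral => w _; rewrite expr2 -/(Z w) {1}/Z /L2_inner -RintZr.
    by apply: eq_Rintegral => t _; ring.
  exact: L2_mul_L1.
rewrite -(real_Fubini F2); apply: eq_Rintegral => u _.
rewrite -EYZ -RintZl; first by apply: eq_Rintegral => w _; ring.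
exact: L2_mul_L1.
Qed.

Lemma residual_L2 n (psi : nat -> T -> R) : (forall k, L2 mu (psi k)) ->
  L2 pr (fun p => Y p.1 p.2 - \sum_(m < n) inner (Y^~ p.2) (psi m) * psi m p.1).
Proof.
move=> psi2; apply: L2B; first exact: field_L2.
apply: L2_sum => m; apply: (@L2_mul_prod (psi m) (fun w => inner (Y^~ w) (psi m))) => //.
exact: coordinate_L2.
Qed.

Definition residual n (psi : nat -> T -> R) w t :=
  Y t w - \sum_(m < n) inner (Y^~ w) (psi m) * psi m t.

Lemma residual_path_L2 n psi w : (forall k, L2 mu (psi k)) ->
  L2 mu (residual n psi w).
Proof.
by move=> psi2; apply: L2B => //; apply: L2_sum => m; exact: L2Z.
Qed.

Lemma L1_residual n psi : (forall k, L2 mu (psi k)) ->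
  L1 P (fun w => inner (residual n psi w) (residual n psi w)).
Proof.
move=> psi2; rewrite (_ : (fun w => _) = fun w => \int[mu]_t (residual n psi w t ^+ 2)).
  exact: (L1_Rintegral2 (residual_L2 n psi2).2).
by apply/funext => w; apply: eq_Rintegral => t _; rewrite expr2.
Qed.

Lemma mean_square_errorE n (psi : nat -> T -> R) : (forall k, L2 mu (psi k)) ->
  mean_square_error P mu Y (fun m : 'I_n => psi m) =
  (\int[P]_w inner (residual n psi w) (residual n psi w))%:E.
Proof.
move=> psi2; rewrite RintE; last exact: L1_residual.
apply: eq_integral => w _; rewrite RintE.
  by apply: eq_integral => t _; rewrite expr2.
by apply: L2_mul_L1; exact: residual_path_L2.
Qed.

Lemma mean_square_error_proj n e : orthonormal_or0 mu e ->
  mean_square_error P mu Y (fun m : 'I_n => e m) =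
  (\int[mu]_t second_moment t t -
   \sum_(m < n) \int[P]_w (inner (Y^~ w) (e m) ^+ 2))%:E.
Proof.
move=> eo; have [e2 _ _] := eo; rewrite mean_square_errorE//; congr EFin.
transitivity (\int[P]_w (inner (Y^~ w) (Y^~ w) -
    \sum_(m < n) inner (Y^~ w) (e m) ^+ 2)).
  by apply: eq_Rintegral => w _; exact: inner_sub_proj.
have Z1 m : L1 P (fun w => inner (Y^~ w) (e m) ^+ 2).
  exact: (coordinate_L2 (e2 m)).2.
rewrite RintB; [|exact: L1_path_norm|exact: L1_sum].
by rewrite expected_path_norm Rint_sum.
Qed.

(** The approximants are combinations of arbitrary functions [psi m], but each
    path of the approximation lies in their span, where the orthogonal projection
    is at least as good. *)
Lemma mean_square_error_ge n (psi : nat -> T -> R) : (forall k, L2 mu (psi k)) ->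
  exists2 e, orthonormal_or0 mu e &
    ((\int[mu]_t second_moment t t -
      \sum_(m < n) \int[P]_w (inner (Y^~ w) (e m) ^+ 2))%R%:E <=
    mean_square_error P mu Y (fun m : 'I_n => psi m))%E.
Proof.
move=> psi2; have [e [eo e0 ea]] := gram_schmidt n psi2.
exists e => //; have [e2 _ _] := eo.
rewrite -(mean_square_error_proj _ eo) (mean_square_errorE _ psi2) (mean_square_errorE _ e2) lee_fin.
apply: Rint_le; [exact: L1_residual|exact: L1_residual|move=> w].
have [a ae] := choice (fun m : 'I_n => ea m (ltn_ord m)).
pose b l := \sum_(m < n) inner (Y^~ w) (psi m) * a m l.
have -> : inner (residual n psi w) (residual n psi w) =
    inner (fun t => Y t w - \sum_(l < n) b l * e l t)
          (fun t => Y t w - \sum_(l < n) b l * e l t).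
  have rb : {ae mu, forall t, residual n psi w t = Y t w - \sum_(l < n) b l * e l t}.
    have aa : {ae mu, forall t, forall m : 'I_n, psi m t = \sum_(l < n) a m l * e l t}.
      have : {ae mu, forall t, forall m : 'I_n, [set: 'I_n] m ->
          psi m t = \sum_(l < n) a m l * e l t}.
        by apply: filter_forall => m; apply: filterS (ae m) => t.
      by apply: filterS => t h m; exact: h.
    apply: filterS aa => t h; congr (_ - _).
    rewrite (eq_bigr (fun m : 'I_n => \sum_(l < n)
      inner (Y^~ w) (psi m) * a m l * e l t)); last first.
      by move=> m _; rewrite {1}h mulr_sumr; apply: eq_bigr => l _; rewrite mulrA.
    rewrite exchange_big; apply: eq_bigr => l _; rewrite /b mulr_suml.
    by [].
  have r2 := residual_path_L2 n w psi2.
  have s2 : L2 mu (fun t => Y t w - \sum_(l < n) b l * e l t).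
    by apply: L2B => //; exact: L2_comb.
  apply: ae_eq_Rintegral.
  - exact: (L1_measurable (L2_mul_L1 r2 r2)).
  - exact: (L1_measurable (L2_mul_L1 s2 s2)).
  - by apply: filterS rb => t ->.
rewrite /residual inner_sub_proj//.
exact: proj_optimal.
Qed.

End random_field.

(** * Null sets *)

Section null_complement.
Context {R : realType} {d : measure_display} {T : measurableType d}.
Variables (mu : {measure set T -> \bar R}) (D : set T).
Hypotheses (mD : measurable D) (D0 : mu (~` D) = 0%E).
Local Open Scope ereal_scope.
Import HBNNSimple.

Let ge0_integral_null_compl (f : T -> \bar R) : (forall x, 0 <= f x) ->
  \int[mu]_x f x = \int[mu]_(x in D) f x.
Proof.
move=> f0; rewrite ge0_integralTE// ge0_integralE//.
apply/eqP; rewrite eq_le; apply/andP; split; apply: ge_ereal_sup => _ [h /= hf <-].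
- have hD x : proj_nnsfun h mD x = (h \_ D) x by rewrite (mrestrict h mD).
  apply: ereal_sup_ubound; exists (proj_nnsfun h mD).
    by move=> x; rewrite hD /patch; case: (x \in D) => //; exact: hf.
  rewrite -!integralT_nnsfun.
  rewrite [RHS](@ge0_negligible_integral _ _ _ mu setT (~` D))//.
  + rewrite setTD setCK [RHS]integral_mkcond; apply: eq_integral => x _.
    by rewrite restrict_EFin hD.
  + exact: measurableC.
  + exact/measurable_EFinP.
  + by move=> x _; rewrite lee_fin.
- apply: ereal_sup_ubound; exists h => //= x.
  by apply: (le_trans (hf x)); rewrite /patch; case: ifP.
Qed.

(** This holds for functions that are not measurable: simple functions below [f]
    may be cut off outside of [D]. *)
Lemma integral_null_compl (f : T -> \bar R) :
  \int[mu]_x f x = \int[mu]_(x in D) f x.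
Proof. by rewrite integralE [RHS]integralE !ge0_integral_null_compl. Qed.

Lemma eq_Rintegral_null_compl (f g : T -> R) : (forall x, D x -> f x = g x) ->
  (\int[mu]_x f x = \int[mu]_x g x)%R.
Proof.
move=> fg; congr fine; rewrite integral_null_compl [RHS]integral_null_compl.
by apply: eq_integral => x; rewrite inE => /fg ->.
Qed.

End null_complement.

(** * Joint measurability *)

Section caratheodory.
Context {R : realType} {d : measure_display} {T : measurableType d}.

(** A function measurable in one variable and continuous in the other is a limit
    of functions that are piecewise constant in the latter. *)
Lemma measurable_caratheodory (F : R -> T -> R) :
  (forall q, measurable_fun [set: T] (F q)) ->
  (forall y, seq_continuous01 (F^~ y)) ->
  (forall t y, t \notin `[0, 1] -> F t y = 0) ->
  measurable_fun [set: R * T] (fun p => F p.1 p.2).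
Proof.
move=> mF Fc F_out.
(* n.+2 intervals, because the point 1 opens an interval of its own *)
pose I n i : set R := `[i%:R / n.+1%:R, i.+1%:R / n.+1%:R[%classic.
pose G n (p : R * T) := \1_(`[0, 1]%classic : set R) p.1 *
  \sum_(i < n.+2) \1_(I n i) p.1 * F (i%:R / n.+1%:R) p.2.
have m1 (A : set R) : measurable A ->
    measurable_fun [set: R * T] (fun p => \1_A p.1 : R).
  by move=> mA; apply: (measurableT_comp (measurable_indic mA) measurable_fst).
apply: (measurable_fun_cvg (h := G)) => [n|[t y] _ /=].
- apply: measurable_funM; first exact: m1.
  apply: measurable_sum => i; apply: measurable_funM.
    by apply: m1; exact: measurable_itv.
  exact: (measurableT_comp (mF _) measurable_snd).
- have [t01|t01] := boolP (t \in `[0, 1]); last first.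
    rewrite F_out//; apply: cvg_near_cst; apply: nearW => n.
    by rewrite /G /= indicE memNset ?mul0r//; exact/negP.
  have := t01; rewrite in_itv/= => /andP[t0 t1].
  pose i n := Num.truncn (t * n.+1%:R).
  have n0 n : (0 : R) < n.+1%:R by [].
  have iP n : (i n)%:R / n.+1%:R <= t < (i n).+1%:R / n.+1%:R.
    rewrite ler_pdivrMr// ltr_pdivlMr//; apply: truncn_itv.
    by rewrite mulr_ge0.
  have in_ n : (i n < n.+2)%N.
    rewrite ltnS -(ler_nat R) -[leRHS](mul1r n.+1%:R) -ler_pdivrMr//.
    by case/andP: (iP n) => /le_trans + _; apply.
  have GE n : G n (t, y) = F ((i n)%:R / n.+1%:R) y.
    rewrite /G /= indicE mem_set// mul1r (bigD1 (Ordinal (in_ n)))//= big1.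
      rewrite indicE mem_set ?mul1r ?addr0//.
      by rewrite /I /= in_itv/=; exact: iP.
    move=> j ji; rewrite indicE memNset ?mul0r// /I /= in_itv/=.
    move=> /andP[jt tj]; case/negP : ji; apply/eqP/val_inj => /=.
    apply/esym/truncn_def; rewrite -ler_pdivrMr// -ltr_pdivlMr//.
    by apply/andP.
  under eq_fun do rewrite GE.
  apply: Fc => // [n|].
    rewrite in_itv/= divr_ge0//=.
    by case/andP: (iP n) => /le_trans + _; apply.
  apply/cvgrPdist_le => e e0; near=> n.
  have /andP[it ti] := iP n.
  rewrite ger0_norm ?subr_ge0// lerBlDr.
  apply: (le_trans (ltW ti)); rewrite -natr1 mulrDl addrC lerD2r mul1r.
  by apply: ltW; near: n; exact: (near_infty_natSinv_lt (PosNum e0)).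
Unshelve. all: by end_near. Qed.

End caratheodory.

(** * The kernel of a process *)

Section process_kernel.
Context {R : realType} {dO : measure_display} {Om : measurableType dO}.
Variable P : probability Om R.

Lemma covfun_second_moment I (D : set I) (Z : I -> Om -> R) t u :
  zero_mean_on P D Z -> D t -> D u ->
  covfun P Z t u = \int[P]_w (Z t w * Z u w).
Proof.
move=> Z0 Dt Du; have [t2 t0] := Z0 t Dt; have [u2 u0] := Z0 u Du.
have sub12 f : f \in Lfun P 2%:E -> f \in Lfun P 1.
  by move=> f2; apply: Lfun_subset12 f2; rewrite fin_num_measure.
rewrite /covfun (covarianceE (sub12 _ t2) (sub12 _ u2) (Lfun2_mul_Lfun1 t2 u2)).
by rewrite t0 mul0e sube0 unlock.
Qed.

Variable X : R -> Om -> R.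
Hypothesis X0 : zero_mean_on P `[0, 1] X.
Hypothesis Xc : {within `[0, 1] `*` `[0, 1],
    continuous (fun p : R * R => covfun P X p.1 p.2)}.

(** Nothing is assumed about [X] off the unit interval; extending it by zero makes
    its kernel positive, bounded and measurable on the whole plane. *)
Definition process01 (t : R) (w : Om) := if t \in `[0, 1] then X t w else 0.
Definition cov01 (t u : R) := \int[P]_w (process01 t w * process01 u w).

Lemma cov01E t u : t \in `[0, 1] -> u \in `[0, 1] -> covfun P X t u = cov01 t u.
Proof.
move=> t01 u01; rewrite (covfun_second_moment X0)//.
by apply: eq_Rintegral => w _; rewrite /process01 t01 u01.
Qed.

Lemma cov01_sym t u : cov01 t u = cov01 u t.
Proof. by apply: eq_Rintegral => w _; rewrite mulrC. Qed.

Lemma cov01_out t u : u \notin `[0, 1] -> cov01 t u = 0.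
Proof.
move=> u01; rewrite -[RHS](Rint_cst P); apply: eq_Rintegral => w _.
by rewrite /process01 (negbTE u01) mulr0.
Qed.

Lemma process01_L2 t : L2 P (process01 t).
Proof.
rewrite /process01; have [t01|_] := boolP (t \in `[0, 1]); last first.
  exact/bounded_L2/cst_bounded.
by apply/L2_Lfun; have [] := @X0 t t01.
Qed.

Lemma cov01_psd : psd_kernel cov01.
Proof.
move=> s; have X1 t u : L1 P (fun w => process01 t w * process01 u w).
  by apply: L2_mul_L1; exact: process01_L2.
have -> : \sum_(p <- s) \sum_(q <- s) p.1 * q.1 * cov01 p.2 q.2 =
    \int[P]_w ((\sum_(p <- s) p.1 * process01 p.2 w) ^+ 2).
  transitivity (\int[P]_w \sum_(p <- s) \sum_(q <- s)
      p.1 * q.1 * (process01 p.2 w * process01 q.2 w)).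
    rewrite Rint_sum => [|p]; last by apply: L1_sum => q _; exact: L1Zl.
    apply: eq_bigr => p _; rewrite Rint_sum => [|q]; last exact: L1Zl.
    by apply: eq_bigr => q _; rewrite RintZl.
  apply: eq_Rintegral => w _; rewrite expr2 mulr_suml; apply: eq_bigr => p _.
  by rewrite mulr_sumr; apply: eq_bigr => q _; ring.
by apply: Rintegral_ge0 => w _; exact: sqr_ge0.
Qed.

Let joint_cvg {I : Type} (F : set_system I) (u v : I -> R) (x y : R) : Filter F ->
  (\forall n \near F, u n \in `[0, 1] /\ v n \in `[0, 1]) ->
  x \in `[0, 1] -> y \in `[0, 1] ->
  u @ F --> x -> v @ F --> y ->
  (fun n => covfun P X (u n) (v n)) @ F --> covfun P X x y.
Proof.
move=> FF uv01 x01 y01 ux vy.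
have /subspace_continuousP/(_ (x, y)) := Xc.
move=> /(_ (conj x01 y01)) H; apply: cvg_trans H => A /= HA.
have uvxy : (fun n => (u n, v n)) @ F --> (x, y) by apply: (cvg_pair ux vy).
have := uvxy _ HA; rewrite /= => HB.
by apply: filterS2 uv01 HB => n [u01 v01]; apply.
Qed.

Lemma cov01_seq_continuous t : seq_continuous01 (cov01 t).
Proof.
have [t01|t01] := boolP (t \in `[0, 1]); last first.
  move=> u x _ _ _; rewrite cov01_sym cov01_out//.
  by under eq_fun do rewrite cov01_sym cov01_out//; exact: cvg_cst.
move=> u x u01 x01 ux; rewrite -cov01E//.
under eq_fun do rewrite -cov01E//.
apply: (@joint_cvg _ _ (fun=> t)) => //; last exact: cvg_cst.
exact: nearW.
Qed.

(** Joint measurability follows from continuity in each variable; a continuous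
    variance is bounded, and the variance bounds the covariance. *)
Lemma bounded_cov01 : bounded_kernel cov01.
Proof.
split.
  apply: measurable_caratheodory => [q|y|t y t01].
  - have : measurable_fun [set: R * R] (fun p : R * R => cov01 q p.1).
      apply: (@measurable_caratheodory _ _ _ (fun t (_ : R) => cov01 q t)) => [t|_|t _].
      + exact: measurable_cst.
      + exact: cov01_seq_continuous.
      + exact: cov01_out.
    by move=> /(measurable_section2 (0 : R)).
  - rewrite (_ : _^~ y = cov01 y); last by apply/funext => t; exact: cov01_sym.
    exact: cov01_seq_continuous.
  - by rewrite cov01_sym cov01_out.
have diag : {within `[0, 1], continuous (fun t => covfun P X t t)}.
  apply/subspace_continuousP => x x01.
  have FF : Filter (within `[0, 1] (nbhs x)) by exact: within_filter.
  apply: joint_cvg => //.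
  - by near=> t; have : t \in `[0, 1]; [near: t; exact: withinT|].
  - exact: cvg_within.
  - exact: cvg_within.
have [c c01 cmax] := EVT_max ler01 diag.
exists (covfun P X c c) => -[t u] /=.
have diag_le s : cov01 s s <= covfun P X c c.
  have [s01|s01] := boolP (s \in `[0, 1]); first by rewrite -cov01E// cmax.
  rewrite cov01_out// cov01E// /cov01.
  by apply: Rintegral_ge0 => w _; rewrite -expr2 sqr_ge0.
have X2 s : L1 P (fun w => process01 s w * process01 s w).
  by apply: L2_mul_L1; exact: process01_L2.
have XX : L1 P (fun w => process01 t w * process01 u w).
  by apply: L2_mul_L1; exact: process01_L2.
apply: (@le_trans _ _ (2^-1 * (cov01 t t + cov01 u u))); last first.
  by have := diag_le t; have := diag_le u => h1 h2; lra.
rewrite -RintD// -RintZl; last exact: L1D.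
have Rle' f g : L1 P f -> L1 P g -> (forall w, `|f w| <= g w) ->
    `|\int[P]_w f w| <= \int[P]_w g w.
  move=> f1 g1 fg; apply: le_trans; first exact: le_normr_Rintegral.
  by apply: Rint_le => //; exact: (integrable_norm f1).
apply: Rle' => //; first by apply: L1Zl; exact: L1D.
move=> w; set a := process01 t w; set b := process01 u w.
have := sqr_ge0 (a - b); have := sqr_ge0 (a + b) => h1 h2.
by rewrite ler_norml; apply/andP; split; nra.
Unshelve. all: by end_near. Qed.

Variables (lam : nat -> R) (psi : nat -> R -> R).
Hypothesis eig : is_eigensystem leb01 (covfun P X) lam psi.

Lemma integral_operator_cov01 (f : R -> R) t : t \in `[0, 1] ->
  integral_operator leb01 (covfun P X) f t = \int[leb01]_u (cov01 t u * f u).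
Proof.
move=> t01; rewrite /integral_operator.
apply: (@eq_Rintegral_null_compl _ _ (measurableTypeR R) leb01 `[0, 1]%classic).
- exact: measurable_itv.
- exact: leb01_setC01.
- by move=> u u01; rewrite cov01E.
Qed.

Lemma cov01_eig k : {ae leb01, forall t,
  \int[leb01]_u (cov01 t u * psi k u) = lam k * psi k t}.
Proof.
have [_ _ Kpsi _ _] := eig.
by apply: leb01_aeS2 (Kpsi k) ae_leb01_in => t + t01; rewrite integral_operator_cov01.
Qed.

Lemma cov01_complete (m : R) (f : R -> R) : m != 0 -> bounded_measurable f ->
  {ae leb01, forall t, \int[leb01]_u (cov01 t u * f u) = m * f t} ->
  exists n (c : nat -> R),
    {ae leb01, forall t, f t = \sum_(k < n | lam k == m) c k * psi k t}.
Proof.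
have [_ _ _ _ comp] := eig; move=> m0 fb Kf; apply: comp => //.
  by apply/(L2_Lfun leb01); apply: bounded_L2.
by apply: leb01_aeS2 Kf ae_leb01_in => t + t01; rewrite integral_operator_cov01.
Qed.

Lemma psi_L2 k : L2 leb01 (psi k).
Proof. by have [_ psi2 _ _ _] := eig; apply/L2_Lfun. Qed.

End process_kernel.

(** * A modification with square integrable paths *)

Section modification.
Context {R : realType} {dO dT : measure_display}.
Context {Om : measurableType dO} {T : measurableType dT}.
Variables (P : probability Om R) (mu : probability T R) (D : set T).
Variables (Y : T -> Om -> R) (M : R).
Hypotheses (mD : measurable D) (D0 : mu (~` D) = 0%E).
Hypothesis mY : measurable_fun (D `*` [set: Om]) (fun p => Y p.1 p.2).
Hypothesis Y2 : forall t, D t -> L2 P (Y t).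
Hypothesis YM : forall t, D t -> \int[P]_w (Y t w ^+ 2) <= M.

Let Y1 t w := if t \in D then Y t w else 0.

Let mY1 : measurable_fun [set: T * Om] (fun p => Y1 p.1 p.2).
Proof.
rewrite (_ : (fun p => _) = (fun p => Y p.1 p.2) \_ (D `*` setT)).
  by apply/(measurable_restrictT _ (measurableX mD measurableT)).
apply/funext => -[t w]; rewrite /Y1 /patch /=.
by congr (if _ then _ else _); apply/idP/idP; rewrite !inE//= => -[].
Qed.

Let Y1_L2 t : L2 P (Y1 t).
Proof.
rewrite /Y1; have [tD|_] := boolP (t \in D); last exact/bounded_L2/cst_bounded.
by apply: Y2; exact: set_mem.
Qed.

Let pathnorm w := (\int[mu]_t (Y1 t w ^+ 2)%:E)%E.

Let mY1sqr : measurable_fun [set: T * Om] (fun p => (Y1 p.1 p.2 ^+ 2)%:E).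
Proof. by apply/measurable_EFinP; exact: measurable_funX. Qed.

Let mpathnorm : measurable_fun [set: Om] pathnorm.
Proof.
apply: (measurable_fun_fubini_tonelli_G (fun p => (Y1 p.1 p.2 ^+ 2)%:E)) => //.
by move=> p; rewrite lee_fin sqr_ge0.
Qed.

Let good := [set w | (pathnorm w < +oo)%E].

Let mgood : measurable good.
Proof. by rewrite -[good]setTI; exact: emeasurable_fun_infty_o. Qed.

Let good0 : P (~` good) = 0%E.
Proof.
have ge0 w : (0 <= pathnorm w)%E.
  by apply: integral_ge0 => t _; rewrite lee_fin sqr_ge0.
have : P.-integrable [set: Om] pathnorm.
  apply/integrableP; split => //.
  under eq_integral do rewrite gee0_abs//.
  rewrite -(@fubini_tonelli _ _ _ _ _ mu P (fun p => (Y1 p.1 p.2 ^+ 2)%:E))//; last first.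
    by move=> p; rewrite lee_fin sqr_ge0.
  apply: (@le_lt_trans _ _ (\int[mu]_t (`|M|)%:E)%E).
    apply: ge0_le_integral => //.
    - by move=> t _; apply: integral_ge0 => w _; rewrite lee_fin sqr_ge0.
    - apply: (measurable_fun_fubini_tonelli_F (fun p => (Y1 p.1 p.2 ^+ 2)%:E)) => //.
      by move=> p; rewrite lee_fin sqr_ge0.
    - move=> t _; rewrite -RintE; last exact: (Y1_L2 t).2.
      rewrite lee_fin /Y1; have [tD|_] := boolP (t \in D).
        by rewrite (le_trans _ (ler_norm M))// YM//; exact: set_mem.
      rewrite (_ : \int[P]_w _ = 0)// -[RHS](Rint_cst P).
      by apply: eq_Rintegral => w _; rewrite expr0n.
  by rewrite -RintE ?ltry//; exact/bounded_L1/cst_bounded.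
move=> /integrable_ae => /(_ measurableT) ae.
apply: measure_negligible; first exact: measurableC.
apply: negligibleS ae => w /= wg wf; apply: wg.
by rewrite /good /= ltey_eq (wf I).
Qed.

(** The field is set to zero off [D] and on the event of paths of infinite norm.
    The event is negligible and [D] has full measure, so neither the errors nor
    the second moments on [D] change. *)
Definition modification t w := if (t \in D) && (w \in good) then Y t w else 0.
Local Notation Yg := modification.

Lemma modificationE t w : w \in good -> Yg t w = Y1 t w.
Proof. by rewrite /modification /Y1 => ->; rewrite andbT. Qed.

Lemma modification_measurable : measurable_fun [set: T * Om] (fun p => Yg p.1 p.2).
Proof.
rewrite (_ : (fun p => _) = (fun p => Y1 p.1 p.2 * (\1_good p.2 : R))).
  apply: measurable_funM => //.
  exact: (measurableT_comp (measurable_indic mgood) measurable_snd).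
apply/funext => -[t w]; rewrite /modification /Y1 indicE /=.
by case: (t \in D); case: (w \in good); rewrite ?mulr1 ?mulr0 ?mul0r.
Qed.

Lemma modification_paths w : L2 mu (Yg^~ w).
Proof.
have mYg : measurable_fun [set: T] (Yg^~ w).
  exact: (measurable_section2 w modification_measurable).
split=> //; have [wg|wg] := boolP (w \in good); last first.
  rewrite (_ : (fun x => _) = cst 0); last first.
    by apply/funext => t; rewrite /modification (negbTE wg) andbF expr0n.
  exact/bounded_L1/cst_bounded.
apply/integrableP; split; first by apply/measurable_EFinP; exact: measurable_funX.
move: (wg); rewrite inE /good /= /pathnorm; apply: le_lt_trans.
rewrite le_eqVlt; apply/orP; left; apply/eqP; apply: eq_integral => t _ /=.
by rewrite (modificationE t wg) ger0_norm ?sqr_ge0.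
Qed.

Lemma modification_moments t : L2 P (Yg t) /\ \int[P]_w (Yg t w ^+ 2) <= `|M|.
Proof.
have mg : measurable_fun [set: Om] (Yg t).
  exact: (measurable_section1 t modification_measurable).
have le1 w : Yg t w ^+ 2 <= Y1 t w ^+ 2.
  rewrite /modification /Y1; case: (t \in D) => //=.
  by case: (w \in good) => //; rewrite expr0n sqr_ge0.
have Y1M : \int[P]_w (Y1 t w ^+ 2) <= `|M|.
  rewrite /Y1; have [tD|_] := boolP (t \in D).
    by rewrite (le_trans _ (ler_norm M))// YM//; exact: set_mem.
  rewrite (_ : \int[P]_w _ = 0)// -[RHS](Rint_cst P).
  by apply: eq_Rintegral => w _; rewrite expr0n.
have g2 : L1 P (fun w => Yg t w ^+ 2).
  apply: (le_L1 _ (Y1_L2 t).2) => [|w]; first exact: measurable_funX.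
  by rewrite ger0_norm ?sqr_ge0.
split=> //; apply: le_trans Y1M; apply: Rint_le => //; exact: (Y1_L2 t).2.
Qed.

Lemma modification_second_moment t u : D t -> D u ->
  second_moment P Yg t u = \int[P]_w (Y t w * Y u w).
Proof.
move=> Dt Du; apply: (eq_Rintegral_null_compl mgood good0) => w wg.
by rewrite /modification !mem_set.
Qed.

Lemma mean_square_error_modification n (psi : 'I_n -> T -> R) :
  mean_square_error P mu Y psi = mean_square_error P mu Yg psi.
Proof.
rewrite /mean_square_error; etransitivity; first exact: (integral_null_compl mgood good0).
etransitivity; last by apply/esym; exact: (integral_null_compl mgood good0).
apply: eq_integral => w wg.
rewrite (integral_null_compl mD D0) [RHS](integral_null_compl mD D0).
have YY t : t \in D -> Y t w = Yg t w by move=> tD; rewrite /modification tD wg.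
apply: eq_integral => t tD; rewrite YY//; congr ((_ - _) ^+ 2)%:E.
apply: eq_bigr => m _; congr (_ * _).
apply: (eq_Rintegral_null_compl mD D0) => x Dx.
by rewrite YY ?mem_set.
Qed.

End modification.

(** * The spectrum of an additive kernel *)

Lemma dominated_Rintegral {R : realType} {d} {T : measurableType d}
    (mu : probability T R) (F : nat -> T -> R) (f g : T -> R) :
  (forall n, measurable_fun [set: T] (F n)) -> L1 mu g ->
  (forall n x, `|F n x| <= g x) -> (forall x, F ^~ x @ \oo --> f x) ->
  (fun n => \int[mu]_x F n x) @ \oo --> \int[mu]_x f x.
Proof.
move=> mF g1 Fg Ff.
have fg x : `|f x| <= g x.
  have H : (fun n => `|F n x|) @ \oo --> `|f x| by apply: cvg_norm; exact: Ff.
  exact: (cvgr_to_le H (nearW _ (fun n => Fg n x))).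
have f1 : L1 mu f.
  by apply: (le_L1 _ g1) => //; apply: (measurable_fun_cvg mF) => x _; exact: Ff.
have : (fun n => \int[mu]_x (F n x)%:E)%E @ \oo --> (\int[mu]_x (f x)%:E)%E.
  apply: (@dominated_cvg _ _ _ mu _ measurableT
      (fun n x => (F n x)%:E) _ (fun x => (g x)%:E)) => //.
  - by move=> n; exact/measurable_EFinP.
  - by move=> x _; apply/cvg_EFin; [exact: nearW|exact: Ff].
  - by move=> n x _; rewrite /= lee_fin.
by rewrite -RintE// => /fine_cvg.
Qed.

Lemma cvg_finite_sum {R : realType} I (s : seq I) (f : I -> nat -> R) (l : I -> R) :
  (forall i, f i @ \oo --> l i) ->
  (fun n => \sum_(i <- s) f i n) @ \oo --> \sum_(i <- s) l i.
Proof.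
move=> fl; elim: s => [|i s IH].
  by under eq_fun do rewrite big_nil; rewrite big_nil; exact: cvg_cst.
under eq_fun do rewrite big_cons; rewrite big_cons.
by apply: cvgD => //; exact: fl.
Qed.

Section additive_kernel.
Context {R : realType}.
Variable d : nat.
Local Notation mu := (@leb01 R).
Local Notation nu := (@leb_cube R d).
Local Notation inner := (L2_inner nu).
Variables (K G : nat -> R -> R -> R) (lam : nat -> nat -> R).
Variables (phi : nat -> nat -> R -> R) (k0 : nat -> nat).
Hypothesis Kb : forall j, bounded_kernel (K j).
Hypothesis Gb : forall j, bounded_kernel (G j).
Hypothesis lam_ge0 : forall j k, 0 <= lam j k.
Hypothesis phib : forall j k, bounded_measurable (phi j k).
Hypothesis phi_lam0 : forall j k t, lam j k = 0 -> phi j k t = 0.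
Hypothesis phi_orth : forall j k l,
  lam j k * \int[mu]_t (phi j k t * phi j l t) = lam j k * (k == l)%:R.
Hypothesis phi_k0 : forall j, {ae mu, forall t, phi j (k0 j) t = 1}.
Hypothesis lam_k0 : forall j, lam j (k0 j) != 0.
Hypothesis partial_bound : forall j, exists M : R, forall n t s,
  `|\sum_(k < n) lam j k * phi j k t * phi j k s| <= M.
Hypothesis partial_cvg : forall j t s,
  (fun n => \sum_(k < n) lam j k * phi j k t * phi j k s) @ \oo --> G j t s.
Hypothesis mercerK : forall j, {ae mu, forall s, forall u, K j s u = G j s u}.

(** The coordinates of a uniform point of the cube are uniform. *)
Lemma ae_cube (i : 'I_d) (A : R -> Prop) : {ae mu, forall x, A x} ->
  {ae nu, forall t, A (tnth t i)}.
Proof.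
move=> [N [mN N0 AN]].
have bN : bounded_measurable (\1_N : R -> R).
  split; first exact: measurable_indic.
  by exists 1 => x; rewrite indicE; case: (_ \in _); rewrite ?normr0 ?normr1.
have iN0 : \int[nu]_t (\1_N (tnth t i) : R) = 0.
  rewrite (integral_cube_tnth i bN) -[RHS](Rint_cst mu); apply: ae_eq_Rintegral => //.
  exists N; split=> // x /= /eqP; rewrite indicE.
  by case: (boolP (x \in N)) => [/set_mem//|_]; rewrite eqxx.
have N_ge0 (t : d.-tuple R) : 0 <= \1_N (tnth t i) :> R by rewrite indicE ler0n.
have := Rintegral_eq0_ae (bounded_L1 nu (bounded_tnth i bN)) N_ge0 iN0.
apply: filterS => t /eqP; rewrite indicE pnatr_eq0 eqb0 => /negP tN.
by apply: contrapT => nA; apply: tN; apply/mem_set/AN.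
Qed.

(** The quadratic form of the integral operator with kernel K_i(t_i, u_i). *)
Definition quad (i : 'I_d) (e : d.-tuple R -> R) :=
  \int[nu]_u (e u * \int[nu]_t (e t * K i (tnth t i) (tnth u i))).

Definition lift_coord (i : 'I_d) (f : R -> R) (t : d.-tuple R) := f (tnth t i).

Lemma bounded_lift i f : bounded_measurable f -> bounded_measurable (lift_coord i f).
Proof. exact: bounded_tnth. Qed.

Lemma bounded_coord2 (i : 'I_d) (L : R -> R -> R) : bounded_kernel L ->
  bounded_kernel (fun t u : d.-tuple R => L (tnth t i) (tnth u i)).
Proof.
move=> Lb; apply: (bounded_comp
  (g := fun p : d.-tuple R * d.-tuple R => (tnth p.1 i, tnth p.2 i)) Lb).
apply: measurable_fun_pair.
- exact: (measurableT_comp (measurable_tnth i) measurable_fst).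
- exact: (measurableT_comp (measurable_tnth i) measurable_snd).
Qed.

(** Mercer's expansion inserted in the quadratic form; the bound on the partial
    sums provides the domination. *)
Lemma quad_cvg (i : 'I_d) e : L2 nu e ->
  (fun n => \sum_(k < n) lam i k * inner e (lift_coord i (phi i k)) ^+ 2) @ \oo
    --> quad i e.
Proof.
move=> e2; have e1 := L2_L1 e2.
have ee1 : L1 (nu \x nu)%E (fun p => e p.1 * e p.2) by exact: L1_mul_prod.
have LK (L : R -> R -> R) : bounded_kernel L ->
    L1 (nu \x nu)%E (fun p => e p.1 * e p.2 * L (tnth p.1 i) (tnth p.2 i)).
  move=> Lb; have := bounded_mul_L1 (bounded_coord2 i Lb) ee1.
  by apply: eq_integrable => // p _ /=; rewrite mulrC.
have iter (L : R -> R -> R) : bounded_kernel L ->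
    \int[(nu \x nu)%E]_p (e p.1 * e p.2 * L (tnth p.1 i) (tnth p.2 i)) =
    \int[nu]_t (e t * \int[nu]_u (e u * L (tnth t i) (tnth u i))).
  move=> Lb; rewrite -(real_Fubini1 (LK L Lb)); apply: eq_Rintegral => t _ /=.
  rewrite -RintZl; first by apply: eq_Rintegral => u _; rewrite mulrA.
  have Ltb : bounded_measurable (fun u : d.-tuple R => L (tnth t i) (tnth u i)).
    exact: (bounded_kernelE t (bounded_coord2 i Lb)).
  have := bounded_mul_L1 Ltb e1.
  by apply: eq_integrable => // u _ /=; rewrite mulrC.
have -> : quad i e = \int[(nu \x nu)%E]_p (e p.1 * e p.2 * G i (tnth p.1 i) (tnth p.2 i)).
  transitivity (\int[(nu \x nu)%E]_p (e p.1 * e p.2 * K i (tnth p.1 i) (tnth p.2 i))).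
    rewrite -(real_Fubini2 (LK _ (Kb i))); apply: eq_Rintegral => u _ /=.
    rewrite -RintZl; first by apply: eq_Rintegral => t _; ring.
    have Kub := bounded_kernelEr u (bounded_coord2 i (Kb i)).
    have := bounded_mul_L1 Kub e1.
    by apply: eq_integrable => // t _ /=; rewrite mulrC.
  have mL (L : R -> R -> R) : bounded_kernel L -> measurable_fun [set: d.-tuple R]
      (fun t => e t * \int[nu]_u (e u * L (tnth t i) (tnth u i))).
    move=> Lb; rewrite (_ : (fun t => _) = fun t => \int[nu]_u (e t * e u * L (tnth t i) (tnth u i))).
      exact: (measurable_Rintegral1 (LK L Lb)).
    apply/funext => t; rewrite -RintZl; first by apply: eq_Rintegral => u _; rewrite mulrA.
    have Ltb : bounded_measurable (fun u : d.-tuple R => L (tnth t i) (tnth u i)).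
      exact: (bounded_kernelE t (bounded_coord2 i Lb)).
    have := bounded_mul_L1 Ltb e1.
    by apply: eq_integrable => // u _ /=; rewrite mulrC.
  etransitivity; first by apply: iter; exact: Kb.
  etransitivity; last by apply/esym; apply: iter; exact: Gb.
  apply: ae_eq_Rintegral; [by apply: mL; exact: Kb|by apply: mL; exact: Gb|].
  apply: filterS (ae_cube i (mercerK i)) => t KG.
  by congr (_ * _); apply: eq_Rintegral => u _; rewrite KG.
have Sb n : bounded_kernel (fun t s => \sum_(k < n) lam i k * phi i k t * phi i k s).
  apply: bounded_sum => k; apply: boundedM.
    by apply: boundedZ; exact: (bounded_comp (phib i k) measurable_fst).
  exact: (bounded_comp (phib i k) measurable_snd).
have -> : (fun n => \sum_(k < n) lam i k * inner e (lift_coord i (phi i k)) ^+ 2) =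
    fun n => \int[(nu \x nu)%E]_p (e p.1 * e p.2 *
      \sum_(k < n) lam i k * phi i k (tnth p.1 i) * phi i k (tnth p.2 i)).
  apply/funext => n; rewrite (iter _ (Sb n)).
  have ep k : L1 nu (fun u => e u * phi i k (tnth u i)).
    by apply: L2_mul_L1 => //; apply: bounded_L2; exact: (bounded_lift i (phib i k)).
  transitivity (\int[nu]_t \sum_(k < n) lam i k * inner e (lift_coord i (phi i k)) *
     (e t * phi i k (tnth t i))).
    rewrite Rint_sum => [|k]; last exact: L1Zl.
    by apply: eq_bigr => k _; rewrite RintZl// expr2 mulrA.
  apply: eq_Rintegral => t _.
  transitivity (e t * \int[nu]_u \sum_(k < n) lam i k * phi i k (tnth t i) *
      (e u * phi i k (tnth u i))).
    rewrite Rint_sum => [|k]; last exact: L1Zl.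
    rewrite mulr_sumr; apply: eq_bigr => k _; rewrite RintZl// /L2_inner /lift_coord.
    by ring.
  congr (_ * _); apply: eq_Rintegral => u _; rewrite mulr_sumr.
  by apply: eq_bigr => k _; ring.
have [M SM] := partial_bound i.
apply: (@dominated_Rintegral _ _ _ _ _ _ (fun p => M * `|e p.1 * e p.2|)).
- by move=> n; exact: (L1_measurable (LK _ (Sb n))).
- by apply: L1Zl; exact: (integrable_norm ee1).
- by move=> n p; rewrite normrM mulrC ler_wpM2r// SM.
- by move=> p; apply: cvgMl_tmp; exact: partial_cvg.
Qed.

Lemma quad_ge_term (i : 'I_d) k e : L2 nu e ->
  lam i k * inner e (lift_coord i (phi i k)) ^+ 2 <= quad i e.
Proof.
move=> e2; have /cvgr_to_ge := @quad_cvg i _ e2; apply; exists k.+1 => // n /= kn.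
rewrite (bigD1 (Ordinal kn))//= lerDl sumr_ge0// => l _.
by rewrite mulr_ge0// sqr_ge0.
Qed.

Lemma quad_ge0 (i : 'I_d) e : L2 nu e -> 0 <= quad i e.
Proof.
by move=> e2; apply: le_trans (quad_ge_term i 0 e2); rewrite mulr_ge0// sqr_ge0.
Qed.

(** Orthogonality to the constant eigenfunction; it makes eigenfunctions in
    different coordinates orthogonal to each other. *)
Lemma phi_mean0 j k : k != k0 j -> \int[mu]_t phi j k t = 0.
Proof.
move=> kk; transitivity (\int[mu]_t (phi j (k0 j) t * phi j k t)).
  apply: ae_eq_Rintegral.
  - exact: (phib j k).1.
  - exact: (boundedM (phib j (k0 j)) (phib j k)).1.
  - by apply: leb01_aeS (phi_k0 j) => t ->; rewrite mul1r.
apply: (mulfI (lam_k0 j)); rewrite phi_orth eq_sym (negbTE kk).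
by rewrite !mulr0.
Qed.

Lemma phi_inner j k l : \int[mu]_t (phi j k t * phi j l t) =
  ((k == l) && (lam j k != 0))%:R.
Proof.
have [lk|lk] := eqVneq (lam j k) 0; last first.
  by rewrite andbT; apply: (mulfI lk); exact: phi_orth.
rewrite andbF -[RHS](Rint_cst mu); apply: eq_Rintegral => t _.
by rewrite phi_lam0// mul0r.
Qed.

Definition field_eigenfun (p : 'I_d * nat) : d.-tuple R -> R :=
  lift_coord p.1 (phi p.1 (bump (k0 p.1) p.2)).

Lemma bounded_field_eigenfun p : bounded_measurable (field_eigenfun p).
Proof. exact: bounded_lift. Qed.

Lemma field_eigenfun_mean0 p : \int[nu]_t field_eigenfun p t = 0.
Proof.
rewrite integral_cube_tnth//; apply: phi_mean0.
by rewrite eq_sym neq_bump.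
Qed.

Lemma field_eigenfun_orth p q : p != q -> inner (field_eigenfun p) (field_eigenfun q) = 0.
Proof.
case: p q => [i k] [j l] pq; rewrite /L2_inner /field_eigenfun /lift_coord /=.
set f := phi i _; set g := phi j _.
have fb : bounded_measurable f by exact: phib.
have gb : bounded_measurable g by exact: phib.
have [ij|ij] := eqVneq i j; last first.
  have fgb : bounded_kernel (fun x y => f x * g y).
    apply: boundedM; first exact: (bounded_comp fb measurable_fst).
    exact: (bounded_comp gb measurable_snd).
  rewrite (integral_cube_tnth2 ij fgb) -[RHS](Rint_cst mu); apply: eq_Rintegral => x _.
  by rewrite RintZl ?phi_mean0 ?mulr0 1?eq_sym ?neq_bump//; exact: bounded_L1.
rewrite -{j}ij in g gb pq *.
rewrite (@integral_cube_tnth _ _ i (fun x => f x * g x)); last exact: boundedM.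
rewrite phi_inner (_ : (_ == _) = false)//.
apply: contra_neqF pq => /eqP/(can_inj (bumpK _)) ->.
by [].
Qed.

Lemma field_eigenfun_norm p : inner (field_eigenfun p) (field_eigenfun p) = (lam p.1 (bump (k0 p.1) p.2) != 0)%:R.
Proof.
rewrite /L2_inner /field_eigenfun /lift_coord (@integral_cube_tnth _ _ p.1
  (fun x => phi p.1 (bump (k0 p.1) p.2) x * phi p.1 (bump (k0 p.1) p.2) x)).
  by rewrite phi_inner eqxx.
exact: boundedM.
Qed.

(** The constant function followed by the non-constant eigenfunctions of the
    additive kernel, which are functions of a single coordinate, indexed by a
    finite list and padded with zero. *)
Definition eigen_family (s : seq ('I_d * nat)) (m : nat) : d.-tuple R -> R :=
  if m is m'.+1 then
    (if ohead (drop m' s) is Some p then field_eigenfun p else fun=> 0)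
  else fun=> 1.

Lemma eigen_familyS p s m : (m < size s)%N ->
  eigen_family s m.+1 = field_eigenfun (nth p s m).
Proof. by move=> ms; rewrite /eigen_family (drop_nth p ms). Qed.

Lemma eigen_family_out s m : (size s <= m)%N -> eigen_family s m.+1 = fun=> 0.
Proof. by move=> sm; rewrite /eigen_family drop_oversize. Qed.

Lemma eigen_family_ortho s : uniq s -> orthonormal_or0 nu (eigen_family s).
Proof.
move=> us.
have zl (f : d.-tuple R -> R) : inner (fun=> 0) f = 0.
  by rewrite -[RHS](Rint_cst nu); apply: eq_Rintegral => t _; rewrite mul0r.
have bE m : bounded_measurable (eigen_family s m).
  case: m => [|m]; first exact: cst_bounded.
  rewrite /eigen_family; case: ohead => [p|]; last exact: cst_bounded.
  exact: bounded_field_eigenfun.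
have E0 m : inner (eigen_family s 0) (eigen_family s m.+1) = 0.
  have [sm|ms] := leqP (size s) m; first by rewrite innerC eigen_family_out.
  case: s us bE ms => // p s _ _ ms; rewrite (eigen_familyS p ms).
  rewrite -[RHS](field_eigenfun_mean0 (nth p (p :: s) m)); apply: eq_Rintegral => t _.
  by rewrite mul1r.
split=> [k|k l kl|k].
- exact: bounded_L2.
- case: k l kl => [|k] [|l]//; rewrite ?E0// => kl.
    by rewrite innerC E0.
  have [sk|ks] := leqP (size s) k; first by rewrite eigen_family_out.
  have [sl|ls] := leqP (size s) l; first by rewrite innerC eigen_family_out.
  case: s us {bE E0} ks ls => // p s us ks ls.
  by rewrite !(eigen_familyS p)// field_eigenfun_orth// nth_uniq.
- case: k => [|k].
    right; rewrite -[RHS](Rint_cst nu); apply: eq_Rintegral => t _; exact: mulr1.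
  have [sk|ks] := leqP (size s) k; first by left; rewrite eigen_family_out.
  case: s us {bE E0} ks => // p s us ks; rewrite (eigen_familyS p)// field_eigenfun_norm.
  by case: (_ != _); [right|left].
Qed.

Lemma sum_eigen_family (F : (d.-tuple R -> R) -> R) s :
  \sum_(m < (size s).+1) F (eigen_family s m) =
  F (fun=> 1) + \sum_(p <- s) F (field_eigenfun p).
Proof.
rewrite big_ord_recl; congr (_ + _); case: s => [|p s]; first by rewrite big_nil big_ord0.
rewrite (big_nth p) big_mkord; apply: eq_bigr => m _.
by rewrite lift0 (eigen_familyS p).
Qed.

Definition total_quad e := \sum_(i < d) quad i e.

(** The constant function collects the distinguished eigenvalue from every
    coordinate; another eigenfunction collects its own eigenvalue from one
    coordinate, and the remaining coordinates contribute nonnegative terms. *)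
Lemma total_quad_eigen_family (s : seq ('I_d * nat)) : uniq s ->
  \sum_(i < d) lam i (k0 i) + \sum_(p <- s) lam p.1 (bump (k0 p.1) p.2) <=
  \sum_(m < (size s).+1) total_quad (eigen_family s m).
Proof.
move=> us; rewrite sum_eigen_family; apply: lerD.
  apply: ler_sum => i _.
  have one2 : L2 nu (fun=> 1) by exact/bounded_L2/cst_bounded.
  apply: le_trans (quad_ge_term i (k0 i) one2).
  rewrite (_ : inner _ _ = 1) ?expr1n ?mulr1//.
  rewrite -[RHS](Rint_cst nu); apply: ae_eq_Rintegral => //.
    exact: (boundedM (cst_bounded 1) (bounded_lift i (phib i (k0 i)))).1.
  by apply: filterS (ae_cube i (phi_k0 i)) => t; rewrite mul1r /lift_coord.
apply: ler_sum => p _; rewrite /total_quad (bigD1 p.1)//=.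
have eta2 : L2 nu (field_eigenfun p) by exact/bounded_L2/bounded_field_eigenfun.
apply: (@le_trans _ _ (quad p.1 (field_eigenfun p))); last first.
  by rewrite lerDl sumr_ge0// => i _; exact: quad_ge0.
apply: le_trans (quad_ge_term p.1 (bump (k0 p.1) p.2) eta2).
rewrite -/(field_eigenfun p) field_eigenfun_norm; case: eqVneq => [->|_] /=; first by rewrite mul0r.
by rewrite expr1n mulr1.
Qed.

(** Ky Fan's inequality in dual form.  The weight [C f] of an eigenfunction [f] in
    the family [e] is at most 1, and all weights sum up to at most [n], by
    Bessel's inequality applied in both directions; an eigenvalue [l] with a
    weight in the unit interval contributes at most
    [max 0 (l - theta) + theta * weight]. *)
Lemma total_quad_upper e n (theta H : R) : orthonormal_or0 nu e -> 0 < theta ->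
  (forall N, \sum_(i < d) \sum_(k < N)
     Num.max 0 (lam i (bump (k0 i) k) - theta) <= H) ->
  \sum_(m < n) total_quad (e m) <= \sum_(i < d) lam i (k0 i) + H + theta * n%:R.
Proof.
move=> eo th0 excess; have [e2 _ en] := eo.
pose V N m := \sum_(i < d) \sum_(k < N.+1)
  lam i k * inner (e m) (lift_coord i (phi i k)) ^+ 2.
have Vlim : (fun N => \sum_(m < n) V N m) @ \oo --> \sum_(m < n) total_quad (e m).
  apply: (@cvg_finite_sum _ _ _ (fun (m : 'I_n) N => V N m)
    (fun m : 'I_n => total_quad (e m))) => m.
  apply: (@cvg_finite_sum _ _ _ (fun (i : 'I_d) N => \sum_(k < N.+1)
    lam i k * inner (e m) (lift_coord i (phi i k)) ^+ 2)
    (fun i => quad i (e m))) => i.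
  by have := @quad_cvg i _ (e2 m); rewrite -(cvg_shiftS (fun n => \sum_(k < n) _)).
(* beyond this index the truncation contains all constant eigenfunctions *)
apply: (cvgr_to_le Vlim); exists (\max_(i < d) k0 i)%N => // N /= kN.
have k0N (i : 'I_d) : (k0 i < N.+1)%N.
  by rewrite ltnS (leq_trans _ kN)// (leq_bigmax i).
pose one : d.-tuple R -> R := fun=> 1.
have one2 : L2 nu one by exact/bounded_L2/cst_bounded.
pose c m (f : d.-tuple R -> R) := inner (e m) f ^+ 2.
pose s := [seq (i, k) | i <- index_enum 'I_d, k <- index_iota 0 N].
have us : uniq s.
  apply: allpairs_uniq; [exact: index_enum_uniq|exact: iota_uniq|].
  by move=> [? ?] [? ?].
have sumE (F : 'I_d * nat -> R) :
    \sum_(p <- s) F p = \sum_(i < d) \sum_(k < N) F (i, val k).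
  by rewrite big_allpairs; apply: eq_bigr => i _; rewrite big_mkord.
have VE m : V N m = \sum_(i < d) lam i (k0 i) * c m one +
    \sum_(p <- s) lam p.1 (bump (k0 p.1) p.2) * c m (field_eigenfun p).
  rewrite sumE -big_split; apply: eq_bigr => i _ /=.
  rewrite (bigD1_ord (Ordinal (k0N i)))//=; congr (_ * _ ^+ 2 + _).
  apply: ae_eq_Rintegral.
  - apply: (L1_measurable (L2_mul_L1 (e2 m) _)).
    exact/bounded_L2/bounded_lift.
  - exact: (L1_measurable (L2_mul_L1 (e2 m) one2)).
  - by apply: filterS (ae_cube i (phi_k0 i)) => t; rewrite /lift_coord => ->.
under eq_bigr do rewrite VE.
rewrite big_split /= exchange_big /= [X in _ + X]exchange_big /=.
under eq_bigr do rewrite -mulr_sumr.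
under [X in _ + X]eq_bigr do rewrite -mulr_sumr.
pose C f := \sum_(m < n) c m f.
have C_le f : L2 nu f -> C f <= inner f f.
  move=> f2; apply: le_trans (bessel n eo f2).
  by rewrite /C /c; apply: ler_sum => m _; rewrite innerC.
have C_ge0 f : 0 <= C f by apply: sumr_ge0 => m _; exact: sqr_ge0.
have inner11 : inner one one = 1.
  by rewrite -[RHS](Rint_cst nu); apply: eq_Rintegral => t _; exact: mulr1.
have C1 : C one <= 1 by rewrite -inner11 C_le.
have Ceta p : C (field_eigenfun p) <= 1.
  apply: le_trans (C_le _ (bounded_L2 nu (bounded_field_eigenfun p))) _.
  by rewrite field_eigenfun_norm; case: (_ != _).
have Csum : C one + \sum_(p <- s) C (field_eigenfun p) <= n%:R.
  rewrite /C exchange_big -big_split /=.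
  apply: (@le_trans _ _ (\sum_(m < n) 1)); last by rewrite sumr_const card_ord.
  apply: ler_sum => m _; rewrite -(sum_eigen_family (c m)).
  apply: le_trans (bessel _ (eigen_family_ortho us) (e2 m)) _.
  by case: (en m) => ->.
rewrite -addrA; apply: lerD.
  by apply: ler_sum => i _; rewrite -[leRHS]mulr1 ler_wpM2l.
apply: (@le_trans _ _ (\sum_(p <- s)
    (Num.max 0 (lam p.1 (bump (k0 p.1) p.2) - theta) + theta * C (field_eigenfun p)))).
  apply: ler_sum => p _; set l := lam _ _; set Cp := C (field_eigenfun p).
  have Cp0 : 0 <= Cp by exact: C_ge0.
  have Cp1 : Cp <= 1 by exact: Ceta.
  have : l - theta <= Num.max 0 (l - theta) by rewrite le_max lexx orbT.
  have : 0 <= Num.max 0 (l - theta) by rewrite le_max lexx.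
  set x := Num.max _ _ => x0 lx.
  by rewrite -/(C _) -/Cp; nra.
rewrite big_split /=; apply: lerD; first by rewrite sumE.
rewrite -mulr_sumr; apply: ler_wpM2l; first exact: ltW.
by apply: le_trans Csum; rewrite lerDr.
Qed.

End additive_kernel.

(** * Approximation of an additive random field *)

Section field_complexity.
Context {R : realType}.
Unset Implicit Arguments.
Variables (dX : nat -> measure_display) (OX : forall j, measurableType (dX j)).
Variables (PX : forall j, probability (OX j) R) (X : forall j, R -> OX j -> R).
Variables (lam : nat -> nat -> R) (psi : nat -> nat -> R -> R) (k0 : nat -> nat).
Hypothesis X0 : forall j, zero_mean_on (PX j) `[0, 1] (X j).
Hypothesis Xc : forall j, {within `[0, 1] `*` `[0, 1],
    continuous (fun p : R * R => covfun (PX j) (X j) p.1 p.2)}.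
Hypothesis eig : forall j, is_eigensystem leb01 (covfun (PX j) (X j)) (lam j) (psi j).
Hypothesis basic : forall j, {ae leb01, forall t, psi j (k0 j) t = 1}.
Set Implicit Arguments.

Local Notation K := (fun j => cov01 (PX j) (X j)).
Local Notation phi := (fun j => eigenfun (cov01 (PX j) (X j)) (lam j) (psi j)).
Local Notation G := (fun j => mercer_sum (cov01 (PX j) (X j)) (lam j) (psi j)).

Lemma eigenvalue_ge0 j k : 0 <= lam j k.
Proof. by have [[_ h] _ _ _ _] := eig j. Qed.

Lemma eigenvalue_k0_neq0 j : lam j (k0 j) != 0.
Proof.
have [_ _ _ [_ h] _] := eig j; apply/eqP => /h psi0.
have : {ae leb01, forall t : R, (1 : R) = 0}.
  by apply: leb01_aeS2 psi0 (basic j) => t -> .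
move=> H; have : \int[leb01]_t (1 : R) = \int[leb01]_(t in [set: R]) (0 : R).
  by apply: (@ae_eq_Rintegral _ _ (measurableTypeR R) leb01).
by rewrite !Rint_cst => /eqP; rewrite oner_eq0.
Qed.

Lemma cov01_bounded j : bounded_kernel (K j).
Proof. exact: bounded_cov01. Qed.

Lemma eigenvalue_orth j k l : lam j k != 0 -> lam j l != 0 ->
  \int[leb01]_t (psi j k t * psi j l t) = (k == l)%:R.
Proof. by have [_ _ _ [h _] _] := eig j; exact: h. Qed.

Lemma bounded_phi j k : bounded_measurable (phi j k).
Proof.
apply: bounded_eigenfun; first exact: cov01_bounded.
by move=> i; exact: (psi_L2 (eig j) i).
Qed.

Lemma phi_orthE j k l :
  lam j k * \int[leb01]_t (phi j k t * phi j l t) = lam j k * (k == l)%:R.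
Proof.
apply: eigenfun_orth.
- exact: cov01_bounded.
- by move=> i; exact: (psi_L2 (eig j) i).
- by move=> i; exact: (cov01_eig (X0 j)).
- exact: eigenvalue_orth.
Qed.

Lemma phi_k0E j : {ae leb01, forall t, phi j (k0 j) t = 1}.
Proof.
have := eigenfun_ae (cov01_eig (X0 j) (eig j)) (eigenvalue_k0_neq0 j).
by move=> h; apply: leb01_aeS2 h (basic j) => t ->.
Qed.

Lemma cov01_mercer_hypotheses j : [/\ bounded_kernel (K j),
   (forall t s, K j t s = K j s t), psd_kernel (K j),
   (forall t, seq_continuous01 (K j t)) &
   (forall t s, s \notin `[0, 1] -> K j t s = 0)].
Proof.
split.
- exact: cov01_bounded.
- exact: cov01_sym.
- exact: cov01_psd.
- exact: cov01_seq_continuous.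
- exact: cov01_out.
Qed.

Lemma partial_sum_bound j : exists M : R, forall n t s,
  `|\sum_(k < n) lam j k * phi j k t * phi j k s| <= M.
Proof.
have [Kb Ks Kp Kc Ko] := cov01_mercer_hypotheses j; have [M KM] := Kb.2.
exists (2 * M) => n t s; rewrite -(big_mkord xpredT
  (fun k => lam j k * phi j k t * phi j k s)).
apply: (mercer_sum_bounded Kb Ks Kp (eigenvalue_ge0 j)) => //.
- by move=> i; exact: (psi_L2 (eig j) i).
- by move=> i; exact: (cov01_eig (X0 j)).
- exact: eigenvalue_orth.
- by move=> x y; exact: (KM (x, y)).
Qed.

Lemma partial_sum_cvg j t s :
  (fun n => \sum_(k < n) lam j k * phi j k t * phi j k s) @ \oo --> G j t s.
Proof.
have [Kb Ks Kp Kc Ko] := cov01_mercer_hypotheses j.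
under eq_fun => n do rewrite -(big_mkord xpredT
  (fun k => lam j k * phi j k t * phi j k s)).
apply: (mercer_cvg Kb Ks Kp (eigenvalue_ge0 j)).
- by move=> i; exact: (psi_L2 (eig j) i).
- by move=> i; exact: (cov01_eig (X0 j)).
- exact: eigenvalue_orth.
Qed.

Lemma bounded_process_mercer_sum j : bounded_kernel (G j).
Proof.
have [Kb Ks Kp Kc Ko] := cov01_mercer_hypotheses j.
apply: (bounded_mercer_sum Kb Ks Kp (eigenvalue_ge0 j)).
- by move=> i; exact: (psi_L2 (eig j) i).
- by move=> i; exact: (cov01_eig (X0 j)).
- exact: eigenvalue_orth.
Qed.

Lemma mercer_process j : {ae leb01, forall s, forall u, K j s u = G j s u}.
Proof.
have [Kb Ks Kp Kc Ko] := cov01_mercer_hypotheses j.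
apply: (mercer Kb Ks Kp Kc Ko (eigenvalue_ge0 j)).
- by move=> i; exact: (psi_L2 (eig j) i).
- by move=> i; exact: (cov01_eig (X0 j)).
- exact: eigenvalue_orth.
- by move=> m f; exact: (cov01_complete (X0 j)).
Qed.

Lemma trace_cvg j : series (lam j) @ \oo --> \int[leb01]_s K j s s.
Proof.
have [Kb Ks Kp Kc Ko] := cov01_mercer_hypotheses j.
apply: (eigenvalue_sum_cvg Kb Ks Kp Kc Ko (eigenvalue_ge0 j)).
- by move=> i; exact: (psi_L2 (eig j) i).
- by move=> i; exact: (cov01_eig (X0 j)).
- exact: eigenvalue_orth.
- by move=> m f; exact: (cov01_complete (X0 j)).
Qed.

Lemma traceE j : trace lam j = \int[leb01]_s K j s s.
Proof. by apply: cvg_lim => //; exact: trace_cvg. Qed.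

Lemma trace_ge0 j : 0 <= trace lam j.
Proof.
rewrite traceE; apply: Rintegral_ge0 => s _.
by apply: Rintegral_ge0 => w _; rewrite -expr2 sqr_ge0.
Qed.

Section field.
Context {dO : measure_display} {Om : measurableType dO}.
Variables (P : probability Om R) (d : nat) (Y : d.-tuple R -> Om -> R).
Hypothesis mY : measurable_fun (@cube R d `*` [set: Om]) (fun p => Y p.1 p.2).
Hypothesis Y0 : zero_mean_on P (@cube R d) Y.
Hypothesis Ycov : forall t u, cube t -> cube u ->
  covfun P Y t u = \sum_(i < d) covfun (PX i) (X i) (tnth t i) (tnth u i).

Local Notation nu := (@leb_cube R d).
Local Notation inner := (L2_inner nu).

Lemma ae_in_cube : {ae nu, forall t, @cube R d t}.
Proof.
have : {ae nu, forall t, forall i : 'I_d, [set: 'I_d] i -> tnth t i \in `[0, 1]}.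
  apply: filter_forall => i.
  by apply: filterS (ae_cube i (@ae_leb01_in R)) => t ti _.
by apply: filterS => t h i; exact: h.
Qed.

Lemma measurable_cube : measurable (@cube R d).
Proof.
rewrite (_ : @cube R d = \bigcap_(i in [set: 'I_d])
    ((fun t : d.-tuple R => tnth t i) @^-1` `[0, 1]%classic)); last first.
  by apply/seteqP; split=> t h i; [move=> _|]; exact: h.
apply: fin_bigcap_measurable; first exact: finite_finset.
move=> i _; rewrite -[_ @^-1` _]setTI; exact: measurable_tnth.
Qed.

Lemma cubeC_null : nu (~` @cube R d) = 0%E.
Proof.
apply: measure_negligible; last exact: ae_in_cube.
by apply: measurableC; exact: measurable_cube.
Qed.

Let YE t u : cube t -> cube u ->
  \int[P]_w (Y t w * Y u w) = \sum_(i < d) K i (tnth t i) (tnth u i).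
Proof.
move=> tc uc; rewrite -(covfun_second_moment Y0)// Ycov//.
by apply: eq_bigr => i _; rewrite cov01E.
Qed.

Let Y2 t : cube t -> L2 P (Y t).
Proof. by move=> tc; apply/L2_Lfun; have [] := Y0 tc. Qed.

Let YM : exists M : R, forall t, cube t -> \int[P]_w (Y t w ^+ 2) <= M.
Proof.
have bK (i : 'I_d) : exists M : R, forall p : R * R, `|K i p.1 p.2| <= M.
  by have [_ []] := cov01_bounded i => M h; exists M.
have [M KM] := choice bK; exists (\sum_(i < d) M i) => t tc.
rewrite (_ : \int[P]_w _ = \sum_(i < d) K i (tnth t i) (tnth t i)).
  by apply: ler_sum => i _; exact: le_trans (ler_norm _) (KM i (_, _)).
by rewrite -YE//; apply: eq_Rintegral => w _; rewrite expr2.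
Qed.

Local Notation Z := (modification nu (@cube R d) Y).

Let mZ := modification_measurable nu measurable_cube mY.
Let Z_paths := modification_paths nu measurable_cube mY.
Let Z_moments M (h : forall t, cube t -> \int[P]_w (Y t w ^+ 2) <= M) :=
  modification_moments nu measurable_cube mY Y2 h.

Lemma field_second_moment t u : cube t -> cube u ->
  second_moment P Z t u = \sum_(i < d) K i (tnth t i) (tnth u i).
Proof.
have [M YM'] := YM; move=> tc uc; rewrite -YE//.
exact: (modification_second_moment nu measurable_cube mY Y2 YM').
Qed.

Lemma bounded_diag j : bounded_measurable (fun s => K j s s).
Proof.
apply: (bounded_comp (g := fun s : R => (s, s)) (cov01_bounded j)).
exact: measurable_fun_pair.
Qed.

Lemma field_trace :
  \int[nu]_t second_moment P Z t t = \sum_(i < d) trace lam i.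
Proof.
transitivity (\int[nu]_t \sum_(i < d) K i (tnth t i) (tnth t i)).
  apply: (eq_Rintegral_null_compl measurable_cube cubeC_null) => t tc.
  exact: field_second_moment.
rewrite Rint_sum => [|i]; last first.
  by apply: bounded_L1; exact: (bounded_tnth i (bounded_diag i)).
apply: eq_bigr => i _; rewrite traceE.
exact: (integral_cube_tnth i (bounded_diag i)).
Qed.

Lemma field_coordinate_variance e : L2 nu e ->
  \int[P]_w (inner (Z^~ w) e ^+ 2) = total_quad K e.
Proof.
have [M YM'] := YM; move=> e2; have e1 := L2_L1 e2.
have ZM t := (Z_moments YM' t).2; have Z2 t := (Z_moments YM' t).1.
rewrite (coordinate_variance mZ Z_paths Z2 ZM e2).
have eK (i : 'I_d) u : L1 nu (fun t => e t * K i (tnth t i) (tnth u i)).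
  have Kub := bounded_kernelEr u (bounded_coord2 i (cov01_bounded i)).
  by apply: eq_integrable (bounded_mul_L1 Kub e1) => // t _ /=; rewrite mulrC.
transitivity (\int[nu]_u \sum_(i < d)
    (e u * \int[nu]_t (e t * K i (tnth t i) (tnth u i)))).
  apply: (eq_Rintegral_null_compl measurable_cube cubeC_null) => u uc.
  rewrite -mulr_sumr -Rint_sum//; congr (_ * _).
  apply: (eq_Rintegral_null_compl measurable_cube cubeC_null) => t tc.
  by rewrite field_second_moment// mulr_sumr.
rewrite Rint_sum// => i.
have eeK : L1 (nu \x nu)%E (fun p => e p.2 * (e p.1 * K i (tnth p.1 i) (tnth p.2 i))).
  have := bounded_mul_L1 (bounded_coord2 i (cov01_bounded i)) (L1_mul_prod e1 e1).
  by apply: eq_integrable => // p _ /=; rewrite mulrC; congr EFin; ring.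
have := L1_Rintegral2 eeK.
by apply: eq_integrable => // u _ /=; rewrite RintZl.
Qed.

Local Notation error n := (approx_error P nu Y n).
Local Notation T := (\sum_(i < d) trace lam i).
Local Notation B := (\sum_(i < d) lam i (k0 i)).

Let T_ge0 : 0 <= T. Proof. by apply: sumr_ge0 => i _; exact: trace_ge0. Qed.

Lemma field_error_proj n e : orthonormal_or0 nu e ->
  mean_square_error P nu Y (fun m : 'I_n => e m) =
  (T - \sum_(m < n) total_quad K (e m))%:E.
Proof.
have [M YM'] := YM; move=> eo; have [e2 _ _] := eo.
have ZM t := (Z_moments YM' t).2; have Z2 t := (Z_moments YM' t).1.
rewrite (mean_square_error_modification measurable_cube cubeC_null mY Y2 YM').
rewrite (mean_square_error_proj mZ Z_paths Z2 ZM n eo) field_trace.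
congr (_ - _)%:E; apply: eq_bigr => m _.
exact: field_coordinate_variance.
Qed.

(** Replacing the field by its modification makes all paths square integrable, so
    that projections of paths are defined surely. *)
Lemma field_error_ge n (f : 'I_n -> d.-tuple R -> R) :
  (forall m, f m \in Lfun nu 2%:E) ->
  exists2 e, orthonormal_or0 nu e &
    ((T - \sum_(m < n) total_quad K (e m))%R%:E <= mean_square_error P nu Y f)%E.
Proof.
have [M YM'] := YM; move=> f2.
have ZM t := (Z_moments YM' t).2; have Z2 t := (Z_moments YM' t).1.
pose g k := if insub k is Some m then f m else fun=> 0.
have g2 k : L2 nu (g k).
  rewrite /g; case: insubP => [m _ _|_]; first exact/L2_Lfun/f2.
  exact/bounded_L2/cst_bounded.
have -> : f = (fun m : 'I_n => g m).
  by apply/funext => m; rewrite /g valK.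
rewrite (mean_square_error_modification measurable_cube cubeC_null mY Y2 YM').
have [e eo ge] := mean_square_error_ge mZ Z_paths Z2 ZM n g2.
exists e => //; apply: le_trans ge; rewrite lee_fin field_trace.
rewrite le_eqVlt; apply/orP; left; apply/eqP; congr (_ - _).
apply: eq_bigr => m _; apply/esym/field_coordinate_variance.
by have [] := eo.
Qed.

Lemma field_error0 : error 0 = (Num.sqrt T)%:E.
Proof.
have mse0 (f : 'I_0 -> d.-tuple R -> R) : mean_square_error P nu Y f = T%:E.
  have -> : f = (fun m : 'I_0 => eigen_family (fun j k => phi j k) k0 [::] m).
    by apply/funext => -[].
  rewrite field_error_proj ?big_ord0 ?subr0//.
  apply: (@eigen_family_ortho R d lam (fun j k => phi j k) k0) => //.
  - exact: bounded_phi.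
  - by move=> j k t; exact: eigenfun_lam0.
  - exact: phi_orthE.
  - exact: phi_k0E.
  - exact: eigenvalue_k0_neq0.
have sq : (T%:E `^ 2^-1 = (Num.sqrt T)%:E)%E by rewrite poweR_EFin powR12_sqrt.
apply/eqP; rewrite eq_le; apply/andP; split.
- apply: ge_ereal_inf; exists (T%:E `^ 2^-1)%E; last by rewrite sq.
  by exists (fun=> fun=> 0); [case|rewrite mse0].
- by apply: le_ereal_inf_tmp => _ [f _ <-]; rewrite mse0 sq.
Qed.

(** Project onto the constant function and the eigenfunctions listed in [s]. *)
Lemma field_admissible_upper (eps : R) (s : seq ('I_d * nat)) : 0 <= eps ->
  uniq s ->
  (1 - eps ^+ 2) * T - B <= \sum_(p <- s) lam p.1 (bump (k0 p.1) p.2) ->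
  (error (size s).+1 <= eps%:E * error 0)%E.
Proof.
move=> eps0 us Ts.
pose e := eigen_family (fun j k => phi j k) k0 s.
have eo : orthonormal_or0 nu e.
  apply: (@eigen_family_ortho R d lam (fun j k => phi j k) k0) => //.
  - exact: bounded_phi.
  - by move=> j k t; exact: eigenfun_lam0.
  - exact: phi_orthE.
  - exact: phi_k0E.
  - exact: eigenvalue_k0_neq0.
have [e2 _ _] := eo.
rewrite field_error0 -EFinM; apply: ge_ereal_inf.
exists (mean_square_error P nu Y (fun m : 'I_(size s).+1 => e m) `^ 2^-1)%E.
  by exists (fun m : 'I_(size s).+1 => e m) => // m; exact/L2_Lfun.
have V : B + \sum_(p <- s) lam p.1 (bump (k0 p.1) p.2) <=
    \sum_(m < (size s).+1) total_quad K (e m).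
  apply: (total_quad_eigen_family (G := G)) => //.
  - exact: cov01_bounded.
  - exact: bounded_process_mercer_sum.
  - exact: eigenvalue_ge0.
  - exact: bounded_phi.
  - by move=> j k t; exact: eigenfun_lam0.
  - exact: phi_orthE.
  - exact: phi_k0E.
  - exact: partial_sum_bound.
  - exact: partial_sum_cvg.
  - exact: mercer_process.
have mse_ge0 : 0 <= T - \sum_(m < (size s).+1) total_quad K (e m).
  rewrite -lee_fin -field_error_proj//; apply: integral_ge0 => w _.
  by apply: integral_ge0 => t _; rewrite lee_fin sqr_ge0.
rewrite field_error_proj// poweR_EFin powR12_sqrt// lee_fin.
rewrite -[eps in leRHS]ger0_norm// -sqrtr_sqr -sqrtrM ?sqr_ge0//.
rewrite ler_wsqrtr//; move: Ts V; rewrite mulrBl mul1r.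
set a := \sum_(p <- s) _; set b := \sum_(m < _) _; lra.
Qed.

(** An admissible rank captures at least [(1 - eps ^+ 2) * T] of the trace, and
    [total_quad_upper] limits what a rank can capture. *)
Lemma field_admissible_lower (eps theta H : R) (n : nat) : 0 <= eps -> 0 < theta ->
  (forall N, \sum_(i < d) \sum_(k < N)
     Num.max 0 (lam i (bump (k0 i) k) - theta) <= H) ->
  (error n <= eps%:E * error 0)%E ->
  (1 - eps ^+ 2) * T <= B + H + theta * n%:R.
Proof.
move=> eps0 th0 excess; rewrite field_error0 -EFinM => err.
rewrite leNgt; apply/negP => lt.
pose m0 := T - (B + H + theta * n%:R).
have m0_gt : eps ^+ 2 * T < m0 by rewrite /m0; move: lt; rewrite mulrBl mul1r; lra.
have e2T : 0 <= eps ^+ 2 * T by rewrite mulr_ge0// sqr_ge0.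
have : (eps * Num.sqrt T < Num.sqrt m0).
  rewrite -[eps in ltLHS]ger0_norm// -sqrtr_sqr -sqrtrM ?sqr_ge0//.
  by rewrite ltr_sqrt// (le_lt_trans e2T).
apply/negP; rewrite -leNgt -lee_fin; apply: le_trans err.
apply: le_ereal_inf_tmp => _ [f f2 <-].
have [e eo mse] := field_error_ge f2.
have V : \sum_(m < n) total_quad K (e m) <= B + H + theta * n%:R.
  apply: (@total_quad_upper R d K G lam (fun j k => phi j k) k0) => //.
  - exact: cov01_bounded.
  - exact: bounded_process_mercer_sum.
  - exact: eigenvalue_ge0.
  - exact: bounded_phi.
  - by move=> j k t; exact: eigenfun_lam0.
  - exact: phi_orthE.
  - exact: phi_k0E.
  - exact: eigenvalue_k0_neq0.
  - exact: partial_sum_bound.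
  - exact: partial_sum_cvg.
  - exact: mercer_process.
have m0ge0 : 0 <= m0 by rewrite ltW// (le_lt_trans e2T).
rewrite -powR12_sqrt// -poweR_EFin.
apply: gt0_ler_poweR => //.
- by rewrite in_itv/= lee_fin m0ge0 leey.
- rewrite in_itv/= leey andbT; apply: integral_ge0 => w _.
  by apply: integral_ge0 => t _; rewrite lee_fin sqr_ge0.
- by apply: le_trans mse; rewrite lee_fin /m0 lerD2l lerN2.
Qed.

Local Notation N := (complexity P nu Y).

(** Once some rank is admissible, the default value of the definition of the
    complexity is not reached. *)
Lemma complexityP (eps : R) m : (0 < m)%N ->
  (error m <= eps%:E * error 0)%E ->
  [/\ (0 < N eps)%N, (error (N eps) <= eps%:E * error 0)%E & (N eps <= m)%N].
Proof.
move=> m0 em; rewrite /complexity.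
pose adm n := (0 < n)%N /\ (error n <= eps%:E * error 0)%E.
have [n [an nmin]] : exists n, adm n /\ forall k, adm k -> (n <= k)%N.
  have : exists n, `[< adm n >] by exists m; apply/asboolP; split.
  move=> ex; exists (ex_minn ex); case: ex_minnP => n /asboolP an nmin.
  by split=> // k /asboolP; exact: nmin.
case: xgetP => [k -> [[k0' ek] kmin]|/(_ n)]; last by case; split.
by split=> //; apply: kmin; split.
Qed.

End field.

End field_complexity.

(** * Levy closeness of distribution functions *)

Section levy.
Context {R : realType}.

(** A monotone function has countably many discontinuities, and an interval is
    not countable. *)
Lemma cumulative_continuity_point (G : cumulativeBounded (0 : R) (1 : R)) (a b : R) : a < b ->
  exists2 x, a < x < b & {for x, continuous G}.
Proof.
move=> ab; apply: contrapT => /forall2NP H.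
have Gnd : {in `[a, b] &, nondecreasing_fun G}.
  by move=> x y _ _; exact: cumulative_is_nondecreasing.
have := discontinuity_countable Gnd.
have -> : [set x | x \in (`]a, b[) /\ discontinuity G x] = `]a, b[%classic.
  apply/seteqP; split=> [x []//|x /= xab]; split=> //.
  have [Gx|Gx] := H x; first by case: Gx; move: xab; rewrite in_itv.
  have rc : G @ x^'+ --> G x by exact: cumulative_is_right_continuous.
  have lc : cvg (G x @[x --> x^'-]).
    apply: nondecreasing_at_left_is_cvgr.
      by near=> y => u v _ _; exact: cumulative_is_nondecreasing.
    near=> y; exists (G x) => _ [z /= zx <-].
    apply: cumulative_is_nondecreasing; apply: ltW.
    by move: zx; rewrite in_itv/= => /andP[].
  split; [by []|by apply: cvgP rc|].
  apply/eqP => GG; apply: Gx; apply/left_right_continuousP; split=> //.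
  by move: rc => /(cvg_lim (@Rhausdorff R)) <-; rewrite -GG.
move=> /(@countable_lebesgue_measure0 R).
by rewrite lebesgue_measure_itv/= lte_fin ab => -[] /eqP; rewrite subr_eq0 gt_eqF.
Unshelve. all: by end_near. Qed.

Lemma cumulative_le (G : cumulativeBounded (0 : R) (1 : R)) x y : x <= y -> G x <= G y.
Proof. exact: cumulative_is_nondecreasing. Qed.

Lemma cumulative_lo (G : cumulativeBounded (0 : R) (1 : R)) (e : R) : 0 < e ->
  exists A, forall x, x <= A -> G x <= e.
Proof.
move=> e0; have := cumulativeNy G => /cvgrPdist_le /(_ e e0) [A [_ HA]].
exists (A - 1) => x xA; have /= := HA x; rewrite sub0r normrN => h.
by apply: (le_trans (ler_norm _)); apply: h; lra.
Qed.

Lemma cumulative_hi (G : cumulativeBounded (0 : R) (1 : R)) (e : R) : 0 < e ->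
  exists A, forall x, A <= x -> 1 - e <= G x.
Proof.
move=> e0; have := cumulativey G => /cvgrPdist_le /(_ e e0) [A [_ HA]].
exists (A + 1) => x xA; have /= h := HA x.
have : `|1 - G x| <= e by apply: h; lra.
by move/(le_trans (ler_norm _)); lra.
Qed.

Lemma cumulative01 (G : cumulativeBounded (0 : R) (1 : R)) x : 0 <= G x <= 1.
Proof.
have nd := @cumulative_le G; apply/andP; split.
  have h : G @ -oo --> (0 : R) := cumulativeNy G.
  apply: (cvgr_to_le h); exists x; split; first exact: num_real.
  by move=> y /= /ltW; exact: nd.
have h : G @ +oo --> (1 : R) := cumulativey G.
apply: (cvgr_to_ge h); exists x; split; first exact: num_real.
by move=> y /= /ltW; exact: nd.
Qed.

Lemma near_forall_ord (m : nat) (Q : nat -> nat -> Prop) :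
  (forall i, \forall n \near \oo, Q i n) ->
  \forall n \near \oo, forall i, (i <= m)%N -> Q i n.
Proof.
move=> H; elim: m => [|m IH].
  by apply: filterS (H 0%N) => n Qn i; rewrite leqn0 => /eqP ->.
apply: filterS2 IH (H m.+1) => n IHn Qn i.
by rewrite leq_eqVlt ltnS => /orP[/eqP ->//|]; exact: IHn.
Qed.

(** Convergence at the continuity points implies convergence in the Levy metric:
    compare on a finite grid of continuity points of mesh at most [del], outside
    of which [G] is within [del / 2] of its limits. *)
Lemma levy_sandwich (G : cumulativeBounded (0 : R) (1 : R)) (Gn : nat -> R -> R) :
  (\forall n \near \oo, forall x y, x <= y -> Gn n x <= Gn n y) ->
  (\forall n \near \oo, forall x, 0 <= Gn n x <= 1) ->
  (forall x, {for x, continuous G} -> (fun n => Gn n x) @ \oo --> G x) ->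
  forall del, 0 < del -> \forall n \near \oo, forall x,
    G (x - del) - del <= Gn n x <= G (x + del) + del.
Proof.
move=> nd b01 GnG del del0.
have Gle := @cumulative_le G.
have h0 : 0 < del / 2 by rewrite divr_gt0.
have [A HA] := cumulative_lo G h0; have [B HB] := cumulative_hi G h0.
pose h := del / 2; pose A' := A - 2 * h.
have cpt i : exists x, A' + i%:R * h < x < A' + i.+1%:R * h /\ {for x, continuous G}.
  have [|x x1 x2] := @cumulative_continuity_point G (A' + i%:R * h) (A' + i.+1%:R * h).
    by rewrite ltrD2l ltr_pM2r// ltr_nat.
  by exists x.
have [y yP] := choice cpt.
pose N := (Num.truncn ((B - A') / h)).+1.
have NB : B <= y N.
  have [/andP[/ltW h1 _] _] := yP N; apply: le_trans h1.
  have := truncnS_gt ((B - A') / h); rewrite -/N ltr_pdivrMr//; lra.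
have y0A : y 0%N <= A by have [/andP[_ /ltW h1] _] := yP 0%N; apply: (le_trans h1); rewrite /A'/h; lra.
have ystep i : y i.+1 <= y i + del.
  have [/andP[_ h1] _] := yP i.+1; have [/andP[h2 _] _] := yP i.
  by move: h1 h2; rewrite -![i.+2%:R]natr1 -![i.+1%:R]natr1 /h; lra.
have yG : \forall n \near \oo, forall i, (i <= N)%N -> `|Gn n (y i) - G (y i)| <= h.
  apply: near_forall_ord => i; have [_ /GnG] := yP i.
  by move=> /cvgrPdist_le /(_ h h0); apply: filterS => n; rewrite distrC.
near=> n => x.
have ndn : forall x y, x <= y -> Gn n x <= Gn n y by near: n.
have n01 : forall x, 0 <= Gn n x <= 1 by near: n.
have nG : forall i, (i <= N)%N -> `|Gn n (y i) - G (y i)| <= h by near: n.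
have /andP[a0 a1] := n01 x.
have /andP[b0 b1] := cumulative01 G (x - del).
have /andP[c0 c1] := cumulative01 G (x + del).
have [xN|xN] := leP (y N) x.
  have := nG N (leqnn _); rewrite ler_distl => /andP[/= h1 _].
  have := HB (y N) NB; have := ndn _ _ xN.
  have : y N <= x + del by lra.
  move=> /Gle; rewrite /h in h1 *; lra.
have ex : exists i, x < y i by exists N.
case: (ex_minnP ex) => i xi imin.
have iN : (i <= N)%N by exact: imin.
case: i => [|i] in xi imin iN *.
  have := nG 0%N (leq0n _); rewrite ler_distl => /andP[/= _ h1].
  have := HA _ y0A; have := ndn _ _ (ltW xi).
  have : x - del <= y 0%N by lra.
  move=> /Gle; rewrite /h in h1 *; lra.
have yix : y i <= x by rewrite leNgt; apply/negP => /imin; rewrite ltnn.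
have := nG i (ltnW iN); rewrite ler_distl => /andP[/= h1 _].
have := nG _ iN; rewrite ler_distl => /andP[/= _ h2].
have := ndn _ _ (ltW xi); have := ndn _ _ yix.
have := ystep i => ys.
have : y i.+1 <= x + del by lra.
have : x - del <= y i by lra.
move=> /Gle + /Gle; rewrite /h in h1 h2 *; lra.
Unshelve. all: by end_near. Qed.

End levy.

(** * Mixtures of shifted distribution functions *)

Section mixture.
Context {R : realType}.

Lemma bounded_le_indicator (z : R) :
  @bounded_measurable R _ (measurableTypeR R) (fun u : R => (u <= z)%R%:R).
Proof.
split; last by exists 1 => u; case: (u <= z); rewrite ?normr1 ?normr0.
have -> : (fun u : R => (u <= z)%R%:R) = \1_(`]-oo, z]%classic) :> (R -> R).
  by apply/funext => u; rewrite indicE; congr (nat_of_bool _)%:R; rewrite mem_setE/= in_itv.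
by apply: measurable_indic; exact: measurable_itv.
Qed.

Lemma stieltjes_le_indicator (U : cumulativeBounded (0 : R) (1 : R)) c :
  \int[lebesgue_stieltjes_measure U]_u ((u <= c)%R%:R : R) = U c.
Proof.
have := cdf_lebesgue_stieltjes_id U c.
rewrite /cdf /= /distribution /= preimage_id => h.
have -> : (fun u : R => (u <= c)%R%:R) = \1_(`]-oo, c]%classic) :> (R -> R).
  by apply/funext => u; rewrite indicE; congr (nat_of_bool _)%:R; rewrite mem_setE/= in_itv.
rewrite /Rintegral integral_indic ?setIT//.
by rewrite [X in fine X]h.
Qed.

Section weighted_average.
Variable w : nat -> R.
Hypothesis w0 : forall j, 0 <= w j.

Definition average d (f : nat -> R) : R := (\sum_(j < d) w j * f j) / \sum_(j < d) w j.

Lemma average_le d f g : (forall j, f j <= g j) -> average d f <= average d g.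
Proof.
move=> fg; rewrite ler_wpM2r ?invr_ge0 ?sumr_ge0//.
by apply: ler_sum => j _; rewrite ler_wpM2l.
Qed.

Lemma averageD d f g : average d (fun j => f j + g j) = average d f + average d g.
Proof.
rewrite -mulrDl -big_split/=; congr (_ / _).
by apply: eq_bigr => j _; rewrite mulrDr.
Qed.

Lemma averageB d f g : average d (fun j => f j - g j) = average d f - average d g.
Proof.
rewrite -mulrBl -sumrB/=; congr (_ / _).
by apply: eq_bigr => j _; rewrite mulrBr.
Qed.

Lemma average_cst d c : 0 < \sum_(j < d) w j -> average d (fun=> c) = c.
Proof. by move=> S0; rewrite /average -mulr_suml mulrAC divff ?mul1r// gt_eqF. Qed.

Lemma average01 d f : (forall j, 0 <= f j <= 1) -> 0 <= average d f <= 1.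
Proof.
move=> f01; apply/andP; split.
  rewrite mulr_ge0 ?invr_ge0 ?sumr_ge0// => j _.
  by rewrite mulr_ge0//; have /andP[] := f01 j.
have [S0|] := ltP 0 (\sum_(j < d) w j).
  rewrite -(average_cst 1 S0); apply: average_le => j.
  by have /andP[] := f01 j.
move=> S0; have /eqP : \sum_(j < d) w j = 0 by apply/eqP; rewrite eq_le S0 sumr_ge0.
by rewrite /average => /eqP ->; rewrite invr0 mulr0.
Qed.

(** A fixed initial segment is negligible once the total weight diverges. *)
Lemma average_head J : (fun d => \sum_(j < d) w j) @ \oo --> +oo ->
  (fun d => average d (fun j => (j < J)%N%:R)) @ \oo --> (0 : R).
Proof.
move=> Soo.
apply: (@squeeze_cvgr _ _ _ _ (cst 0) (fun d => (\sum_(j < J) w j) * (\sum_(j < d) w j)^-1)).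
- apply: nearW => d; rewrite mulr_ge0 ?invr_ge0 ?sumr_ge0//=; last first.
    by move=> j _; rewrite mulr_ge0.
  rewrite ler_wpM2r ?invr_ge0 ?sumr_ge0//.
  rewrite (eq_bigr (fun j : 'I_d => if (j < J)%N then w j else 0)); last first.
    by move=> j _; case: ifP => _; rewrite ?mulr1 ?mulr0.
  rewrite -big_mkcond/= -(big_mkord (fun j => (j < J)%N) w) -(big_mkord predT w).
  have [dJ|Jd] := leqP d J.
    rewrite [leRHS](big_cat_nat (leq0n _) dJ)/= [leRHS]addrC.
    rewrite ler_wpDl ?sumr_ge0// big_mkcond/=.
    by apply: ler_sum => j _; case: ifP.
  rewrite (big_cat_nat (leq0n _) (ltnW Jd))/= [X in _ + X]big1_seq ?addr0.
    by rewrite big_mkcond/=; apply: ler_sum => j _; case: ifP.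
  by move=> j /andP[jJ]; rewrite mem_index_iota leqNgt jJ.
- exact: cvg_cst.
- rewrite -[X in _ --> X](mulr0 (\sum_(j < J) w j)); apply: cvgM; first exact: cvg_cst.
  apply/gtr0_cvgV0 => //; by have /cvgryPgt/(_ 0) := Soo.
Qed.

End weighted_average.

Section signed.
Variables (U W : cumulativeBounded (0 : R) (1 : R)) (s : R).
Hypothesis sE : s = 1 \/ s = -1.

Let mU := lebesgue_stieltjes_measure U.
Let mW := lebesgue_stieltjes_measure W.

Let tail u z : R := \int[mW]_v (u + s * v <= z)%R%:R.

Let bounded_tail2 z : @bounded_measurable R _ (measurableTypeR R * measurableTypeR R)%type
  (fun p : R * R => (p.1 + s * p.2 <= z)%R%:R).
Proof.
apply: (bounded_comp (bounded_le_indicator z)).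
apply: measurable_funD; first exact: measurable_fst.
by apply: measurable_funM => //; exact: measurable_snd.
Qed.

Let bounded_tail u z : @bounded_measurable R _ (measurableTypeR R)
  (fun v : R => (u + s * v <= z)%R%:R).
Proof. exact: (bounded_section1 u (bounded_tail2 z)). Qed.

Let bounded_tail_int z : @bounded_measurable R _ (measurableTypeR R) (tail ^~ z).
Proof. 
have := @bounded_Rintegral1 _ _ _ _ _ mU mW _ (bounded_tail2 z).  by []. Qed.

(** The convolution written symmetrically, as the probability that the sum of
    [u] and [s * v] is at most [z]. *)
Lemma signed_convolution_tail z :
  signed_convolution U W s z = \int[mU]_u tail u z.
Proof.
rewrite /signed_convolution /tail.
rewrite (real_Fubini (bounded_L1 (mU \x mW)%E (bounded_tail2 z))).
apply: eq_Rintegral => v _; rewrite -stieltjes_le_indicator.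
by apply: eq_Rintegral => u _; rewrite lerBrDr.
Qed.

Let tail_le u x y : x <= y -> tail u x <= tail u y.
Proof.
move=> xy; apply: Rint_le; [exact/bounded_L1/bounded_tail|exact/bounded_L1/bounded_tail|].
by move=> v; rewrite ler_nat; case: leP => //= h; rewrite (le_trans h xy).
Qed.

Lemma signed_convolution_le x y : x <= y ->
  signed_convolution U W s x <= signed_convolution U W s y.
Proof.
move=> xy; rewrite !signed_convolution_tail; apply: Rint_le.
- exact/bounded_L1/bounded_tail_int.
- exact/bounded_L1/bounded_tail_int.
- by move=> u; exact: tail_le.
Qed.

Lemma signed_convolution01 x : 0 <= signed_convolution U W s x <= 1.
Proof.
have c0 := bounded_L1 mW (cst_bounded 0); have c1 := bounded_L1 mW (cst_bounded 1).
have b01 u : 0 <= tail u x <= 1.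
  rewrite -[X in _ <= _ <= X](Rint_cst mW 1) -[X in X <= _ <= _](Rint_cst mW 0) /tail.
  have tb := bounded_L1 mW (bounded_tail u x).
  apply/andP; split.
    by apply: Rint_le => // v; exact: ler0n.
  by apply: Rint_le => // v; rewrite lern1 leq_b1.
have d0 := bounded_L1 mU (cst_bounded 0); have d1 := bounded_L1 mU (cst_bounded 1).
have tb := bounded_L1 mU (bounded_tail_int x).
rewrite signed_convolution_tail -[X in _ <= _ <= X](Rint_cst mU 1) -[X in X <= _ <= _](Rint_cst mU 0).
apply/andP; split; apply: Rint_le => // u; first by have /andP[] := b01 u.
by have /andP[] := b01 u.
Qed.

Let boundedU x : @bounded_measurable R _ (measurableTypeR R) (fun v : R => U (x - s * v)).
Proof.
have := bounded_Rintegral2 mU mW (bounded_tail2 x).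
congr bounded_measurable; apply/funext => v; rewrite -stieltjes_le_indicator.
by apply: eq_Rintegral => u _; rewrite lerBrDr.
Qed.

Let outside (K v : R) : R := (v <= - K)%R%:R + (1 - (v <= K)%R%:R).

Let bounded_outside K : @bounded_measurable R _ (measurableTypeR R) (outside K).
Proof.
apply: boundedD; first exact: bounded_le_indicator.
by apply: boundedB; [exact: cst_bounded|exact: bounded_le_indicator].
Qed.

Let integral_outside K : \int[mW]_v outside K v = W (- K) + (1 - W K).
Proof.
have b x := bounded_L1 mW (bounded_le_indicator x).
have b1 := bounded_L1 mW (cst_bounded 1).
by rewrite RintD ?RintB ?Rint_cst ?stieltjes_le_indicator//; exact: L1B.
Qed.

Let essential_range e : 0 < e -> exists K,
  [/\ W (- K) + (1 - W K) <= 2 * e, U (- K) <= e & 1 - e <= U K].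
Proof.
move=> e0; have [A WA] := cumulative_lo W e0; have [B WB] := cumulative_hi W e0.
have [A' UA] := cumulative_lo U e0; have [B' UB] := cumulative_hi U e0.
pose K := Num.max (Num.max (- A) B) (Num.max (- A') B').
have KA : - K <= A by rewrite lerNl !le_max lexx.
have KB : B <= K by rewrite !le_max lexx orbT.
have KA' : - K <= A' by rewrite lerNl !le_max lexx !orbT.
have KB' : B' <= K by rewrite !le_max lexx !orbT.
exists K; split; [|exact: UA|exact: UB].
by have := WA _ KA; have := WB _ KB; lra.
Qed.

Lemma signed_convolution_lo e : 0 < e -> exists x, signed_convolution U W s x < e.
Proof.
move=> e0; have e4 : 0 < e / 4 by rewrite divr_gt0.
have [K [WK UK _]] := essential_range e4; exists (- K - K).
apply: (@le_lt_trans _ _ (\int[mW]_v (e / 4 + outside K v))); last first.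
  rewrite RintD; last exact/bounded_L1/bounded_outside.
    by rewrite Rint_cst integral_outside; lra.
  exact/bounded_L1/cst_bounded.
apply: Rint_le; first exact/bounded_L1/boundedU.
  by apply: L1D; [exact/bounded_L1/cst_bounded|exact/bounded_L1/bounded_outside].
move=> v; have /andP[_ U1] := cumulative01 U (- K - K - s * v).
rewrite /outside; case: (leP v (- K)) => h1; case: (leP v K) => h2 /=; try lra.
have : U (- K - K - s * v) <= U (- K).
  by apply: cumulative_le; case: sE => ->; lra.
by lra.
Qed.

Lemma signed_convolution_hi e : 0 < e -> exists x, 1 - e < signed_convolution U W s x.
Proof.
move=> e0; have e4 : 0 < e / 4 by rewrite divr_gt0.
have [K [WK _ UK]] := essential_range e4; exists (K + K).
apply: (@lt_le_trans _ _ (\int[mW]_v (1 - e / 4 - outside K v))).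
  rewrite RintB; last exact/bounded_L1/bounded_outside.
    by rewrite Rint_cst integral_outside; lra.
  exact/bounded_L1/cst_bounded.
apply: Rint_le; last first.
- move=> v; have /andP[U0 _] := cumulative01 U (K + K - s * v).
  rewrite /outside; case: (leP v (- K)) => h1; case: (leP v K) => h2 /=; try lra.
  have : U K <= U (K + K - s * v).
    by apply: cumulative_le; case: sE => ->; lra.
  by lra.
- exact/bounded_L1/boundedU.
- by apply: L1B; [exact/bounded_L1/cst_bounded|exact/bounded_L1/bounded_outside].
Qed.

Variables (w : nat -> R) (v : nat -> nat -> R).
Hypothesis w0 : forall j, 0 <= w j.
Hypothesis Soo : (fun d => \sum_(j < d) w j) @ \oo --> +oo.
Hypothesis Wcvg : forall x, {for x, continuous W} ->
  (fun d => average w d (fun j => (v j d <= x)%R%:R)) @ \oo --> W x.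

Let Spos : \forall d \near \oo, 0 < \sum_(j < d) w j.
Proof. by have /cvgryPgt/(_ 0) := Soo. Qed.

Let W_sandwich del : 0 < del -> \forall d \near \oo, forall x,
  W (x - del) - del <= average w d (fun j => (v j d <= x)%R%:R) <= W (x + del) + del.
Proof.
apply: levy_sandwich => //.
- apply: nearW => d x y xy; apply: average_le => // j; rewrite ler_nat.
  by case: leP => //= h; rewrite (le_trans h xy).
- by apply: nearW => d x; apply: average01 => // j; rewrite ler0n lern1 leq_b1.
Qed.

(** For [s = 1] the event is a lower half-line in [v].  For [s = -1] it is a closed
    upper half-line, of which [W] measures the complement up to the boundary
    point; the slack absorbs that point. *)
Let tail_sandwich del : 0 < del -> \forall d \near \oo, forall u z,
  tail u (z - del) - del <= average w d (fun j => (u + s * v j d <= z)%R%:R)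
    <= tail u (z + del) + del.
Proof.
move=> del0; case: sE => s1.
  have tW u z : tail u z = W (z - u).
    rewrite -stieltjes_le_indicator; apply: eq_Rintegral => y _.
    by rewrite s1 mul1r lerBrDl.
  apply: filterS (W_sandwich del0) => d H u z; rewrite !tW.
  have -> : average w d (fun j => (u + s * v j d <= z)%R%:R) =
    average w d (fun j => (v j d <= z - u)%R%:R).
    by congr average; apply/funext => j; rewrite s1 mul1r lerBrDl.
  by have := H (z - u); rewrite addrAC [z - u + del]addrAC.
have compl c : bounded_measurable (fun y : measurableTypeR R => 1 - ((y : R) <= c)%R%:R : R).
  by apply: boundedB; [exact: cst_bounded|exact: bounded_le_indicator].
have complE c : 1 - W c = \int[mW]_y (1 - (y <= c)%R%:R : R).
  rewrite RintB ?Rint_cst ?stieltjes_le_indicator//.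
    exact/bounded_L1/cst_bounded.
  exact/bounded_L1/bounded_le_indicator.
have tlo u z : 1 - W (u - z) <= tail u z.
  rewrite complE; apply: Rint_le.
  - exact: bounded_L1.
  - exact/bounded_L1/bounded_tail.
  - by move=> y; rewrite s1 mulN1r; case: (leP y (u - z)) => h1; case: (leP (u - y) z) => h2 //=; lra.
have thi u z eta : 0 < eta -> tail u z <= 1 - W (u - z - eta).
  move=> eta0; rewrite complE; apply: Rint_le.
  - exact/bounded_L1/bounded_tail.
  - exact: bounded_L1.
  - by move=> y; rewrite s1 mulN1r; case: (leP y (u - z - eta)) => h1; case: (leP (u - y) z) => h2 //=; lra.
have del20 : 0 < del / 2 by rewrite divr_gt0.
apply: filterS2 Spos (W_sandwich del20) => d Sd H u z.
have avgB c : 1 - average w d (fun j => (v j d <= c)%R%:R) =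
    average w d (fun j => 1 - (v j d <= c)%R%:R).
  by rewrite averageB average_cst.
apply/andP; split.
  apply: (@le_trans _ _ (1 - average w d (fun j => (v j d <= u - z)%R%:R))).
    have /andP[_ h] := H (u - z).
    have := @thi u (z - del) (del / 2) del20.
    have -> : u - (z - del) - del / 2 = u - z + del / 2 by lra.
    by move: h; lra.
  rewrite avgB; apply: average_le => // j.
  by rewrite s1 mulN1r; case: (leP (v j d) (u - z)) => h1; case: (leP (u - v j d) z) => h2 //=; lra.
apply: (@le_trans _ _ (1 - average w d (fun j => (v j d <= u - z - del / 2)%R%:R))).
  rewrite avgB; apply: average_le => // j.
  by rewrite s1 mulN1r; case: (leP (v j d) (u - z - del / 2)) => h1; case: (leP (u - v j d) z) => h2 //=; lra.
have /andP[h _] := H (u - z - del / 2).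
have := @tlo u (z + del).
have -> : u - (z + del) = u - z - del / 2 - del / 2 by lra.
by move: h; lra.
Qed.

Let average_U d z : average w d (fun j => U (z - s * v j d)) =
  \int[mU]_u average w d (fun j => (u + s * v j d <= z)%R%:R).
Proof.
have bj j : @bounded_measurable R _ (measurableTypeR R)
    (fun u : R => (u + s * v j d <= z)%R%:R).
  exact: (bounded_section2 (v j d) (bounded_tail2 z)).
rewrite /average RintZr; last first.
  apply: bounded_L1; apply: bounded_sum => j; apply: boundedZ; exact: bj.
rewrite Rint_sum; last by move=> j; apply: L1Zl; exact/bounded_L1/bj.
congr (_ / _); apply: eq_bigr => j _; rewrite RintZl; last exact/bounded_L1/bj.
congr (_ * _); rewrite -stieltjes_le_indicator.
by apply: eq_Rintegral => u _; rewrite lerBrDr.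
Qed.

Let average_U_sandwich del : 0 < del -> \forall d \near \oo, forall z,
  signed_convolution U W s (z - del) - del <=
    average w d (fun j => U (z - s * v j d)) <=
    signed_convolution U W s (z + del) + del.
Proof.
move=> del0; apply: filterS (tail_sandwich del0) => d H z.
have bA : @bounded_measurable R _ (measurableTypeR R)
    (fun u : R => average w d (fun j => (u + s * v j d <= z)%R%:R)).
  rewrite /average; under eq_fun do rewrite mulrC.
  apply: boundedZ; apply: bounded_sum => j; apply: boundedZ.
  exact: (bounded_section2 (v j d) (bounded_tail2 z)).
rewrite average_U !signed_convolution_tail.
have cL := bounded_L1 mU (cst_bounded del).
have tL x := bounded_L1 mU (bounded_tail_int x).
have AL := bounded_L1 mU bA.
have lo := Rint_le (L1B (tL (z - del)) cL) AL (fun u => (andP (H u z)).1).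
have hi := Rint_le AL (L1D (tL (z + del)) cL) (fun u => (andP (H u z)).2).
move: lo hi; rewrite (RintB (tL _) cL) (RintD (tL _) cL) Rint_cst => lo hi.
by apply/andP; split.
Qed.

(** The distribution function [Uj j] may be replaced by its limit, since small
    indices carry a negligible weight.  The average over [j] of the shifted limits
    then is the integral over [U] of averages of indicators, which by
    [tail_sandwich] are close to the inner integral of the convolution. *)
Lemma mixture_sandwich (Uj : nat -> R -> R) :
  (forall j x y, x <= y -> Uj j x <= Uj j y) ->
  (forall j x, 0 <= Uj j x <= 1) ->
  (forall x, {for x, continuous U} -> (fun j => Uj j x) @ \oo --> U x) ->
  forall del, 0 < del -> \forall d \near \oo, forall x,
    signed_convolution U W s (x - del) - del <=
      average w d (fun j => Uj j (x - s * v j d)) <=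
      signed_convolution U W s (x + del) + del.
Proof.
move=> Ujle Uj01 Ucvg del del0.
have del30 : 0 < del / 3 by rewrite divr_gt0.
have [J _ HJ] : \forall j \near \oo, forall x,
    U (x - del / 3) - del / 3 <= Uj j x <= U (x + del / 3) + del / 3.
  by apply: levy_sandwich => //; apply: nearW.
have head := average_head w0 J Soo.
have {}head : \forall d \near \oo, average w d (fun j => (j < J)%N%:R) <= del / 3.
  have := head => /cvgrPdist_le/(_ _ del30); apply: filterS => d.
  by rewrite sub0r normrN; apply: le_trans; exact: ler_norm.
apply: filterS3 head (average_U_sandwich del30) Spos => d Hh HA Sd x.
have U01 := cumulative01 U.
apply/andP; split.
  apply: (@le_trans _ _ (average w d (fun j => U (x - del / 3 - s * v j d) -
      ((j < J)%N%:R + del / 3)))).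
    rewrite averageB averageD average_cst//.
    have /andP[h _] := HA (x - del / 3).
    have : signed_convolution U W s (x - del) <=
      signed_convolution U W s (x - del / 3 - del / 3).
      by apply: signed_convolution_le; lra.
    by lra.
  apply: average_le => // j; have [jJ|Jj] := ltnP j J.
    by have /andP[_ h] := U01 (x - del / 3 - s * v j d);
      have /andP[h' _] := Uj01 j (x - s * v j d); rewrite /=; lra.
  by have /andP[h _] := HJ j Jj (x - s * v j d); rewrite /= add0r addrAC.
apply: (@le_trans _ _ (average w d (fun j => U (x + del / 3 - s * v j d) +
    ((j < J)%N%:R + del / 3)))); last first.
  rewrite !averageD average_cst//.
  have /andP[_ h] := HA (x + del / 3).
  have : signed_convolution U W s (x + del / 3 + del / 3) <=
    signed_convolution U W s (x + del).
    by apply: signed_convolution_le; lra.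
  by lra.
apply: average_le => // j; have [jJ|Jj] := ltnP j J.
  by have /andP[h _] := U01 (x + del / 3 - s * v j d);
    have /andP[_ h'] := Uj01 j (x - s * v j d); rewrite /=; lra.
by have /andP[_ h] := HJ j Jj (x - s * v j d); rewrite /= add0r [x + _ - _]addrAC.
Qed.

End signed.

End mixture.

(** * Excess functions and integrals of quantiles *)

Section quantile_excess.
Context {R : realType}.
Implicit Types x y tau h e : R.

(** The excess [max 0 (tau - x)] is the integral over the levels [t] from 0 to
    [tau] of the indicator of [x <= t]; this is the upper Riemann sum with [N]
    steps of length [h], and the next lemma the lower one with [N.+1] steps. *)
Lemma excess_riemann_le (h x : R) N : 0 <= h -> 0 <= x ->
  Num.max 0 (h * N%:R - x) <= h * \sum_(i < N) (x <= h * i.+1%:R)%R%:R.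
Proof.
move=> h0 x0; elim: N => [|N IH].
  by rewrite big_ord0 !mulr0 sub0r maxEle; case: ifP => //; lra.
rewrite big_ord_recr/= mulrDr; move: IH; set S := \sum_(i < N) _.
have -> : h * N.+1%:R = h * N%:R + h by rewrite -natr1 mulrDr mulr1.
case: (leP x (h * N%:R + h)) => c; rewrite ?mulr1 ?mulr0 !ge_max => /andP[a b];
  apply/andP; split; lra.
Qed.

Lemma excess_riemann_ge (h x : R) N : 0 <= h -> 0 <= x ->
  h * \sum_(i < N) (x <= h * i.+1%:R)%R%:R <= Num.max 0 (h * N.+1%:R - x).
Proof.
move=> h0 x0; elim: N => [|N IH]; first by rewrite big_ord0 mulr0 le_max lexx.
rewrite big_ord_recr/= mulrDr; move: IH; set S := \sum_(i < N) _.
have -> : h * N.+2%:R = h * N.+1%:R + h by rewrite -[N.+2%:R]natr1 mulrDr mulr1.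
case: (leP x (h * N.+1%:R)) => c; rewrite ?mulr1 ?mulr0 !le_max => /orP[] a;
  apply/orP; try (by left; lra); right; lra.
Qed.

Variable F : R -> R.
Hypothesis Fle : forall x y, x <= y -> F x <= F y.
Hypothesis F01 : forall x, 0 <= F x <= 1.
Hypothesis Flo : forall e, 0 < e -> exists x, F x < e.
Hypothesis Fhi : forall e, 0 < e -> exists x, 1 - e < F x.

Local Notation mu := (@leb01 R).

Let has_inf_quantile y : 0 < y < 1 -> has_inf [set x | y <= F x].
Proof.
move=> /andP[y0 y1]; split.
  have [|x xh] := @Fhi (1 - y); first by rewrite subr_gt0.
  by exists x => /=; apply: ltW; move: xh; rewrite subKr.
have [x xl] := Flo y0; exists x => z /= yz.
by rewrite leNgt; apply/negP => /ltW/Fle; lra.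
Qed.

Lemma quantile_le x y : 0 < y < 1 -> y <= F x -> quantile F y <= x.
Proof. by move=> y01 yx; apply: ge_inf => //; exact: (has_inf_quantile y01).2. Qed.

Lemma quantile_ge x x' y : 0 < y < 1 -> quantile F y <= x -> x < x' -> y <= F x'.
Proof.
move=> y01 qx xx'; have [z /= yz zx] := inf_lt (has_inf_quantile y01).1 (le_lt_trans qx xx').
by apply: (le_trans yz); apply: Fle; exact: ltW.
Qed.

Lemma quantile_homo y y' : 0 < y < 1 -> 0 < y' < 1 -> y <= y' ->
  quantile F y <= quantile F y'.
Proof.
move=> y01 y01' yy'; apply: lb_le_inf; first exact: (has_inf_quantile y01').1.
by move=> z /= yz; apply: quantile_le => //; exact: le_trans yz.
Qed.

(** Extended by zero on the left, where it must be nonnegative, nondecreasing and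
    contribute nothing to integrals. *)
Definition exp_quantile y : R := if y <= 0 then 0 else expR (quantile F y).

Local Notation E := exp_quantile.

Lemma exp_quantile_ge0 y : 0 <= E y.
Proof. by rewrite /E; case: ifP => // _; exact: expR_ge0. Qed.

Lemma exp_quantile_homo y y' : y <= y' -> y' < 1 -> E y <= E y'.
Proof.
rewrite /E; case: (leP y 0) => [_|y0] yy' y1; first exact: exp_quantile_ge0.
have y0' : 0 < y' by exact: lt_le_trans yy'.
rewrite (leNgt y') y0'/= ler_expR; apply: quantile_homo => //.
  by rewrite y0 (le_lt_trans yy').
by rewrite y0'.
Qed.

Let excess tau y : R := if y < 1 then Num.max 0 (tau - E y) else 0.
Let below t y : R := if y < 1 then (E y <= t)%R%:R else 0.

Let bounded_excess tau : @bounded_measurable R _ (measurableTypeR R) (excess tau).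
Proof.
split.
  apply: nonincreasing_measurable => // y y' yy'; rewrite /excess.
  case: (ltP y' 1) => y1'; last by case: ifP => _ //; rewrite le_max lexx.
  by rewrite (le_lt_trans yy' y1') le_max2// lerB// exp_quantile_homo.
exists `|tau| => y; rewrite /excess; case: ifP => _; last by rewrite normr0.
rewrite ger0_norm ?le_max ?lexx// ge_max normr_ge0/=.
by rewrite (le_trans _ (ler_norm _))// gerBl exp_quantile_ge0.
Qed.

Let bounded_below t : @bounded_measurable R _ (measurableTypeR R) (below t).
Proof.
split.
  apply: nonincreasing_measurable => // y y' yy'; rewrite /below.
  case: (ltP y' 1) => y1'; last by case: ifP => _ //.
  rewrite (le_lt_trans yy' y1') ler_nat; case: (leP (E y') t) => //= Et.
  by rewrite (le_trans _ Et)// exp_quantile_homo.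
exists 1 => y; rewrite /below; case: ifP => _; last by rewrite normr0.
by rewrite ger0_norm// lern1 leq_b1.
Qed.

Lemma leb01_le c : 0 <= c <= 1 -> \int[mu]_y ((y <= c)%R%:R : R) = c.
Proof.
move=> /andP[c0 c1].
have -> : (fun u : R => (u <= c)%R%:R) = \1_(`]-oo, c]%classic) :> (R -> R).
  by apply/funext => u; rewrite indicE; congr (nat_of_bool _)%:R; rewrite mem_setE/= in_itv.
rewrite /Rintegral integral_indic ?setIT//.
change (fine (lebesgue_measure (`]-oo, c]%classic `&` `[0, 1]%classic)) = c).
rewrite [X in lebesgue_measure X](_ : _ = `[0, c]%classic); last first.
  apply/seteqP; split=> y /=; rewrite !in_itv/=; first by move=> [yc /andP[-> _]].
  by move=> /andP[-> yc]; split=> //; rewrite (le_trans yc).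
by rewrite lebesgue_measure_itv/= lte_fin; case: ltP => c0' /=; rewrite ?oppr0 ?adde0 ?subr0//; lra.
Qed.

Definition mean_excess tau : R := \int[mu]_y excess tau y.
Let mass_below t : R := \int[mu]_y below t y.

Local Notation H := mean_excess.

Lemma mean_excess_lip tau tau' : tau <= tau' -> H tau' <= H tau + (tau' - tau).
Proof.
move=> tt; rewrite -[X in _ + X](Rint_cst mu) -RintD; first last.
- exact/bounded_L1/cst_bounded.
- exact/bounded_L1/bounded_excess.
apply: Rint_le; first exact/bounded_L1/bounded_excess.
  apply: L1D; first exact/bounded_L1/bounded_excess.
  exact/bounded_L1/cst_bounded.
move=> y; rewrite /excess; case: ifP => _; last by lra.
have m0 : 0 <= Num.max 0 (tau - E y) by rewrite le_max lexx.
have m1 : tau - E y <= Num.max 0 (tau - E y) by rewrite le_max lexx orbT.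
by rewrite ge_max; apply/andP; split; lra.
Qed.

Let mass_below_ge x : F x <= mass_below (expR x).
Proof.
have m0 : 0 <= mass_below (expR x).
  rewrite -(Rint_cst mu 0); apply: Rint_le; first exact/bounded_L1/cst_bounded.
    exact/bounded_L1/bounded_below.
  by move=> y; rewrite /below; case: ifP.
apply/ler_addgt0Pr => e e0; rewrite -lerBlDr.
have [Fe|Fe] := leP (F x - e) 0; first exact: le_trans m0.
have /andP[F0 F1] := F01 x.
rewrite -(@leb01_le (F x - e)); last by apply/andP; split; lra.
apply: Rint_le; [exact/bounded_L1/bounded_le_indicator|exact/bounded_L1/bounded_below|].
move=> y; rewrite /below; case: (leP y (F x - e)) => ye /=; last by case: ifP.
have y1 : y < 1 by lra.
rewrite y1 /E; case: (leP y 0) => y0; first by rewrite expR_ge0.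
by rewrite ler_expR quantile_le ?y0//; lra.
Qed.

Let mass_below_le x x' : x < x' -> mass_below (expR x) <= F x'.
Proof.
move=> xx'; rewrite -(leb01_le (F01 x')).
apply: Rint_le; [exact/bounded_L1/bounded_below|exact/bounded_L1/bounded_le_indicator|].
move=> y; rewrite /below; case: ifP => y1 //.
rewrite ler_nat /E; case: (leP y 0) => y0.
  by have /andP[h _] := F01 x'; rewrite (le_trans y0 h) leq_b1.
rewrite ler_expR; case: leP => //= q.
by rewrite (quantile_ge _ q xx')// y0.
Qed.

Let mean_excess_riemann_le h N : 0 <= h ->
  H (h * N%:R) <= h * \sum_(i < N) mass_below (h * i.+1%:R).
Proof.
move=> h0; rewrite -Rint_sum; last by move=> i; exact/bounded_L1/bounded_below.
have bs : @bounded_measurable R _ (measurableTypeR R)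
    (fun y => \sum_(i < N) below (h * i.+1%:R) y).
  by apply: bounded_sum => i; exact: bounded_below.
rewrite -RintZl; last exact/bounded_L1/bs.
apply: Rint_le; [exact/bounded_L1/bounded_excess|exact/bounded_L1/boundedZ/bs|].
move=> y; rewrite /excess /below; case: ifP => _; last by rewrite big1// mulr0.
exact: excess_riemann_le (exp_quantile_ge0 _).
Qed.

Let mean_excess_riemann_ge h N : 0 <= h ->
  h * \sum_(i < N) mass_below (h * i.+1%:R) <= H (h * N.+1%:R).
Proof.
move=> h0; rewrite -Rint_sum; last by move=> i; exact/bounded_L1/bounded_below.
have bs : @bounded_measurable R _ (measurableTypeR R)
    (fun y => \sum_(i < N) below (h * i.+1%:R) y).
  by apply: bounded_sum => i; exact: bounded_below.
rewrite -RintZl; last exact/bounded_L1/bs.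
apply: Rint_le; [exact/bounded_L1/boundedZ/bs|exact/bounded_L1/bounded_excess|].
move=> y; rewrite /excess /below; case: ifP => _; last by rewrite big1// mulr0.
exact: excess_riemann_ge (exp_quantile_ge0 _).
Qed.

(** A mean excess depends on the distribution function only, through Riemann
    sums, so Levy closeness is inherited; the relative shifts of levels by the
    factor [expR del] are absorbed by [mean_excess_lip]. *)
Lemma mean_excess_close (Hd Fd : R -> R) (del : R) :
  (forall h N, 0 < h -> Hd (h * N%:R) <= h * \sum_(i < N) Fd (ln (h * i.+1%:R))) ->
  (forall h N, 0 < h -> h * \sum_(i < N) Fd (ln (h * i.+1%:R)) <= Hd (h * N.+1%:R)) ->
  0 < del <= 2^-1 ->
  (forall x, F (x - del) - del <= Fd x <= F (x + del) + del) ->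
  forall tau, 0 < tau -> `|Hd tau - H tau| <= 5 * tau * del.
Proof.
move=> Hle Hge /andP[del0 del2] FF tau tau0.
(* so that the mesh h of the Riemann sums is at most tau * del *)
pose N := (Num.truncn del^-1).
have N0 : 0 < N.+1%:R :> R by rewrite ltr0n.
have NE : N.+1%:R^-1 <= del.
  rewrite -[leRHS]invrK lef_pV2 ?posrE ?invr_gt0//.
  exact/ltW/truncnS_gt.
pose h := tau / N.+1%:R; have h0 : 0 < h by rewrite divr_gt0.
have hN : h * N.+1%:R = tau by rewrite mulfVK// gt_eqF.
have hd : h <= tau * del by rewrite ler_pM2l.
have e1 : expR del <= 1 + 2 * del.
  have e0 := expR_gt0 del.
  have : (1 - del) * expR del <= 1.
    rewrite -[leRHS](mulVf (lt0r_neq0 e0)) ler_pM2r// -expRN.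
    exact: expR_ge1Dx.
  have : del * expR del <= 2^-1 * expR del by rewrite ler_pM2r.
  rewrite mulrBl mul1r => a b; have c : expR del <= 2 by lra.
  have : del * expR del <= del * 2 by rewrite ler_pM2l.
  by lra.
have e2 : 1 - 2 * del <= expR (- (2 * del)) by exact: expR_ge1Dx.
have e2' : expR (- (2 * del)) <= 1 by rewrite -[leRHS]expR0 ler_expR; lra.
have e1' : 1 <= expR del by rewrite -[leLHS]expR0 ler_expR; lra.
have hi0 i : 0 < h * i.+1%:R by rewrite mulr_gt0.
have m0 t : 0 <= mass_below t.
  rewrite -(Rint_cst mu 0); apply: Rint_le; first exact/bounded_L1/cst_bounded.
    exact/bounded_L1/bounded_below.
  by move=> y; rewrite /below; case: ifP.
have hN2 : h * N%:R = tau - h by rewrite -hN -natr1; lra.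
have hN3 : h * N.+2%:R = tau + h by rewrite -hN -[N.+2%:R]natr1; lra.
have td0 : 0 < tau * del by rewrite mulr_gt0.
have tdd : tau * del * del <= tau * del * 2^-1 by rewrite ler_pM2l.
rewrite ler_distl; apply/andP; split.
  have ge : h * \sum_(i < N) Fd (ln (h * i.+1%:R)) <= Hd tau.
    by rewrite -hN; exact: Hge.
  set h' := h * expR (- (2 * del)).
  have h'0 : 0 < h' by rewrite mulr_gt0 ?expR_gt0.
  have ge2 : h * \sum_(i < N) (mass_below (h' * i.+1%:R) - del) <=
      h * \sum_(i < N) Fd (ln (h * i.+1%:R)).
    rewrite ler_pM2l//; apply: ler_sum => i _.
    have /andP[+ _] := FF (ln (h * i.+1%:R)); apply: le_trans.
    rewrite lerB//.
    have -> : h' * i.+1%:R = expR (ln (h * i.+1%:R) - 2 * del).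
      by rewrite expRD lnK ?posrE// /h' mulrAC.
    by apply: mass_below_le; lra.
  rewrite sumrB sumr_const card_ord mulrBr -mulr_natr mulrCA [h * N%:R]hN2 in ge2.
  have ge3 : h' * \sum_(i < N) mass_below (h' * i.+1%:R) <=
      h * \sum_(i < N) mass_below (h' * i.+1%:R).
    by rewrite ler_wpM2r ?sumr_ge0// /h' ger_pMr.
  have ge4 := mean_excess_riemann_le N (ltW h'0).
  have h'N : (1 - 2 * del) * (tau - h) <= h' * N%:R.
    by rewrite /h' mulrAC hN2 mulrC ler_wpM2l// -hN2 mulr_ge0// ltW.
  have h'N' : h' * N%:R <= tau.
    rewrite /h' mulrAC hN2; apply: (@le_trans _ _ (tau - h)); last by lra.
    by rewrite ler_piMr// -hN2 mulr_ge0// ltW.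
  have := mean_excess_lip h'N'.
  have : del * (tau - h) <= del * tau by rewrite ler_pM2l//; lra.
  have : 0 <= del * h by rewrite mulr_ge0// ltW.
  have : (1 - 2 * del) * (tau - h) = tau - h - 2 * (tau * del) + 2 * (del * h) by ring.
  by lra.
have le1 : Hd tau <= h * \sum_(i < N.+1) Fd (ln (h * i.+1%:R)).
  by rewrite -{1}hN; exact: Hle.
set h' := h * expR del.
have h'0 : 0 < h' by rewrite mulr_gt0 ?expR_gt0.
have le2 : h * \sum_(i < N.+1) Fd (ln (h * i.+1%:R)) <=
    h * \sum_(i < N.+1) (mass_below (h' * i.+1%:R) + del).
  rewrite ler_pM2l//; apply: ler_sum => i _.
  have /andP[_ /le_trans] := FF (ln (h * i.+1%:R)); apply.
  rewrite lerD2r.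
  have -> : h' * i.+1%:R = expR (ln (h * i.+1%:R) + del).
    by rewrite expRD lnK ?posrE// /h' mulrAC.
  exact: mass_below_ge.
rewrite big_split/= sumr_const card_ord mulrDr -[X in _ + _ * X]mulr_natr mulrCA hN in le2.
have le3 : h * \sum_(i < N.+1) mass_below (h' * i.+1%:R) <=
    h' * \sum_(i < N.+1) mass_below (h' * i.+1%:R).
  by rewrite ler_wpM2r ?sumr_ge0// /h' ler_peMr// ltW.
have le4 := mean_excess_riemann_ge N.+1 (ltW h'0).
have h'N : h' * N.+2%:R <= (1 + 2 * del) * (tau + h).
  by rewrite /h' mulrAC hN3 mulrC ler_wpM2r// addr_ge0// ltW.
have h'N' : tau <= h' * N.+2%:R.
  rewrite /h' mulrAC hN3; apply: (@le_trans _ _ (tau + h)); first by lra.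
  by rewrite ler_peMr// addr_ge0// ltW.
have := mean_excess_lip h'N'.
have : del * h <= del * (tau * del) by rewrite ler_pM2l.
have : (1 + 2 * del) * (tau + h) = tau + h + 2 * (tau * del) + 2 * (del * h) by ring.
by lra.
Qed.

Section quantile_integral.
Variable y0 : R.
Hypothesis y01 : 0 < y0 < 1.

Let initial y : R := if y < y0 then E y else 0.

Local Notation I :=
  (\int[lebesgue_measure]_(y in `]0, y0[) expR (quantile F y)).

Let E_y0 : E y0 = expR (quantile F y0).
Proof. by rewrite /E leNgt; have /andP[-> _] := y01. Qed.

Let bounded_initial : @bounded_measurable R _ (measurableTypeR R) initial.
Proof.
have /andP[y0_gt0 y0_lt1] := y01.
split; last first.
  exists (E y0) => y; rewrite /initial; case: ifP => yy.
    by rewrite ger0_norm ?exp_quantile_ge0// exp_quantile_homo// ltW.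
  by rewrite normr0 exp_quantile_ge0.
(* a product of a nondecreasing and a nonincreasing function *)
pose up y := if y < y0 then E y else E y0.
pose step y : R := if y < y0 then 1 else 0.
have -> : initial = (fun y => up y * step y).
  by apply/funext => y; rewrite /initial /up /step; case: ifP => _; rewrite ?mulr1 ?mulr0.
apply: measurable_funM.
  apply: nondecreasing_measurable => // y y' yy'; rewrite /up.
  case: (ltP y' y0) => y'0.
    by rewrite (le_lt_trans yy' y'0) exp_quantile_homo// (lt_trans y'0).
  by case: ltP => // yy0; rewrite exp_quantile_homo// ltW.
apply: nonincreasing_measurable => // y y' yy'; rewrite /step.
case: (ltP y' y0) => y'0; first by rewrite (le_lt_trans yy' y'0).
by case: ifP.
Qed.

Let integral_initial : I = \int[mu]_y initial y.
Proof.
have /andP[y0_gt0 y0_lt1] := y01.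
transitivity (\int[mu]_(y in `]0, y0[) initial y).
  transitivity (\int[lebesgue_measure]_(y in `]0, y0[) initial y).
    apply: eq_Rintegral => y; rewrite inE/= in_itv/= => /andP[y_gt0 yy0].
    by rewrite /initial yy0 /E leNgt y_gt0.
  congr fine; apply: eq_measure_integral => A mA AD.
  change (lebesgue_measure A = lebesgue_measure (A `&` `[0, 1]%classic)).
  congr lebesgue_measure; apply/esym/setIidPl => y /AD /=.
  rewrite !in_itv/= => /andP[y_gt0 yy0]; rewrite !ltW//.
  exact: lt_trans y0_lt1.
rewrite Rintegral_mkcond; apply: eq_Rintegral => y _.
rewrite /patch; case: ifPn => //; rewrite notin_setE/= in_itv/= => /negP.
rewrite negb_and -!leNgt /initial /E => /orP[->|yy0]; first by case: ifP.
by rewrite ltNge yy0.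
Qed.

Let step y : R := (y < y0)%R%:R.

Let stepE : step = \1_(`]-oo, y0[%classic) :> (R -> R).
Proof. by apply/funext => u; rewrite indicE; congr (nat_of_bool _)%:R; rewrite mem_setE/= in_itv. Qed.

Let bounded_step : @bounded_measurable R _ (measurableTypeR R) step.
Proof.
split; first by rewrite stepE; apply: measurable_indic; exact: measurable_itv.
by exists 1 => y; rewrite /step ger0_norm// lern1 leq_b1.
Qed.

Let integral_step : \int[mu]_y step y = y0.
Proof.
have /andP[y0_gt0 y0_lt1] := y01.
rewrite stepE /Rintegral integral_indic ?setIT//.
change (fine (lebesgue_measure (`]-oo, y0[%classic `&` `[0, 1]%classic)) = y0).
rewrite [X in lebesgue_measure X](_ : _ = `[0, y0[%classic); last first.
  apply/seteqP; split=> y /=; rewrite !in_itv/=; first by move=> [yc /andP[-> _]].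
  by move=> /andP[-> yc]; split=> //; rewrite ltW// (lt_trans yc).
by rewrite lebesgue_measure_itv/= lte_fin y0_gt0/= oppr0 addr0.
Qed.

(** Young's inequality: the integral of the exponential of the quantile over an
    initial interval is the convex conjugate, at [y0], of the mean excess.  Pointwise,
    [tau - max 0 (tau - x)] is at most [x] before [y0], and the excess is
    nonnegative after [y0]. *)
Lemma excess_conjugate_le tau : 0 <= tau -> tau * y0 - H tau <= I.
Proof.
move=> tau0; have /andP[y0_gt0 y0_lt1] := y01.
have b1 := bounded_L1 mu bounded_step.
have b2 := bounded_L1 mu (bounded_excess tau).
have b3 := bounded_L1 mu bounded_initial.
have b4 := L1Zl tau b1.
rewrite integral_initial -integral_step -RintZl// -RintB//; apply: Rint_le => //; first exact: L1B.
move=> y; rewrite /step /excess /initial.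
have m0 : 0 <= Num.max 0 (tau - E y) by rewrite le_max lexx.
have m1 : tau - E y <= Num.max 0 (tau - E y) by rewrite le_max lexx orbT.
case: (ltP y y0) => yy0 /=.
  by rewrite (lt_trans yy0 y0_lt1) mulr1; lra.
by case: ifP => _; rewrite mulr0; lra.
Qed.

(** The supremum of the conjugate is attained where the sign of [tau - x] changes
    at [y0]. *)
Lemma excess_conjugate_eq (tau := expR (quantile F y0)) : tau * y0 - H tau = I.
Proof.
have /andP[y0_gt0 y0_lt1] := y01.
have b1 := bounded_L1 mu bounded_step.
have b2 := bounded_L1 mu (bounded_excess tau).
have b4 := L1Zl tau b1.
rewrite integral_initial -[X in _ * X]integral_step -RintZl// -RintB//.
apply: eq_Rintegral => y _; rewrite /step /excess /initial {b1 b2 b4} /tau -E_y0.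
case: (ltP y y0) => yy0 /=.
  rewrite (lt_trans yy0 y0_lt1) mulr1 max_r ?subKr// subr_ge0.
  by rewrite exp_quantile_homo// ltW.
case: ifP => y1; rewrite mulr0 ?subr0// max_l ?subr0// subr_le0.
exact: exp_quantile_homo.
Qed.

Lemma integral_exp_quantile_gt0 : 0 < I.
Proof.
have /andP[y0_gt0 y0_lt1] := y01.
have y2 : 0 < y0 / 2 by rewrite divr_gt0.
have y2' : y0 / 2 < y0 by lra.
set c := expR (quantile F (y0 / 2)); have c0 : 0 < c by exact: expR_gt0.
apply: (@lt_le_trans _ _ (c * (y0 - y0 / 2))); first by rewrite mulr_gt0 ?subr_gt0.
have b1 := bounded_L1 mu bounded_step.
have b2 := bounded_L1 mu (bounded_le_indicator (y0 / 2)).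
have b3 := bounded_L1 mu bounded_initial.
rewrite integral_initial -{1}integral_step -(@leb01_le (y0 / 2)); last first.
  by apply/andP; split; lra.
rewrite -RintB// -RintZl; last exact: L1B.
apply: Rint_le => //; first by apply: L1Zl; exact: L1B.
move=> y; rewrite /step /initial; case: (ltP y y0) => yy0 /=; last first.
  by rewrite sub0r mulrN oppr_le0 mulr_ge0// ltW.
case: (leP y (y0 / 2)) => yy2 /=; first by rewrite subrr mulr0 exp_quantile_ge0.
rewrite subr0 mulr1 /E (leNgt y) (lt_trans y2 yy2)/= /c ler_expR.
apply: quantile_homo; first by apply/andP; split; lra.
  by apply/andP; split; lra.
exact: ltW.
Qed.

End quantile_integral.

End quantile_excess.

(** * Counting eigenvalues through their excess *)

Section excess_of_spectrum.
Context {R : realType}.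

Lemma le_big_uniq (T : eqType) (s t : seq T) (g : T -> R) : uniq s -> uniq t ->
  (forall p, 0 <= g p) -> (forall p, p \in s -> p \notin t -> g p = 0) ->
  \sum_(p <- s) g p <= \sum_(p <- t) g p.
Proof.
move=> us ut g0 gst.
rewrite (bigID (mem t))/= [X in _ + X]big1_seq ?addr0; last first.
  by move=> p /andP[pt ps]; exact: gst.
rewrite -big_filter (perm_big [seq p <- t | p \in s])/=; last first.
  apply: uniq_perm; rewrite ?filter_uniq// => p.
  by rewrite !mem_filter andbC.
rewrite big_filter [leRHS](bigID (mem s))/= lerDl.
exact: sumr_ge0.
Qed.

Variable mu : nat -> nat -> R.
Hypothesis mu_ge0 : forall j k, 0 <= mu j k.
Hypothesis mu_cvg : forall j, cvgn (series (mu j)).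

(** The integral of [f] against the measure that puts the mass [mu j k] at the
    point [mu j k] for every [k].  Zero masses do not see the value of [f]
    at 0. *)
Definition mass_sum j (f : R -> R) : R := limn (series (fun k => mu j k * f (mu j k))).

Let fle (f g : R -> R) := forall m : R, 0 < m -> f m <= g m.

Let term_le f g j k : fle f g -> mu j k * f (mu j k) <= mu j k * g (mu j k).
Proof.
move=> fg; have [m0|m0] := ltP 0 (mu j k); first by rewrite ler_pM2l// fg.
by rewrite (_ : mu j k = 0) ?mul0r//; apply/eqP; rewrite eq_le m0 mu_ge0.
Qed.

Let term_ge0 f j k : fle (cst 0) f -> 0 <= mu j k * f (mu j k).
Proof. by move=> /(@term_le (cst 0) f j k); rewrite mulr0. Qed.

Lemma mass_sum_cvg j (f : R -> R) (C : R) : (forall m, 0 < m -> 0 <= f m <= C) ->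
  series (fun k => mu j k * f (mu j k)) @ \oo --> mass_sum j f.
Proof.
move=> f0C; have f0 : fle (cst 0) f by move=> m /f0C/andP[].
apply: (@series_le_cvg _ _ (fun k => `|C| *: mu j k)).
- by move=> k; exact: term_ge0.
- by move=> k; rewrite mulr_ge0.
- move=> k; rewrite /GRing.scale/= [leRHS]mulrC.
  apply: (@term_le f (cst `|C|)) => m /f0C/andP[_ fC].
  exact: le_trans (ler_norm _).
- exact: is_cvg_seriesZ.
Qed.

Lemma mass_sum_ge j (f : R -> R) (C : R) N : (forall m, 0 < m -> 0 <= f m <= C) ->
  \sum_(k < N) mu j k * f (mu j k) <= mass_sum j f.
Proof.
move=> f0C; have h := @mass_sum_cvg j f C f0C.
apply: (cvgr_to_ge h); exists N => // n /= Nn; rewrite /series/=.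
rewrite -(big_mkord predT (fun k => mu j k * f (mu j k))) [leRHS](big_cat_nat (leq0n _) Nn)/=.
rewrite lerDl sumr_ge0// => k _; apply: term_ge0 => m /f0C.
by case/andP.
Qed.

Lemma mass_sum_le j (f g : R -> R) (C : R) : fle (cst 0) f -> fle f g ->
  (forall m, 0 < m -> g m <= C) -> mass_sum j f <= mass_sum j g.
Proof.
move=> f0 fg gC.
have cf := @mass_sum_cvg j f C; have cg := @mass_sum_cvg j g C.
apply: lim_series_le.
- by apply: cvgP (cf _) => m m0; rewrite f0//= (le_trans (fg _ _))// gC.
- by apply: cvgP (cg _) => m m0; rewrite gC// (le_trans _ (fg _ _))// f0.
- by move=> k; exact: term_le.
Qed.

Lemma mass_sum1 j : mass_sum j (cst 1) = limn (series (mu j)).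
Proof.
by rewrite /mass_sum; congr (limn (series _)); apply/funext => k; rewrite mulr1.
Qed.

Lemma mass_sum_lin j (h : R) N (f : nat -> R -> R) C :
  (forall i m, 0 < m -> 0 <= f i m <= C) ->
  mass_sum j (fun m => h * \sum_(i < N) f i m) = h * \sum_(i < N) mass_sum j (f i).
Proof.
move=> fC; apply/(cvg_lim (@Rhausdorff R)).
have -> : series (fun k => mu j k * (h * \sum_(i < N) f i (mu j k))) =
    (fun n => h * \sum_(i < N) series (fun k => mu j k * f i (mu j k)) n).
  apply/funext => n; rewrite /series/= exchange_big/= mulr_sumr.
  by apply: eq_bigr => k _; rewrite -mulr_sumr mulrCA.
apply: cvgM; first exact: cvg_cst.
by apply: cvg_finite_sum => i; exact: (@mass_sum_cvg _ _ C (fC i)).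
Qed.

Variables (d : nat) (a y : R) (n : nat).
Local Notation S := (\sum_(j < d) limn (series (mu j))).
Local Notation c := (expR (- a)).
Hypothesis S_gt0 : 0 < S.

(** The next two functions describe the probability measure that puts the mass
    [mu j k / S] at the point [- ln (mu j k) - a] for all [j < d] and all [k]: its
    distribution function, and the mean of [max 0 (tau - expR x)]. *)
Definition spectrum_cdf x : R :=
  (\sum_(j < d) mass_sum j (fun m => (- ln m - a <= x)%R%:R)) / S.

Definition spectrum_excess tau : R :=
  (\sum_(j < d) mass_sum j (fun m => Num.max 0 (tau - c / m))) / S.

Let ind01 x m : 0 < m -> 0 <= ((- ln m - a <= x)%R%:R : R) <= 1.
Proof. by rewrite ler0n lern1 leq_b1. Qed.

Let excess01 tau m : 0 <= tau -> 0 < m -> 0 <= Num.max 0 (tau - c / m) <= tau.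
Proof.
move=> tau0 m0; rewrite le_max lexx/= ge_max tau0/= gerBl.
by rewrite divr_ge0 ?expR_ge0// ltW.
Qed.

Let threshold t m : 0 < m -> 0 < t -> (- ln m - a <= ln t) = (c / m <= t).
Proof.
move=> m0 t0; rewrite -[LHS]ler_expR (@lnK _ t) ?posrE//; congr (_ <= _).
by rewrite addrC expRD [expR (- ln m)]expRN lnK ?posrE.
Qed.

Lemma spectrum_excess_riemann_le h N : 0 < h ->
  spectrum_excess (h * N%:R) <= h * \sum_(i < N) spectrum_cdf (ln (h * i.+1%:R)).
Proof.
move=> h0; rewrite /spectrum_excess /spectrum_cdf -mulr_suml mulrA.
rewrite ler_wpM2r ?invr_ge0 ?(ltW S_gt0)// exchange_big/= mulr_sumr.
apply: ler_sum => j _.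
rewrite -(@mass_sum_lin _ h N (fun i m => (- ln m - a <= ln (h * i.+1%:R))%R%:R) 1); last first.
  by move=> i m m0; exact: ind01.
apply: (@mass_sum_le _ _ _ (h * N%:R)).
- by move=> m m0; rewrite le_max lexx.
- move=> m m0; under eq_bigr do rewrite threshold ?mulr_gt0//.
  by apply: excess_riemann_le; rewrite ?divr_ge0 ?expR_ge0// ltW.
- move=> m m0; rewrite ler_pM2l// -[leRHS]mulr1 -[in leRHS](card_ord N) -sum1_card.
  rewrite natr_sum mulr1; apply: ler_sum => i _.
  by have /andP[] := ind01 (ln (h * i.+1%:R)) m0.
Qed.

Lemma spectrum_excess_riemann_ge h N : 0 < h ->
  h * \sum_(i < N) spectrum_cdf (ln (h * i.+1%:R)) <= spectrum_excess (h * N.+1%:R).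
Proof.
move=> h0; rewrite /spectrum_excess /spectrum_cdf -mulr_suml mulrA.
rewrite ler_wpM2r ?invr_ge0 ?(ltW S_gt0)// exchange_big/= mulr_sumr.
apply: ler_sum => j _.
rewrite -(@mass_sum_lin _ h N (fun i m => (- ln m - a <= ln (h * i.+1%:R))%R%:R) 1); last first.
  by move=> i m m0; exact: ind01.
have t0 : 0 <= h * N.+1%:R by rewrite mulr_ge0// ltW.
apply: (@mass_sum_le _ _ _ (h * N.+1%:R)).
- by move=> m m0; rewrite mulr_ge0 ?sumr_ge0// ltW.
- move=> m m0; under eq_bigr do rewrite threshold ?mulr_gt0//.
  by apply: excess_riemann_ge; rewrite ?divr_ge0 ?expR_ge0// ltW.
- by move=> m m0; have /andP[] := excess01 t0 m0.
Qed.

Lemma spectrum_excess_ge0 tau : 0 <= tau -> 0 <= spectrum_excess tau.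
Proof.
move=> tau0; rewrite divr_ge0 ?(ltW S_gt0)// sumr_ge0// => j _.
have := @mass_sum_ge j _ _ 0 (fun m m0 => excess01 tau0 m0).
by rewrite big_ord0.
Qed.

Lemma spectrum_excess_homo tau tau' : tau <= tau' ->
  spectrum_excess tau <= spectrum_excess tau'.
Proof.
move=> tt; rewrite /spectrum_excess ler_wpM2r ?invr_ge0 ?(ltW S_gt0)//.
apply: ler_sum => j _; apply: (@mass_sum_le _ _ _ (Num.max 0 tau')).
- by move=> m _; rewrite le_max lexx.
- by move=> m _; rewrite le_max2// lerB.
- by move=> m m0; rewrite le_max2// gerBl divr_ge0 ?expR_ge0// ltW.
Qed.

Let excess_term tau m : 0 < tau -> 0 <= m ->
  m * Num.max 0 (tau - c / m) = tau * Num.max 0 (m - c / tau).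
Proof.
move=> tau0; rewrite le_eqVlt => /orP[/eqP <-|m0].
  by rewrite mul0r max_l ?mulr0// sub0r oppr_le0 divr_ge0 ?expR_ge0// ltW.
rewrite !maxr_pMr ?(ltW tau0) ?(ltW m0)// !mulr0 !mulrBr.
have V x : 0 < x -> x * (c / x) = c by move=> x0; rewrite mulrCA divff ?mulr1// gt_eqF.
by rewrite !V// [m * tau]mulrC.
Qed.

(** The hypothesis at the level [theta = c / tau], multiplied by [tau / S]. *)
Lemma spectrum_excess_lower (tau : R) : 0 < tau ->
  (forall theta H, 0 < theta ->
    (forall N, \sum_(j < d) \sum_(k < N) Num.max 0 (mu j k - theta) <= H) ->
    y * S <= H + theta * n%:R) ->
  tau * y - spectrum_excess tau <= n%:R * c / S.
Proof.
move=> tau0 lo; have c0 : 0 < c by exact: expR_gt0.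
have := lo (c / tau) (S * spectrum_excess tau / tau) (divr_gt0 c0 tau0).
have SE : S * spectrum_excess tau =
    \sum_(j < d) mass_sum j (fun m => Num.max 0 (tau - c / m)).
  by rewrite /spectrum_excess mulrC divfK// gt_eqF.
move=> H; have {}H : y * S <= S * spectrum_excess tau / tau + c / tau * n%:R.
  apply: H => N; rewrite ler_pdivlMr// SE mulr_suml; apply: ler_sum => j _.
  apply: le_trans (@mass_sum_ge j _ _ N (fun m m0 => excess01 (ltW tau0) m0)).
  rewrite mulr_suml; apply: ler_sum => k _.
  by rewrite excess_term// mulrC.
rewrite ler_pdivlMr// mulrBl lerBlDr -mulrA.
have : tau * (y * S) <= tau * (S * spectrum_excess tau / tau + c / tau * n%:R).
  by rewrite ler_pM2l.
have -> : tau * (S * spectrum_excess tau / tau + c / tau * n%:R) =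
    S * spectrum_excess tau + c * n%:R by field; rewrite gt_eqF.
by rewrite addrC [c * _]mulrC [S * _]mulrC.
Qed.

(** Greedy choice.  Take the masses in decreasing order until their sum reaches
    [y * S]; all but the last one sum up to less.  If [theta] is the last one, the
    masses above [theta] are among those taken, so that their total excess over
    [theta] determines the number of masses taken. *)
Lemma spectrum_excess_upper (M : R) : 0 < M -> 0 < y -> y <= spectrum_cdf (ln M) ->
  (forall s : seq ('I_d * nat), uniq s -> y * S <= \sum_(p <- s) mu p.1 p.2 ->
    (n <= (size s).+1)%N) ->
  exists tau, [/\ 0 < tau <= M, exists p : 'I_d * nat, c <= M * mu p.1 p.2 &
    n%:R * c / S <= 2 * c / S + (tau * y - spectrum_excess tau)].
Proof.
move=> M0 y0 yM up; have c0 : 0 < c by exact: expR_gt0.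
have cM : 0 < c / M by exact: divr_gt0.
have [K KP] : exists K, forall j : 'I_d, forall k, (K <= k)%N -> mu j k < c / M.
  have : \forall k \near \oo, forall i, (i <= d)%N -> mu i k < c / M.
    apply: near_forall_ord => i; have := cvg_series_cvg_0 (@mu_cvg i).
    move=> /cvgr0_norm_lt /(_ _ cM); apply: filterS => k.
    exact: le_lt_trans (ler_norm _).
  by move=> [K _ KP]; exists K => j k Kk; apply: (KP k Kk j); exact: ltnW.
pose v (p : 'I_d * nat) := mu p.1 p.2.
pose box N : seq ('I_d * nat) := [seq (j, k) | j <- enum 'I_d, k <- iota 0 N].
have ubox N : uniq (box N).
  apply: allpairs_uniq; [exact: enum_uniq|exact: iota_uniq|].
  by move=> [j k] [j' k'] _ _ /= [-> ->].
have sbox N (g : 'I_d * nat -> R) :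
    \sum_(p <- box N) g p = \sum_(j < d) \sum_(k < N) g (j, k : nat).
  rewrite big_allpairs_dep/= big_enum/=; apply: eq_bigr => j _.
  by rewrite -[in iota 0 N](subn0 N) -/(index_iota 0 N) big_mkord.
pose L := [seq p <- box K | c / M <= v p].
have mL p : c / M <= v p -> p \in L.
  case: p => j k vp; rewrite mem_filter vp/=; apply/allpairsP; exists (j, k).
  rewrite mem_enum mem_iota/= add0n; split=> //.
  by rewrite ltnNge; apply/negP => /(KP j); rewrite ltNge vp.
have sumL : y * S <= \sum_(p <- L) v p.
  apply: (@le_trans _ _ (spectrum_cdf (ln M) * S)); first by rewrite ler_pM2r.
  rewrite /spectrum_cdf divfK ?gt_eqF// /L [leRHS]big_filter [leRHS]big_mkcond sbox.
  apply: ler_sum => j _.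
  have h := @mass_sum_cvg j _ 1 (fun m => @ind01 (ln M) m).
  apply: (cvgr_to_le h); exists K => // N /= KN.
  rewrite /series/= (big_cat_nat (leq0n _) KN)/= big_mkord.
  rewrite [X in _ + X]big1_seq ?addr0.
    apply: ler_sum => k _; have [m0|m0] := ltP 0 (mu j k); last first.
      rewrite (_ : mu j k = 0) ?mul0r; last by apply/eqP; rewrite eq_le m0 mu_ge0.
      by case: ifP => _; rewrite /v/=.
    rewrite threshold// ler_pdivrMr// -ler_pdivrMl// [M^-1 * _]mulrC /v/=.
    by case: (c / M <= _); rewrite ?mulr1 ?mulr0.
  move=> k /andP[_]; rewrite mem_index_iota => /andP[Kk _].
  have := KP j k Kk; have [m0|m0] := ltP 0 (mu j k); last first.
    by rewrite (_ : mu j k = 0) ?mul0r//; apply/eqP; rewrite eq_le m0 mu_ge0.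
  rewrite threshold// ler_pdivrMr// -ler_pdivrMl// [M^-1 * _]mulrC ltNge => /negbTE ->.
  by rewrite mulr0.
pose ge_v := (fun p q => v q <= v p) : rel ('I_d * nat).
have tr : transitive ge_v by move=> q p r /= pq qr; exact: le_trans qr pq.
pose s0 := sort ge_v L.
have ss0 : sorted ge_v s0.
  by apply: sort_sorted => p q; rewrite /ge_v; exact: le_total.
have us0 : uniq s0 by rewrite sort_uniq filter_uniq.
have ms0 p : (p \in s0) = (p \in L) by rewrite mem_sort.
have ex : exists i, y * S <= \sum_(p <- take i s0) v p.
  exists (size s0); rewrite take_size (perm_big L)//.
  by rewrite perm_sort.
case: (ex_minnP ex) => -[|i] yi imin.
  by move: yi; rewrite take0 big_nil leNgt mulr_gt0.
have isz : (i < size s0)%N.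
  rewrite ltnNge; apply/negP => si.
  have := imin i; rewrite (take_oversize si) ltnn => H.
  by move: yi; rewrite take_oversize ?(leqW si)// => /H.
have yi' : \sum_(p <- take i s0) v p < y * S.
  by rewrite ltNge; apply/negP => /imin; rewrite ltnn.
have [p0 _] : exists p : 'I_d * nat, p \in s0.
  by case: (s0) isz => // p s _; exists p; rewrite mem_head.
pose x := nth p0 s0 i; have xs0 : x \in s0 by exact: mem_nth.
have vx : c / M <= v x by move: xs0; rewrite ms0 mem_filter => /andP[].
have vx0 : 0 < v x by exact: lt_le_trans vx.
have rf : reflexive ge_v by move=> p; exact: lexx.
have take_mem p : v x < v p -> p \in take i s0.
  move=> xp; have pL : p \in s0 by rewrite ms0 mL// (le_trans vx)// ltW.
  rewrite in_take// ltnNge; apply/negP => ip.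
  have := sorted_leq_nth tr rf p0 ss0 i (index p s0).
  rewrite !inE index_mem isz pL => /(_ isT isT ip).
  by rewrite /ge_v nth_index// -/x leNgt xp.
have take_ge p : p \in take i s0 -> v x <= v p.
  move=> pt; have ps : p \in s0 by exact: mem_take pt.
  have ip : (index p s0 < i)%N by rewrite -in_take.
  have := sorted_leq_nth tr rf p0 ss0 (index p s0) i.
  rewrite !inE index_mem isz ps => /(_ isT isT (ltnW ip)).
  by rewrite /ge_v nth_index.
pose tau := c / v x; have tau0 : 0 < tau by exact: divr_gt0.
have ctau : c / tau = v x by rewrite /tau invf_div mulrC divfK// gt_eqF.
exists tau; split.
- by rewrite tau0/= ler_pdivrMr// mulrC -ler_pdivrMr.
- by exists x; rewrite mulrC -ler_pdivrMr.
have SE : S * spectrum_excess tau =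
    \sum_(j < d) mass_sum j (fun m => Num.max 0 (tau - c / m)).
  by rewrite /spectrum_excess mulrC divfK// gt_eqF.
have ub : S * spectrum_excess tau <= tau * (\sum_(p <- take i s0) (v p - v x)).
  rewrite SE.
  have h : (fun N => \sum_(j < d) series (fun k => mu j k *
      Num.max 0 (tau - c / mu j k)) N) @ \oo -->
      \sum_(j < d) mass_sum j (fun m => Num.max 0 (tau - c / m)).
    apply: cvg_finite_sum => j.
    exact: (@mass_sum_cvg j _ _ (fun m m0 => excess01 (ltW tau0) m0)).
  apply: (cvgr_to_le h); apply: nearW => N.
  rewrite /series/= (eq_bigr (fun j : 'I_d => tau * \sum_(k < N) Num.max 0 (v (j, k : nat) - v x))).
    rewrite -mulr_sumr ler_pM2l// -(sbox N (fun p => Num.max 0 (v p - v x))).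
    rewrite [leRHS](eq_big_seq (fun p => Num.max 0 (v p - v x))); last first.
      by move=> p /take_ge xp; rewrite max_r// subr_ge0.
    apply: le_big_uniq => //; first exact: take_uniq.
      by move=> p; rewrite le_max lexx.
    move=> p _ pt; rewrite max_l// subr_le0 leNgt; apply/negP => /take_mem.
    by rewrite (negbTE pt).
  move=> j _; rewrite big_mkord mulr_sumr; apply: eq_bigr => k _.
  by rewrite excess_term// ctau.
have ni : n%:R <= i%:R + 2 :> R.
  have := up (take i.+1 s0) (take_uniq _ us0) yi; rewrite size_takel//.
  by rewrite -(ler_nat R) -natr1 -natr1 -addrA.
have ci : tau * (v x *+ i) = c * i%:R by rewrite [LHS]mulrnAr (_ : tau * v x = c) ?mulr_natr// /tau divfK// gt_eqF.
move: ub; rewrite sumrB big_const_seq count_predT size_takel ?(ltnW isz)//.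
rewrite iter_addr_0 mulrBr ci => ub.
have ub2 : c * i%:R <= tau * (y * S) - S * spectrum_excess tau.
  have : tau * \sum_(p <- take i s0) v p <= tau * (y * S).
    by rewrite ler_pM2l// ltW.
  by move: ub; lra.
have : n%:R * c <= (i%:R + 2) * c by rewrite ler_pM2r.
move=> nc; rewrite ler_pdivrMr// mulrDl divfK ?gt_eqF//.
by move: nc ub2; lra.
Qed.

End excess_of_spectrum.

(** * Growth of the number of eigenvalues *)

Section growth_of_threshold.
Context {R : realType}.
Variables (mu : nat -> nat -> R) (U W : cumulativeBounded (0 : R) (1 : R)).
Variables (l a : nat -> R) (s : R) (n : nat -> nat) (y : nat -> R) (y0 : R).

Local Notation Lam := (fun j => limn (series (mu j))).
Local Notation S := (fun d => \sum_(j < d) limn (series (mu j))).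
Local Notation c := (fun d => expR (- a d)).
Local Notation F := (signed_convolution U W s).

Hypothesis mu_ge0 : forall j k, 0 <= mu j k.
Hypothesis mu_noninc : forall j, nonincreasing_seq (mu j).
Hypothesis mu_cvg : forall j, cvgn (series (mu j)).
Hypothesis top_small : forall e, 0 < e -> \forall d \near \oo,
  forall j, (j < d)%N -> mu j 0%N <= e * S d.
Hypothesis Lam_gt0 : \forall j \near \oo, 0 < Lam j.
Hypothesis Ucvg : forall x, {for x, continuous U} ->
  (fun j => (Lam j)^-1 * mass_sum mu j (fun m => (- ln m - l j <= x)%R%:R)) @ \oo --> U x.
Hypothesis sE : s = 1 \/ s = -1.
Hypothesis Wcvg : forall x, {for x, continuous W} ->
  (fun d => average Lam d (fun j => (s * (l j - a d) <= x)%R%:R)) @ \oo --> W x.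
Hypothesis y01 : 0 < y0 < 1.
Hypothesis ycvg : y @ \oo --> y0.
Hypothesis n_lower : \forall d \near \oo, forall theta H, 0 < theta ->
  (forall N, \sum_(j < d) \sum_(k < N) Num.max 0 (mu j k - theta) <= H) ->
  y d * S d <= H + theta * (n d)%:R.
Hypothesis n_upper : \forall d \near \oo, forall r : seq ('I_d * nat), uniq r ->
  y d * S d <= \sum_(p <- r) mu p.1 p.2 -> (n d <= (size r).+1)%N.

Let Lam_ge0 j : 0 <= Lam j.
Proof.
rewrite /= -(@mass_sum1 R mu).
have := @mass_sum_ge R mu mu_ge0 mu_cvg j (cst 1) 1 0.
by rewrite big_ord0; apply => m _; rewrite ler01 lexx.
Qed.

(** Otherwise the largest mass of a single index would not be negligible. *)
Let S_oo : S @ \oo --> +oo.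
Proof.
have [J _ /(_ J (leqnn J)) LJ] := Lam_gt0.
have mJ : 0 < mu J 0%N.
  rewrite lt_neqAle mu_ge0 andbT eq_sym; apply/eqP => m0.
  suff E : mu J = cst 0.
    move: LJ; rewrite /= E (_ : series _ = cst 0) ?lim_cst ?ltxx//.
    by apply/funext => N; rewrite /series/= big1.
  apply/funext => k; apply/eqP; rewrite eq_le mu_ge0 andbT -m0.
  exact: mu_noninc.
apply/cvgryPge => A.
have e0 : 0 < mu J 0%N / (`|A| + 1) by rewrite divr_gt0// ltr_wpDl.
apply: filterS2 (top_small e0) (nbhs_infty_gt J) => d /(_ J) top Jd.
have := top Jd; rewrite mulrAC -mulrA ler_pMr// ler_pdivlMr ?mul1r; last by rewrite ltr_wpDl.
by have := ler_norm A; lra.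
Qed.

Let S_gt0 : \forall d \near \oo, 0 < S d.
Proof. by have /cvgryPgt/(_ 0) := S_oo. Qed.

Let cdf_close del : 0 < del -> \forall d \near \oo, forall x,
  F (x - del) - del <= spectrum_cdf mu d (a d) x <= F (x + del) + del.
Proof.
move=> del0.
pose Uj j x := (Lam j)^-1 * mass_sum mu j (fun m => (- ln m - l j <= x)%R%:R).
have ind01 j x (m : R) : 0 < m -> 0 <= ((- ln m - l j <= x)%R%:R : R) <= 1.
  by rewrite ler0n lern1 leq_b1.
have ms_le j x : mass_sum mu j (fun m => (- ln m - l j <= x)%R%:R) <= Lam j.
  rewrite /= -(@mass_sum1 R mu); apply: (@mass_sum_le _ _ mu_ge0 mu_cvg _ _ _ 1).
  - by move=> m m0; rewrite ler0n.
  - by move=> m m0; rewrite lern1 leq_b1.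
  - by [].
have ms_ge j x : 0 <= mass_sum mu j (fun m => (- ln m - l j <= x)%R%:R).
  have := @mass_sum_ge R mu mu_ge0 mu_cvg j _ _ 0 (fun m => @ind01 j x m).
  by rewrite big_ord0.
have := @mixture_sandwich R U W s sE Lam (fun j d => s * (l j - a d)) Lam_ge0 S_oo Wcvg Uj.
move=> /(_ _ _ Ucvg _ del0); rewrite /Uj => H.
have {}H : \forall d \near \oo, forall x, F (x - del) - del <=
    average Lam d (fun j => Uj j (x - s * (s * (l j - a d)))) <= F (x + del) + del.
  apply: H.
    move=> j x x' xx'; rewrite ler_wpM2l ?invr_ge0//.
    apply: (@mass_sum_le _ _ mu_ge0 mu_cvg _ _ _ 1).
    - by move=> m m0; rewrite ler0n.
    - move=> m m0; rewrite ler_nat; case: (leP (- ln m - l j) x) => //= h.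
      by rewrite (le_trans h xx').
    - by move=> m m0; rewrite lern1 leq_b1.
  move=> j x; rewrite mulr_ge0 ?invr_ge0//=.
  have [L0|L0] := ltP 0 (Lam j); first by rewrite ler_pdivrMl// mulr1.
  by rewrite (_ : Lam j = 0) ?invr0 ?mul0r//; apply/eqP; rewrite eq_le L0 Lam_ge0.
apply: filterS H => d H x; suff <- : average Lam d (fun j => Uj j (x - s * (s * (l j - a d)))) =
    spectrum_cdf mu d (a d) x by exact: H.
rewrite /average /spectrum_cdf; congr (_ / _); apply: eq_bigr => j _.
have -> : x - s * (s * (l j - a d)) = x - (l j - a d).
  by rewrite mulrA (_ : s * s = 1) ?mul1r//; case: sE => ->; rewrite ?mulrNN mulr1.
have -> : mass_sum mu j (fun m => (- ln m - a d <= x)%R%:R) =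
    mass_sum mu j (fun m => (- ln m - l j <= x - (l j - a d))%R%:R).
  congr mass_sum; apply/funext => m; congr (nat_of_bool _)%:R.
  by rewrite -[RHS](lerD2r (l j - a d)) subrK addrA subrK.
have [L0|L0] := ltP 0 (Lam j); first by rewrite /Uj mulrA divff ?mul1r// gt_eqF.
have L00 : Lam j = 0 by apply/eqP; rewrite eq_le L0 Lam_ge0.
rewrite {1}L00 mul0r; apply/eqP; rewrite eq_le ms_ge/= -L00.
exact: ms_le.
Qed.

Let F_le := @signed_convolution_le R U W s.
Let F_01 := @signed_convolution01 R U W s.
Let F_lo := @signed_convolution_lo R U W s sE.
Let F_hi := @signed_convolution_hi R U W s sE.

Let excess_close tau e : 0 < tau -> 0 < e -> \forall d \near \oo,
  `|spectrum_excess mu d (a d) tau - mean_excess F tau| <= e.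
Proof.
move=> tau0 e0; pose del := Num.min 2^-1 (e / (5 * tau)).
have t5 : 0 < 5 * tau by rewrite mulr_gt0.
have del0 : 0 < del by rewrite lt_min invr_gt0 ltr0n/= divr_gt0.
have tdel : 5 * tau * del <= e.
  by rewrite mulrC -ler_pdivlMr// ge_min lexx orbT.
apply: filterS2 S_gt0 (cdf_close del0) => d Sd close; apply: le_trans tdel.
apply: (@mean_excess_close _ F F_le F_01 F_lo F_hi _ (spectrum_cdf mu d (a d))) => //.
- by move=> h N; exact: spectrum_excess_riemann_le.
- by move=> h N; exact: spectrum_excess_riemann_ge.
- by rewrite del0 ge_min lexx.
Qed.

Local Notation I :=
  (\int[lebesgue_measure]_(t in `]0, y0[) expR (quantile F t)).

Let y_close e : 0 < e -> \forall d \near \oo, `|y d - y0| <= e.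
Proof. by move=> e0; move: ycvg => /cvgrPdist_le/(_ e e0); apply: filterS => d; rewrite distrC. Qed.

(** Evaluate the lower bound at the level that attains the conjugate. *)
Let lower e : 0 < e -> \forall d \near \oo, I - e <= (n d)%:R * c d / S d.
Proof.
move=> e0; pose tau := expR (quantile F y0); have tau0 : 0 < tau by exact: expR_gt0.
have e2 : 0 < e / 2 by rewrite divr_gt0.
have e3 : 0 < e / (2 * tau) by rewrite divr_gt0// mulr_gt0.
have IE := @excess_conjugate_eq R F F_le F_lo F_hi y0 y01.
near=> d.
have Sd : 0 < S d by near: d.
have := @spectrum_excess_lower R mu mu_ge0 mu_cvg d (a d) (y d) (n d) Sd tau tau0.
have nl : forall theta H, 0 < theta ->
  (forall N, \sum_(j < d) \sum_(k < N) Num.max 0 (mu j k - theta) <= H) ->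
  y d * S d <= H + theta * (n d)%:R by near: d.
move=> /(_ nl); apply: le_trans.
have : `|spectrum_excess mu d (a d) tau - mean_excess F tau| <= e / 2.
  by near: d; exact: excess_close.
have : `|y d - y0| <= e / (2 * tau) by near: d; exact: y_close.
rewrite !ler_distl => /andP[h1 _] /andP[_ h2].
have : tau * (y0 - e / (2 * tau)) <= tau * y d by rewrite ler_pM2l.
have -> : tau * (y0 - e / (2 * tau)) = tau * y0 - e / 2 by field; rewrite gt_eqF.
by rewrite -IE -/tau; lra.
Unshelve. all: by end_near. Qed.

(** The level of the greedy choice depends on [d], but stays below a fixed [M]; on
    a finite grid of levels the excesses converge, and monotonicity interpolates
    between neighbours of the grid. *)
Let upper e : 0 < e -> \forall d \near \oo, (n d)%:R * c d / S d <= I + e.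
Proof.
move=> e0; have /andP[y0_gt0 y0_lt1] := y01.
have arith1 u : y0 - y0 / 2 <= u -> 0 < u by lra.
have arith2 u : u <= y0 + (1 - y0) / 3 -> u <= 1 by lra.
have arith3 u f : u <= y0 + (1 - y0) / 3 -> 1 - (1 - y0) / 3 < f ->
  u <= f - (1 - y0) / 3 by lra.
have arith4 u v : u <= e / 8 * v -> 2 * u <= e / 4 * v by lra.
have arith5 p q C Ht Hti i : p <= e / 4 -> q <= C -> C <= e / 8 -> 0 <= Hti ->
  Hti <= Ht -> 0 < i -> p + (q - Ht) <= i + e by lra.
have arith6 p q A C Ht Hti Hm D u i : p <= e / 4 -> q <= A -> A = D * u + C ->
  C <= e / 8 -> Hti <= Ht -> Hm - e / 8 <= Hti -> D * y0 - Hm <= i ->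
  D * (u - y0) <= e / 8 -> p + (q - Ht) <= i + e by lra.
pose del := (1 - y0) / 3; have del0 : 0 < del by rewrite divr_gt0// subr_gt0.
have [x0 Fx0] := F_hi del0.
(* the masses at levels up to M carry a share of at least y0 + del *)
pose M := expR (x0 + del); have M0 : 0 < M by exact: expR_gt0.
have e8 : 0 < e / 8 by rewrite divr_gt0.
pose N := (Num.truncn (M / (e / 8))).+1.
have N0 : 0 < N%:R :> R by rewrite ltr0n.
pose h := M / N%:R; have h0 : 0 < h by rewrite divr_gt0.
have he : h <= e / 8.
  rewrite /h ler_pdivrMr// -ler_pdivrMl// mulrC; exact/ltW/truncnS_gt.
have hN : h * N%:R = M by rewrite divfK// gt_eqF.
have IP := @excess_conjugate_le R F F_le F_lo F_hi y0 y01.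
have I0 := @integral_exp_quantile_gt0 R F F_le F_lo F_hi y0 y01.
near=> d.
have Sd : 0 < S d by near: d.
have yd : `|y d - y0| <= Num.min (Num.min del (y0 / 2)) (e / 8 / M).
  near: d; apply: y_close; rewrite !lt_min del0 !divr_gt0//.
move: yd; rewrite !le_min => /andP[/andP[yd1 yd2] yd3].
have yd_gt0 : 0 < y d.
  by move: yd2; rewrite ler_distl => /andP[/arith1].
have yd_lt1 : y d <= 1.
  by move: yd1; rewrite ler_distl => /andP[_ /arith2].
have grid : forall i, (i <= N)%N -> (0 < i)%N ->
    `|spectrum_excess mu d (a d) (h * i%:R) - mean_excess F (h * i%:R)| <= e / 8.
  near: d; apply: near_forall_ord => i; have [->|i0] := posnP i; first exact: nearW.
  by apply: filterS (@excess_close (h * i%:R) (e / 8) _ e8) => //; rewrite mulr_gt0// ltr0n.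
have grid0 : 0 <= spectrum_excess mu d (a d) (h * 0%:R).
  by apply: spectrum_excess_ge0; rewrite ?mulr0.
have yF : y d <= spectrum_cdf mu d (a d) (ln M).
  have close : forall x, F (x - del) - del <= spectrum_cdf mu d (a d) x <= F (x + del) + del.
    by near: d; exact: cdf_close.
  have /andP[h1 _] := close (ln M); apply: le_trans h1.
  rewrite /M expRK addrK; move: yd1; rewrite ler_distl => /andP[_ h1].
  exact: arith3.
have nu : forall r : seq ('I_d * nat), uniq r ->
  y d * S d <= \sum_(p <- r) mu p.1 p.2 -> (n d <= (size r).+1)%N by near: d.
have top : forall j, (j < d)%N -> mu j 0%N <= e / 8 / M * S d.
  by near: d; apply: top_small; rewrite !divr_gt0.
have [tau [/andP[tau0 tauM] [p cp] ub]] :=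
  @spectrum_excess_upper R mu mu_ge0 mu_cvg d (a d) (y d) (n d) Sd M M0 yd_gt0 yF nu.
(* the greedy choice is off by at most two masses, each negligible *)
have cS : 2 * c d / S d <= e / 4.
  have : c d <= M * (e / 8 / M * S d).
    apply: (le_trans cp); rewrite ler_pM2l//; apply: le_trans (top _ (ltn_ord p.1)).
    exact: mu_noninc.
  have -> : M * (e / 8 / M * S d) = e / 8 * S d by field; rewrite gt_eqF.
  by rewrite ler_pdivrMr//; exact: arith4.
have [i [iN ti ti']] : exists i, [/\ (i < N)%N, h * i%:R <= tau & tau <= h * i.+1%:R].
  have ex : exists i, tau <= h * i.+1%:R by exists N.-1; rewrite hN.
  case: (ex_minnP ex) => i ti imin; exists i; split=> //.
    by have := imin N.-1; rewrite hN => /(_ tauM); rewrite /N/=.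
  case: i ti imin => [|i] ti imin; first by rewrite mulr0 ltW.
  by apply: ltW; rewrite ltNge; apply/negP => /imin; rewrite ltnn.
apply: (le_trans ub).
have b1 : tau * y d <= h * i.+1%:R * y d by rewrite ler_pM2r.
have b2 := @spectrum_excess_homo R mu mu_ge0 mu_cvg d (a d) Sd _ _ ti.
have b3 : h * y d <= e / 8 by rewrite (le_trans _ he)// ger_pMr.
have b4 : h * i.+1%:R * y d = h * i%:R * y d + h * y d by rewrite -natr1 mulrDr mulrDl mulr1.
case: (posnP i) => [i0|i0].
  rewrite i0 in b1 b2; rewrite mulr1 in b1.
  exact: (arith5 _ _ _ _ _ _ cS b1 b3 grid0 b2 I0).
have := grid i (ltnW iN) i0; rewrite ler_distl => /andP[b5 _].
have hi0 : 0 < h * i%:R by rewrite mulr_gt0// ltr0n.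
have b6 := IP _ (ltW hi0).
have b7 : h * i%:R * (y d - y0) <= e / 8.
  apply: (@le_trans _ _ (M * (e / 8 / M))); last by rewrite mulrC divfK// gt_eqF.
  apply: (@le_trans _ _ (h * i%:R * (e / 8 / M))).
    by rewrite ler_pM2l// (le_trans (ler_norm _)).
  by rewrite ler_pM2r ?divr_gt0// -hN ler_pM2l// ler_nat ltnW.
exact: (arith6 _ _ _ _ _ _ _ _ _ _ cS b1 b4 b3 b2 b5 b6 b7).
Unshelve. all: by end_near. Qed.

Lemma threshold_growth :
  (fun d => (n d)%:R / (expR (a d) * S d * I)) @ \oo --> (1 : R).
Proof.
have I0 := @integral_exp_quantile_gt0 R F F_le F_lo F_hi y0 y01.
apply/cvgrPdist_le => e e0.
have eI : 0 < e * I by rewrite mulr_gt0.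
apply: filterS3 S_gt0 (lower eI) (upper eI) => d Sd lo up.
have -> : (n d)%:R / (expR (a d) * S d * I) = (n d)%:R * c d / S d / I.
  by rewrite expRN !invfM !mulrA.
rewrite distrC ler_distl; apply/andP; split.
  by rewrite ler_pdivlMr//; lra.
by rewrite ler_pdivrMr//; lra.
Qed.

End growth_of_threshold.

(** * Asymptotics of the approximation complexity *)

Section spectrum_without_constant.
Context {R : realType}.

Lemma lim_bigop_shift (f g : nat -> R) : (forall k, g k.+1 = f k) -> cvgn (series f) ->
  \big[+%R/0]_(1 <= k <oo) g k = limn (series f).
Proof.
move=> gf cf; apply/(cvg_lim (@Rhausdorff R)).
rewrite -(cvg_shiftS (fun n => \sum_(1 <= k < n) g k)).
rewrite (_ : (fun n => _) = series f); first exact: cf.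
by apply/funext => n; rewrite big_add1/= /series/=; apply: eq_bigr => k _.
Qed.

Lemma series_bump (f : nat -> R) i N : (i <= N)%N ->
  series f N.+1 = f i + series (fun k => f (bump i k)) N.
Proof.
move=> iN; rewrite /series/= !big_mkord.
by rewrite (bigD1_ord (Ordinal (iN : (i < N.+1)%N))).
Qed.

Lemma cvg_series_bump (f : nat -> R) i : cvgn (series f) ->
  series (fun k => f (bump i k)) @ \oo --> limn (series f) - f i.
Proof.
move=> cf; have h : (fun N => series f N.+1 - f i) @ \oo --> limn (series f) - f i.
  apply: cvgB; last exact: cvg_cst.
  by rewrite (cvg_shiftS (series f)).
apply: cvg_trans h; apply: near_eq_cvg; exists i => // N /= iN.
by rewrite (series_bump _ iN) addrAC subrr add0r.
Qed.

End spectrum_without_constant.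

Theorem theorem2 (R : realType)
    (* the processes X_j and their covariance eigensystems *)
    (dX : nat -> measure_display) (OX : forall j, measurableType (dX j))
    (PX : forall j, probability (OX j) R) (X : forall j, R -> OX j -> R)
    (lam : nat -> nat -> R) (psi : nat -> nat -> R -> R) (k0 : nat -> nat)
    (* the random fields Y_d *)
    (dY : nat -> measure_display) (OY : forall d, measurableType (dY d))
    (PY : forall d, probability (OY d) R)
    (Y : forall d, d.-tuple R -> OY d -> R)
    (L eps0 : R) (U W : cumulativeBounded (0 : R) (1 : R))
    (l a : nat -> R) (s : R) :
  (forall j, zero_mean_on (PX j) `[0, 1] (X j)) ->
  (forall j, {within `[0, 1] `*` `[0, 1],
    continuous (fun p : R * R => covfun (PX j) (X j) p.1 p.2)}) ->
  (forall j, is_eigensystem leb01 (covfun (PX j) (X j)) (lam j) (psi j)) ->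
  (* Basic assumption *)
  (forall j, {ae leb01, forall t, psi j (k0 j) t = 1}) ->
  (forall d, (0 < d)%N ->
    [/\ measurable_fun (@cube R d `*` [set: OY d]) (fun p => Y d p.1 p.2),
        zero_mean_on (PY d) (@cube R d) (Y d) &
        forall t u, cube t -> cube u ->
          covfun (PY d) (Y d) t u =
          \sum_(i < d) covfun (PX i) (X i) (tnth t i) (tnth u i)]) ->
  (* (1) *)
  (fun d => (\sum_(j < d) bar_eig lam k0 j 0) / (\sum_(j < d) trace lam j))
    @ \oo --> L ->
  L < 1 ->
  0 < eps0 <= 1 ->
  1 - eps0 ^+ 2 = L ->
  (* (2) *)
  (fun d => \big[Num.max/0]_(j < d) bar_eig lam k0 j 1 : R^o) =o_\oo
    (fun d => \sum_(j < d) bar_trace lam k0 j : R^o) ->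
  (* (3) *)
  (\forall j \near \oo, 0 < bar_trace lam k0 j) ->
  (forall x : R, {for x, continuous U} ->
    (fun j => (bar_trace lam k0 j)^-1 *
       \big[+%R/0]_(1 <= k <oo) (bar_eig lam k0 j k *
          (- ln (bar_eig lam k0 j k) - l j <= x)%R%:R)) @ \oo --> U x) ->
  (s = 1 /\ nondecreasing_seq l) \/ (s = -1 /\ nonincreasing_seq l) ->
  (* (4) *)
  (forall x : R, {for x, continuous W} ->
    (fun d => (\sum_(j < d) bar_trace lam k0 j * (s * (l j - a d) <= x)%R%:R) /
       (\sum_(j < d) bar_trace lam k0 j)) @ \oo --> W x) ->
  forall eps : R, 0 < eps < eps0 ->
    (fun d => (complexity (PY d) (leb_cube d) (Y d) eps)%:R /
       (expR (a d) * (\sum_(j < d) bar_trace lam k0 j) *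
        \int[lebesgue_measure]_(y in `]0, 1 - (eps / eps0) ^+ 2[)
          expR (quantile (signed_convolution U W s) y))) @ \oo --> (1 : R).
Proof.
move=> X0 Xc eig basic field lim1 L1 /andP[eps0_gt0 eps0_le1] epsL small2 Lam_gt0 Ucvg sl Wcvg.
move=> eps /andP[eps_gt0 eps_lt].
pose mu j k := lam j (bump (k0 j) k).
have lam_ge0 := eigenvalue_ge0 eig.
have lam_cvg j : cvgn (series (lam j)) by apply: cvgP (@trace_cvg _ _ _ _ _ _ _ X0 Xc eig j).
have mu_ge0 j k : 0 <= mu j k by exact: lam_ge0.
have mu_lim j := @cvg_series_bump _ (lam j) (k0 j) (@lam_cvg j).
have mu_cvg j : cvgn (series (mu j)) by apply: cvgP (mu_lim j).
have mu_noninc j : nonincreasing_seq (mu j).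
  have [[ni _] _ _ _ _] := eig j; move=> k k' kk'; apply: ni.
  by rewrite leq_bump2.
have barE : bar_trace lam k0 = fun j => limn (series (mu j)).
  by apply/funext => j; apply: lim_bigop_shift.
have traceB j : trace lam j = bar_eig lam k0 j 0 + limn (series (mu j)).
  by rewrite (cvg_lim (@Rhausdorff R) (mu_lim j)) /bar_eig addrC subrK.
rewrite barE in small2 Lam_gt0 Ucvg Wcvg *.
pose S d := \sum_(j < d) limn (series (mu j)).
pose T d := \sum_(j < d) trace lam j.
pose B d := \sum_(j < d) bar_eig lam k0 j 0.
have TE d : T d = B d + S d by rewrite /T /B /S -big_split/=; apply: eq_bigr => j _.
have B_ge0 d : 0 <= B d by apply: sumr_ge0 => j _; exact: lam_ge0.
have Lam_ge0 j : 0 <= limn (series (mu j)).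
  by rewrite -mass_sum1; have := @mass_sum_ge R mu mu_ge0 mu_cvg j (cst 1) 1 0;
    rewrite big_ord0; apply => m _; rewrite ler01 lexx.
have S_gt0 : \forall d \near \oo, 0 < S d.
  have [J _ /(_ J (leqnn J)) LJ] := Lam_gt0.
  exists J.+1 => // d /= Jd; rewrite /S (bigD1 (Ordinal Jd))//=.
  by rewrite ltr_pwDl// sumr_ge0.
have eps0E : 1 - L = eps0 ^+ 2 by rewrite -epsL opprB addrC subrK.
have eps02 : 0 < eps0 ^+ 2 by rewrite exprn_gt0.
(* the share of the non-constant part of the trace that must be captured *)
pose y d := ((1 - eps ^+ 2) * T d - B d) / S d.
pose y0 := 1 - (eps / eps0) ^+ 2.
have y01 : 0 < y0 < 1.
  rewrite /y0 subr_gt0 gtrBl; apply/andP; split.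
    by rewrite expr_lt1// ?divr_ge0 ?ltr_pdivrMr ?mul1r// ltW.
  by rewrite exprn_gt0// divr_gt0.
have yS : \forall d \near \oo, y d * S d = (1 - eps ^+ 2) * T d - B d.
  by apply: filterS S_gt0 => d Sd; rewrite divfK// gt_eqF.
have ycvg : y @ \oo --> y0.
  pose b d := B d / T d.
  have bL : b @ \oo --> L by exact: lim1.
  have h : (fun d => (1 - eps ^+ 2 - b d) / (1 - b d)) @ \oo --> (1 - eps ^+ 2 - L) / (1 - L).
    apply: cvgM; first by apply: cvgB => //; exact: cvg_cst.
    apply: cvgV; first by rewrite subr_eq0 gt_eqF.
    by apply: cvgB => //; exact: cvg_cst.
  have -> : y0 = (1 - eps ^+ 2 - L) / (1 - L).
    rewrite addrAC eps0E /y0 mulrBl divff ?gt_eqF//; congr (_ - _).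
    by rewrite expr_div_n.
  apply: cvg_trans h; apply: near_eq_cvg; apply: filterS S_gt0 => d Sd.
  have Td : 0 < T d by rewrite TE ltr_wpDl.
  have E : 1 - b d = S d / T d.
    by rewrite /b -[X in X - _](divff (lt0r_neq0 Td)) -mulrBl TE addrAC subrr add0r.
  rewrite E /y /b; have := lt0r_neq0 Td; have := lt0r_neq0 Sd => h1 h2.
  by field; rewrite h1 h2.
(* the listed eigenvalues exhaust the trace, so finite ranks suffice *)
have adm : \forall d \near \oo, exists r : seq ('I_d * nat), uniq r /\
    (1 - eps ^+ 2) * T d - B d <= \sum_(p <- r) mu p.1 p.2.
  have y1 : \forall d \near \oo, y d < 1.
    by have /andP[_ y0_lt1] := y01; move: ycvg => /cvgr_lt; exact.
  apply: filterS3 S_gt0 yS y1 => d Sd <- yd.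
  have h : (fun N => \sum_(j < d) series (mu j) N) @ \oo --> S d.
    by apply: cvg_finite_sum => j; exact: mu_cvg.
  have lt : y d * S d < S d by rewrite gtr_pMl.
  have [N _ /(_ N (leqnn N)) /= lN] := cvgr_gt _ h _ lt.
  exists [seq (j, k) | j <- enum 'I_d, k <- iota 0 N]; split.
    apply: allpairs_uniq; [exact: enum_uniq|exact: iota_uniq|].
    by move=> [j k] [j' k'] _ _ /= [-> ->].
  by rewrite big_allpairs_dep/= big_enum/=; apply: ltW; move: lN;
    rewrite /series/=; under eq_bigr do rewrite /index_iota subn0.
pose n d := complexity (PY d) (leb_cube d) (Y d) eps.
have eps_ge0 := ltW eps_gt0.
apply: (@threshold_growth R mu U W l a s n y y0) => //.
- move=> e e0; move: small2 => /eqoP/(_ e e0); apply: filterS => d.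
  rewrite [X in _ <= e * X]ger0_norm ?sumr_ge0// => h j jd.
  apply: le_trans h; apply: le_trans (ler_norm _).
  exact: (le_bigmax 0 (fun i : 'I_d => bar_eig lam k0 i 1) (Ordinal jd)).
- move=> x Ux; have := Ucvg x Ux; apply: cvg_trans; apply: near_eq_cvg.
  apply: nearW => j; congr (_ * _); apply: lim_bigop_shift => //.
  apply: cvgP (@mass_sum_cvg R mu mu_ge0 mu_cvg j (fun m => (- ln m - l j <= x)%R%:R) 1 _).
  by move=> m _; rewrite ler0n lern1 leq_b1.
- by case: sl => -[-> _]; [left|right].
- apply: filterS3 yS adm (nbhs_infty_gt 0%N) => d yd [r [ur rB]] d0 theta H th0 HH.
  have [mY Y0 Ycov] := field d d0.
  have /complexityP[//|_ en _] := field_admissible_upper X0 Xc eig basic mY Y0 Ycov eps_ge0 ur rB.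
  have := field_admissible_lower X0 Xc eig basic mY Y0 Ycov eps_ge0 th0 HH en.
  rewrite -/(T d) -/(n d) => h.
  suff : (1 - eps ^+ 2) * T d <= B d + H + theta * (n d)%:R by rewrite -/(S d) yd; lra.
  exact: h.
- apply: filterS2 yS (nbhs_infty_gt 0%N) => d yd d0 r ur; rewrite -/(S d) yd => rB.
  have [mY Y0 Ycov] := field d d0.
  by have /complexityP[//|_ _] := field_admissible_upper X0 Xc eig basic mY Y0 Ycov eps_ge0 ur rB.
Qed.
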